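(* Suppose that the Jacobi operator $J$ is positive and that the inverse $J_F^{-1}$ of its Friedrichs extension $J_F$ belongs to the Schatten class $\mathcal{S}_k$ for some $k\in\{1,2,\ldots\}$. Then $$\lim_{n\to\infty}\det\big[E_{k-1}\big(z\mathcal{J}_n^{-1}\big)\big]=\mathfrak{F}_k(z)$$ locally uniformly with respect to $z\in\mathbb{C}$.
   Context: Let $(a_n)_{n\ge0}$ be positive numbers, $(b_n)_{n\ge0}$ real numbers. The Jacobi operator $J$ is the closure in $\ell^2(\mathbb{N}_0)$, $\mathbb{N}_0=\{0,1,2,\dots\}$, of the action on finitely supported sequences of the infinite symmetric tridiagonal matrix $\mathcal{J}$ with diagonal entries $b_0,b_1,\dots$ and off-diagonal entries $a_0,a_1,\dots$. If $J$ is self-adjoint then $J_F=J$. Under the hypotheses $\sigma(J_F)=\{\zeta_j:j\ge1\}$ with $0<\zeta_1<\zeta_2<\cdots$ simple eigenvalues and $\sum_j\zeta_j^{-k}<\infty$. For $n\ge1$, $\mathcal{J}_n$ is the $n\times n$ upper-left truncation of $\mathcal{J}$ (diagonal $b_0,\dots,b_{n-1}$, off-diagonal $a_0,\dots,a_{n-2}$); it is invertible under the hypotheses. The elementary factors are the entire functions $$E_n(w)=(1-w)\exp\Big(\sum_{j=1}^n\tfrac1j w^j\Big),\qquad n\ge0,$$ and $E_{k-1}$ of a matrix is defined by holomorphic functional calculus. The regularized characteristic function of $J_F$ is the entire function $$\mathfrak{F}_k(z)=\prod_{j=1}^\infty E_{k-1}\Big(\frac{z}{\zeta_j}\Big).$$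 *)

(* Defs.v *)
From mathcomp Require Import all_boot all_order all_algebra.
From mathcomp Require Export complex.
From mathcomp Require Import all_classical all_reals all_analysis.

Set Implicit Arguments.
Unset Strict Implicit.
Unset Printing Implicit Defensive.

Import Order.TTheory GRing.Theory Num.Theory numFieldNormedType.Exports.

Local Open Scope complex_scope.
Local Open Scope classical_set_scope.
Local Open Scope ring_scope.

(* [R[i]] bundled as a [numClosedFieldType]: this gives it the topology and
   uniformity that MathComp-Analysis puts on every numeric field. *)
Definition Cplx (R : realType) : numClosedFieldType := R[i].

Section SequenceSpace.
Variable R : realType.
Local Notation C := (Cplx R).
Implicit Types x y : nat -> C.

(* [|x|^2], with value [+oo] when [x] is not square summable. *)
Definition l2sqnorm x : \bar R :=
  (\sum_(0 <= n <oo) (Normc.normc (x n) ^+ 2)%:E)%E.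

Definition l2 : set (nat -> C) := [set x | (l2sqnorm x < +oo)%E].

(* Antilinear in the first argument; meaningful for [x] and [y] in [l2]. *)
Definition inner x y : C := limn (series (fun n => (x n)^* * y n)).

Definition l2_cvg (u : nat -> nat -> C) x : Prop :=
  l2sqnorm (fun n => u m n - x n) @[m --> \oo] --> 0%E.

End SequenceSpace.

(* An operator in [l2], in general unbounded, is given by its graph, the set of
   all pairs [(u, T u)] with [u] in the domain of [T]. *)
Section Operators.
Variable R : realType.
Local Notation C := (Cplx R).
Local Notation op := (set ((nat -> C) * (nat -> C))).
Implicit Types (T : op) (z : C).

Definition op_closure T : op :=
  [set p | [/\ l2 p.1, l2 p.2 &
     exists q : nat -> (nat -> C) * (nat -> C),
       [/\ forall m, T (q m),
           l2_cvg (fun m => (q m).1) p.1 & l2_cvg (fun m => (q m).2) p.2]]].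

Definition op_inv T : op := [set p | T (p.2, p.1)].

Definition adjoint T : op :=
  [set p | [/\ l2 p.1, l2 p.2 &
     forall q, T q -> inner p.1 q.2 = inner p.2 q.1]].

(* In [R[i]], [0 <= w] means that [w] is real and nonnegative. *)
Definition positive_op T : Prop := forall p, T p -> 0 <= inner p.1 p.2.

(* Domain of the closure of the form [u, v |-> <u, T v>]. *)
Definition form_domain T : set (nat -> C) :=
  [set u | l2 u /\
     exists q : nat -> (nat -> C) * (nat -> C),
       [/\ forall m, T (q m),
           l2_cvg (fun m => (q m).1) u &
           forall e : C, 0 < e -> exists N, forall m n,
             (N <= m)%N -> (N <= n)%N ->
             `|inner (fun i => (q m).1 i - (q n).1 i)
                     (fun i => (q m).2 i - (q n).2 i)| < e]].

(* Friedrichs extension of a positive densely defined operator: the restriction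
   of the adjoint to the form domain (Freudenthal's description). *)
Definition friedrichs T : op := [set p | form_domain T p.1 /\ adjoint T p].

(* [T - z] is onto [l2] and has a bounded inverse; the estimate contains
   injectivity. *)
Definition resolvent_set T : set C :=
  [set z | (forall g, l2 g -> exists2 p, T p & g = (fun n => p.2 n - z * p.1 n))
    /\ exists M : R, forall p, T p ->
         (l2sqnorm p.1 <= M%:E * l2sqnorm (fun n => p.2 n - z * p.1 n)%R)%E].

Definition spectrum T : set C := ~` resolvent_set T.

Definition simple_eigenvalue T z : Prop :=
  exists v : nat -> C,
    [/\ T (v, fun n => z * v n), exists n, v n != 0 &
        forall u, T (u, fun n => z * u n) ->
          exists c : C, u = (fun n => c * v n)].

(* Everywhere defined bounded linear operator; linearity and the bound make the
   relation [T] single-valued. *)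
Definition bounded_op T : Prop :=
  [/\ forall p, T p -> l2 p.1 /\ l2 p.2,
      forall u, l2 u -> exists f, T (u, f),
      forall (c : C) p q, T p -> T q ->
        T (fun n => c * p.1 n + q.1 n, fun n => c * p.2 n + q.2 n) &
      exists M : R, forall p, T p -> (l2sqnorm p.2 <= M%:E * l2sqnorm p.1)%E].

Definition compact_op T : Prop :=
  bounded_op T /\
  forall q : nat -> (nat -> C) * (nat -> C),
    (forall m, T (q m)) ->
    (exists M : R, forall m, (l2sqnorm (q m).1 <= M%:E)%E) ->
    exists (h : nat -> nat) (f : nat -> C),
      [/\ {homo h : m n / (m < n)%N}, l2 f & l2_cvg (fun m => (q (h m)).2) f].

Definition hilbert_basis (e : nat -> nat -> C) : Prop :=
  [/\ forall i, l2 (e i),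
      forall i j, inner (e i) (e j) = (i == j)%:R &
      forall u, l2 u -> (forall i, inner (e i) u = 0) -> forall n, u n = 0].

(* [s] lists, with multiplicity and possibly with zeros, the eigenvalues of
   [|T| = (T^* T)^(1/2)]: [T^* T e_j = s_j^2 e_j] for a Hilbert basis [e]. *)
Definition singular_values T (s : nat -> R) : Prop :=
  (forall j, 0 <= s j) /\
  exists2 e : nat -> nat -> C, hilbert_basis e &
    forall j, exists2 f, T (e j, f) &
      adjoint T (f, fun n => (s j ^+ 2)%:C * e j n).

Definition schatten (k : nat) T : Prop :=
  compact_op T /\
  exists2 s, singular_values T s &
    (\sum_(0 <= j <oo) (s j ^+ k)%:E < +oo)%E.

End Operators.

Section Jacobi.
Variables (R : realType) (a b : nat -> R).
Local Notation C := (Cplx R).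

Definition jacobi_entry (i j : nat) : R :=
  if i == j then b i
  else if j == i.+1 then a i
  else if i == j.+1 then a j
  else 0.

(* Row [i] vanishes beyond column [i.+1], so the row sums are finite. *)
Definition jacobi_act (u : nat -> C) : nat -> C :=
  fun i => \sum_(j < i.+2) (jacobi_entry i j)%:C * u j.

Definition jacobi_op : set ((nat -> C) * (nat -> C)) :=
  op_closure [set p | (exists N, forall n, (N <= n)%N -> p.1 n = 0)
                      /\ p.2 = jacobi_act p.1].

Definition jacobi_trunc (n : nat) : 'M[C]_n :=
  \matrix_(i < n, j < n) (jacobi_entry i j)%:C.

End Jacobi.

Section EntireFunctions.
Variable R : realType.
Local Notation C := (Cplx R).

Definition cexp (w : C) : C :=
  (expR (complex.Re w))%:C * (cos (complex.Im w) +i* sin (complex.Im w)).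

Definition elem_factor (n : nat) (w : C) : C :=
  (1 - w) * cexp (\sum_(1 <= j < n.+1) w ^+ j / j%:R).

(* Meaningful when the product converges, which it does as soon as
   [\sum_j zeta_j ^- k] is finite. *)
Definition reg_char_fun (k : nat) (zeta : nat -> R) (z : C) : C :=
  limn (fun N => \prod_(0 <= j < N) elem_factor k.-1 (z / (zeta j)%:C)).

Definition integral_2pi (g : R -> C) : C :=
  (\int[lebesgue_measure]_(t in `[0, 2 * pi]) complex.Re (g t)) +i*
  (\int[lebesgue_measure]_(t in `[0, 2 * pi]) complex.Im (g t)).

(* The integral of [g] along the circle [t |-> r e^(it)], where [dw = i w dt]. *)
Definition circle_integral (r : C) (g : C -> C) : C :=
  integral_2pi (fun t => let w := r * (cos t +i* sin t) in g w * ('i%C * w)).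

(* Exceeds the modulus of every eigenvalue of [A]. *)
Definition hfc_radius (n : nat) (A : 'M[C]_n) : C :=
  1 + \sum_(i < n) \sum_(j < n) `|A i j|.

(* Holomorphic functional calculus [f(A) = (2 pi i)^-1 \oint f(w) (w - A)^-1 dw]
   for entire [f]; by Cauchy's theorem the choice of a circle enclosing the
   eigenvalues of [A] does not matter. *)
Definition hfc (f : C -> C) (n : nat) (A : 'M[C]_n) : 'M[C]_n :=
  \matrix_(i < n, j < n)
    (((2 * pi)%:C * 'i%C)^-1 *
       circle_integral (hfc_radius A) (fun w => f w * invmx (w%:M - A) i j)).

Definition locally_uniform_cvg (f : nat -> C -> C) (F : C -> C) : Prop :=
  forall z : C, exists2 U : set C, nbhs z U & {uniform U, f @ \oo --> F}.

End EntireFunctions.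

(* [zeta] is the increasing enumeration of the spectrum of [T], which consists
   of positive simple eigenvalues with [\sum_j zeta_j ^- k] finite. Being
   strictly increasing with range [spectrum T], [zeta] is unique. *)
Definition spectral_sequence (R : realType) (k : nat)
    (T : set ((nat -> Cplx R) * (nat -> Cplx R))) (zeta : nat -> R) : Prop :=
  [/\ 0 < zeta 0%N, {homo zeta : m n / (m < n)%N >-> m < n},
      spectrum T = [set ((zeta j)%:C : Cplx R) | j in [set: nat]],
      forall j, simple_eigenvalue T (zeta j)%:C &
      (\sum_(0 <= j <oo) (zeta j ^- k)%:E < +oo)%E].

(* Main.v *)
(* Let T be the inverse of the Friedrichs extension J_F.  Approximating in the
   form domain shows that T is symmetric and nonnegative and that
     <x, T x> = sup_y (2 Re <y, x> - <y, J y>),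
   the supremum being over finitely supported y, while J_n^-1 gives the same
   supremum over y supported in {0, ..., n-1}.  A singular vector of T with
   singular value s is an eigenvector with eigenvalue s, because f = T e - s e
   satisfies T f = - s f; the three-term recurrence makes all these eigenvalues
   simple, so they can be listed decreasingly as s_0 > s_1 > ..., and the
   spectrum of J_F consists of the numbers 1 / s_j.

   Let mu_0 >= mu_1 >= ... be the eigenvalues of J_n^-1.  Courant-Fischer gives
   mu_i <= s_i.  Conversely, testing the supremum on the eigenvectors of T gives
   \sum_(i < M) s_i <= \sum_(i < M) mu_i + o(1) as n grows, by Ky Fan, so that
   mu_i tends to s_i.  The determinant is the product of the E_(k-1)(z mu_i), by
   Cauchy's formula for the functional calculus, and the domination
   |E_(k-1)(w) - 1| <= C |w|^k together with \sum_i s_i^k < oo lets one pass to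
   the limit in the product, locally uniformly in z. *)
Require Import Defs.
From mathcomp Require Import all_boot all_order all_algebra.
From mathcomp Require Import all_classical all_reals all_analysis.
From mathcomp Require Import zify ring lra.
Set Implicit Arguments.
Unset Strict Implicit.
Unset Printing Implicit Defensive.
Import Order.TTheory GRing.Theory Num.Theory numFieldNormedType.Exports.
Local Open Scope classical_set_scope.
Local Open Scope ring_scope.


(** * Complex moduli and limits *)

(** The matrix, its truncations and [T] meet only in the quadratic form on finitely supported
    vectors, so every comparison is made there. Positivity also supplies symmetry: a form that is
    nonnegative at all [x + t y] is Hermitian and satisfies Cauchy-Schwarz, and one polarization
    lemma serves both [J] and [T]. Simplicity of the spectrum reconciles the two sides of the limit:
    the determinant counts eigenvalues with multiplicity, while [zeta] runs over distinct spectral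
    points. The bound [mu_i <= s_i] is used twice: it dominates the products uniformly in [n], and
    it makes each difference [s_i - mu_i] nonnegative, so that the Ky Fan estimate of their sum
    controls absolute values. For the elementary factors the delicate point is a Lipschitz constant
    of order [r ^ m] on the disc of radius [r], where [m = k - 1]; it yields both the exponent [k]
    in the domination and the continuity needed as [mu_i] tends to [s_i]. The polynomials that
    provide it also serve as approximants in Cauchy's formula. *)

Section ComplexModulus.
Variable R : realType.
Local Notation C := (Cplx R).
Implicit Types (z w : C) (x y : R).

Definition cabs z : R := Normc.normc z.
Definition rc x : C := (real_complex R x).

Lemma normE z : `|z| = rc (cabs z). Proof. by []. Qed.

Lemma rcI : injective rc. Proof. by move=> x y []. Qed.
Lemma rcD x y : rc (x + y) = rc x + rc y. Proof. exact: (rmorphD (real_complex R)). Qed.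
Lemma rcB x y : rc (x - y) = rc x - rc y. Proof. exact: (rmorphB (real_complex R)). Qed.
Lemma rcN x : rc (- x) = - rc x. Proof. exact: (rmorphN (real_complex R)). Qed.
Lemma rcM x y : rc (x * y) = rc x * rc y. Proof. exact: (rmorphM (real_complex R)). Qed.
Lemma rcX x n : rc (x ^+ n) = rc x ^+ n. Proof. exact: (rmorphXn (real_complex R)). Qed.
Lemma rcV x : rc (x^-1) = (rc x)^-1. Proof. exact: (fmorphV (real_complex R)). Qed.
Lemma rc0 : rc 0 = 0. Proof. by []. Qed.
Lemma rc1 : rc 1 = 1. Proof. by []. Qed.
Lemma rc_nat n : rc n%:R = n%:R. Proof. exact: (rmorph_nat (real_complex R)). Qed.
Lemma rc_eq0 x : (rc x == 0) = (x == 0).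
Proof. by rewrite -rc0 (inj_eq rcI). Qed.
Lemma rc_sum (I : Type) (r : seq I) (P : pred I) (F : I -> R) :
  rc (\sum_(i <- r | P i) F i) = \sum_(i <- r | P i) rc (F i).
Proof. exact: (rmorph_sum (real_complex R)). Qed.

Lemma rc_le x y : (rc x <= rc y) = (x <= y). Proof. exact: lecR. Qed.
Lemma rc_lt x y : (rc x < rc y) = (x < y). Proof. exact: ltcR. Qed.

Lemma cabs_ge0 z : 0 <= cabs z.
Proof. by rewrite -rc_le -normE normr_ge0. Qed.
Lemma cabs0 : cabs 0 = 0. Proof. by apply: rcI; rewrite -normE normr0. Qed.
Lemma cabs1 : cabs 1 = 1. Proof. by apply: rcI; rewrite -normE normr1. Qed.
Lemma cabs_eq0 z : (cabs z == 0) = (z == 0).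
Proof. by rewrite -rc_eq0 -normE normr_eq0. Qed.
Lemma cabsM z w : cabs (z * w) = cabs z * cabs w.
Proof. by apply: rcI; rewrite rcM -!normE normrM. Qed.
Lemma cabsN z : cabs (- z) = cabs z.
Proof. by apply: rcI; rewrite -!normE normrN. Qed.
Lemma cabsD z w : cabs (z + w) <= cabs z + cabs w.
Proof. by rewrite -rc_le rcD -!normE ler_normD. Qed.
Lemma cabsB z w : cabs (z - w) <= cabs z + cabs w.
Proof. by rewrite -(cabsN w) cabsD. Qed.
Lemma cabs_distrC z w : cabs (z - w) = cabs (w - z).
Proof. by rewrite -cabsN opprB. Qed.
Lemma cabsX z n : cabs (z ^+ n) = cabs z ^+ n.
Proof. by apply: rcI; rewrite rcX -!normE normrX. Qed.
Lemma cabsV z : cabs z^-1 = (cabs z)^-1.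
Proof. by apply: rcI; rewrite rcV -!normE normfV. Qed.
Lemma cabs_rc x : cabs (rc x) = `|x|.
Proof. by apply: rcI; rewrite -normE normc_def /= expr0n addr0 sqrtr_sqr. Qed.
Lemma cabs_nat n : cabs n%:R = n%:R.
Proof. by rewrite -rc_nat cabs_rc normr_nat. Qed.
Lemma cabs_sum (I : Type) (r : seq I) (P : pred I) (F : I -> C) :
  cabs (\sum_(i <- r | P i) F i) <= \sum_(i <- r | P i) cabs (F i).
Proof. by rewrite -rc_le rc_sum -normE ler_norm_sum. Qed.
Lemma cabs_conj z : cabs z^* = cabs z.
Proof. by apply: rcI; rewrite -!normE norm_conjC. Qed.
Lemma conj_mul z : z^* * z = rc (cabs z ^+ 2).
Proof. by rewrite rcX -normE normCK mulrC. Qed.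
Lemma rc_conj x : (rc x)^* = rc x.
Proof. exact: conjc_real. Qed.

Lemma cReD z w : complex.Re (z + w) = complex.Re z + complex.Re w.
Proof. by case: z w => [a b] [c d]. Qed.
Lemma cImD z w : complex.Im (z + w) = complex.Im z + complex.Im w.
Proof. by case: z w => [a b] [c d]. Qed.
Lemma cReN z : complex.Re (- z) = - complex.Re z.
Proof. by case: z. Qed.
Lemma cImN z : complex.Im (- z) = - complex.Im z.
Proof. by case: z. Qed.
Lemma cReM z w :
  complex.Re (z * w) = complex.Re z * complex.Re w - complex.Im z * complex.Im w.
Proof. by case: z w => [a b] [c d]. Qed.
Lemma cImM z w :
  complex.Im (z * w) = complex.Re z * complex.Im w + complex.Im z * complex.Re w.
Proof. by case: z w => [a b] [c d]. Qed.
Lemma cRe_conj z : complex.Re z^* = complex.Re z.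
Proof. by case: z. Qed.
Lemma cIm_conj z : complex.Im z^* = - complex.Im z.
Proof. by case: z. Qed.
Lemma cRe_sum (I : Type) (r : seq I) (P : pred I) (F : I -> C) :
  complex.Re (\sum_(i <- r | P i) F i) = \sum_(i <- r | P i) complex.Re (F i).
Proof. by apply: (big_morph _ cReD). Qed.
Lemma cIm_sum (I : Type) (r : seq I) (P : pred I) (F : I -> C) :
  complex.Im (\sum_(i <- r | P i) F i) = \sum_(i <- r | P i) complex.Im (F i).
Proof. by apply: (big_morph _ cImD). Qed.

Lemma cplx_eq z w :
  complex.Re z = complex.Re w -> complex.Im z = complex.Im w -> z = w.
Proof. by case: z w => [a b] [c d] /= -> ->. Qed.

Lemma cabs_sqr z : cabs z ^+ 2 = complex.Re z ^+ 2 + complex.Im z ^+ 2.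
Proof. by apply: rcI; rewrite rcX -normE -add_Re2_Im2. Qed.
Lemma Re_le_cabs z : `|complex.Re z| <= cabs z.
Proof. by rewrite -rc_le; exact: normc_ge_Re. Qed.
Lemma Im_le_cabs z : `|complex.Im z| <= cabs z.
Proof.
rewrite -(@ler_pXn2r _ 2) ?nnegrE ?cabs_ge0 //.
by rewrite real_normK ?num_real // cabs_sqr lerDr sqr_ge0.
Qed.
Lemma cabs_le_ReIm z : cabs z <= `|complex.Re z| + `|complex.Im z|.
Proof.
rewrite -(@ler_pXn2r _ 2) ?nnegrE ?cabs_ge0 ?addr_ge0 //.
rewrite cabs_sqr sqrrD !real_normK ?num_real // addrAC lerDl.
by rewrite mulrn_wge0 // mulr_ge0.
Qed.
Lemma ge0C z : 0 <= z -> z = rc (complex.Re z) /\ 0 <= complex.Re z.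
Proof. by case: z => a b; rewrite lecE /= => /andP[/eqP -> h]. Qed.

(** Distances in the topology of [Cplx R] are themselves elements of [Cplx R]; a positive one is
    real, so real epsilons suffice. *)
Lemma cvgC_dist (u : nat -> C) (l : C) :
  u @ \oo --> l <->
  forall e : R, 0 < e -> exists N, forall n, (N <= n)%N -> cabs (u n - l) < e.
Proof.
split=> [/cvgrPdistC_lt h e e0|h].
  have := h (rc e); rewrite -[X in X < _]rc0 rc_lt => /(_ e0) [N _ hN].
  by exists N => n Nn; have := hN n Nn; rewrite /= normE rc_lt.
apply/cvgrPdistC_lt => e e0.
have [e1 e2] := ge0C (ltW e0).
have {}e0 : 0 < complex.Re e by rewrite -rc_lt -e1.
have [N hN] := h _ e0; exists N => // n Nn.
by rewrite e1 normE rc_lt; exact: hN.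
Qed.

Lemma cvgR_dist (u : nat -> R) (l : R) :
  u @ \oo --> l <->
  forall e : R, 0 < e -> exists N, forall n, (N <= n)%N -> `|u n - l| < e.
Proof.
split=> [/cvgrPdistC_lt h e e0|h].
  by have [N _ hN] := h e e0; exists N => n Nn; exact: hN.
apply/cvgrPdistC_lt => e e0; have [N hN] := h _ e0.
by exists N => // n Nn; exact: hN.
Qed.

Lemma cvg_Re (u : nat -> C) (l : C) :
  u @ \oo --> l -> (fun n => complex.Re (u n)) @ \oo --> complex.Re l.
Proof.
move=> /cvgC_dist h; apply/cvgR_dist => e /h[N hN]; exists N => n /hN.
by apply: le_lt_trans; rewrite -cReN -cReD Re_le_cabs.
Qed.

Lemma cvg_Im (u : nat -> C) (l : C) :
  u @ \oo --> l -> (fun n => complex.Im (u n)) @ \oo --> complex.Im l.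
Proof.
move=> /cvgC_dist h; apply/cvgR_dist => e /h[N hN]; exists N => n /hN.
by apply: le_lt_trans; rewrite -cImN -cImD Im_le_cabs.
Qed.

Lemma cvg_ReIm (u : nat -> C) (l : C) :
  (fun n => complex.Re (u n)) @ \oo --> complex.Re l ->
  (fun n => complex.Im (u n)) @ \oo --> complex.Im l -> u @ \oo --> l.
Proof.
move=> /cvgR_dist h1 /cvgR_dist h2; apply/cvgC_dist => e e0.
have e2 : 0 < e / 2 by rewrite divr_gt0.
have [N1 hN1] := h1 _ e2; have [N2 hN2] := h2 _ e2.
exists (maxn N1 N2) => n; rewrite geq_max => /andP[n1 n2].
apply: le_lt_trans (cabs_le_ReIm _) _.
by rewrite [ltRHS]splitr cReD cImD cReN cImN ltrD ?hN1 ?hN2.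
Qed.

Lemma cvg_conj (u : nat -> C) (l : C) :
  u @ \oo --> l -> (fun n => (u n)^*) @ \oo --> l^*.
Proof.
move=> /cvgC_dist h; apply/cvgC_dist => e /h[N hN]; exists N => n /hN.
by rewrite -rmorphB cabs_conj.
Qed.

Lemma cvg_cabs (u : nat -> C) (l : C) :
  u @ \oo --> l -> (fun n => cabs (u n)) @ \oo --> cabs l.
Proof.
move=> /cvgC_dist h; apply/cvgR_dist => e /h[N hN]; exists N => n /hN.
by apply: le_lt_trans; rewrite -cabs_rc rcB -!normE -rc_le -!normE ler_dist_dist.
Qed.

Lemma cvgC_rc (u : nat -> R) (l : R) :
  u @ \oo --> l -> (fun n => rc (u n)) @ \oo --> rc l.
Proof.
move=> /cvgR_dist h; apply/cvgC_dist => e /h[N hN]; exists N => n /hN.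
by rewrite -rcB cabs_rc.
Qed.

Lemma cvgR_series_abs (u : nat -> R) (M : R) :
  (forall N, \sum_(0 <= n < N) `|u n| <= M) -> cvgn (series u).
Proof.
move=> h; apply: normed_cvg; apply: nondecreasing_is_cvgn.
  by apply/nondecreasing_series => n _ _; exact: normr_ge0.
by exists M => _ [N _ <-]; exact: h.
Qed.

Lemma cvgC_series_abs (u : nat -> C) (M : R) :
  (forall N, \sum_(0 <= n < N) cabs (u n) <= M) -> cvgn (series u).
Proof.
move=> h.
have hR : cvgn (series (fun n => complex.Re (u n))).
  apply: (@cvgR_series_abs _ M) => N; apply: le_trans (h N).
  by apply: ler_sum => i _; exact: Re_le_cabs.
have hI : cvgn (series (fun n => complex.Im (u n))).
  apply: (@cvgR_series_abs _ M) => N; apply: le_trans (h N).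
  by apply: ler_sum => i _; exact: Im_le_cabs.
apply/cvg_ex; exists (Complex (limn (series (fun n => complex.Re (u n))))
  (limn (series (fun n => complex.Im (u n))))).
apply: cvg_ReIm => /=.
  by under eq_fun do rewrite cRe_sum; exact: hR.
by under eq_fun do rewrite cIm_sum; exact: hI.
Qed.

Lemma cvgC_lim (u : nat -> C) (l : C) : u @ \oo --> l -> limn u = l.
Proof. by move=> h; apply: cvg_lim => //; exact: norm_hausdorff. Qed.

Lemma cvgC_unique (u : nat -> C) (l l' : C) :
  u @ \oo --> l -> u @ \oo --> l' -> l = l'.
Proof. by move=> /cvgC_lim <- /cvgC_lim <-. Qed.

Lemma cvgR_unique (u : nat -> R) (l l' : R) :
  u @ \oo --> l -> u @ \oo --> l' -> l = l'.
Proof. by move=> h1 h2; apply: cvg_unique h1 h2; exact: norm_hausdorff. Qed.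

Lemma cvgR_le (u : nat -> R) (l M : R) N :
  u @ \oo --> l -> (forall n, (N <= n)%N -> u n <= M) -> l <= M.
Proof.
move=> hu hM; rewrite -(cvg_lim (@norm_hausdorff _ _) hu).
apply: limr_le; first by apply/cvg_ex; exists l.
by exists N => // n; exact: hM.
Qed.

Lemma cvgR_ge (u : nat -> R) (l M : R) N :
  u @ \oo --> l -> (forall n, (N <= n)%N -> M <= u n) -> M <= l.
Proof.
move=> hu hM; rewrite -(cvg_lim (@norm_hausdorff _ _) hu).
apply: limr_ge; first by apply/cvg_ex; exists l.
by exists N => // n; exact: hM.
Qed.

End ComplexModulus.


(** * The sequence space *)

Section NonnegSeries.
Variable R : realType.
Implicit Types u : nat -> R.

Lemma nneseries_ge_psum u N : (forall n, 0 <= u n) ->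
  ((\sum_(0 <= n < N) u n)%:E <= \sum_(0 <= n <oo) (u n)%:E)%E.
Proof.
move=> u0; rewrite -sumEFin.
by apply: nneseries_lim_ge => n _ _; rewrite lee_fin.
Qed.

Lemma nneseries_le_bound u M : (forall n, 0 <= u n) ->
  (forall N, \sum_(0 <= n < N) u n <= M) ->
  (\sum_(0 <= n <oo) (u n)%:E <= M%:E)%E.
Proof.
move=> u0 h; apply: lime_le.
  by apply: is_cvg_nneseries => n _ _; rewrite lee_fin.
by apply: nearW => N; rewrite sumEFin lee_fin; exact: h.
Qed.

Lemma nneseries_ltyP u : (forall n, 0 <= u n) ->
  (\sum_(0 <= n <oo) (u n)%:E < +oo)%E <->
  exists M, forall N, \sum_(0 <= n < N) u n <= M.
Proof.
move=> u0; split=> [h|[M hM]]; last first.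
  by apply: le_lt_trans (nneseries_le_bound u0 hM) _; rewrite ltry.
have fin : (\sum_(0 <= n <oo) (u n)%:E)%E \is a fin_num.
  by rewrite ge0_fin_numE //; apply: nneseries_ge0 => n _ _; rewrite lee_fin.
exists (fine (\sum_(0 <= n <oo) (u n)%:E)%E) => N.
by rewrite -lee_fin fineK //; exact: nneseries_ge_psum.
Qed.

End NonnegSeries.

Section HermitianNumbers.
Variable R : realType.
Local Notation C := (Cplx R).

(* Polarization: a sesquilinear form that is only known to be nonnegative is
   Hermitian and satisfies the Cauchy-Schwarz inequality. *)
Lemma nonneg_quadratic (al de : R) (b b' : C) :
  (forall t : C, 0 <= rc al + t * b + t^* * b' + rc (cabs t ^+ 2 * de)) ->
  b' = b^* /\ cabs b ^+ 2 <= al * de.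
Proof.
move=> h.
have imh t : complex.Im (t * b + t^* * b') = 0.
  have [+ _] := ge0C (h t).
  by move/(congr1 (@complex.Im R)); rewrite !cImD /= add0r addr0.
(* The values [t = 1] and [t = i] give two real linear equations that determine [b']. *)
have hb : b' = b^*.
  have := imh 1; have := imh (Complex 0 1).
  rewrite !cImD !cImM !cRe_conj !cIm_conj /=; case: b b' {h imh} => [x y] [x' y'] /=.
  by move=> h1 h2; apply: cplx_eq => /=; lra.
split=> //.
have hq t : 0 <= al + 2 * complex.Re (t * b) + cabs t ^+ 2 * de.
  have [_] := ge0C (h t).
  by rewrite !cReD /= hb -rmorphM cRe_conj; lra.
set B := cabs b ^+ 2.
have B0 : 0 <= B by rewrite sqr_ge0.
(* With [t = - x b^*] the product [t * b] is real, which leaves a real quadratic in [x]. *)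
have hr (x : R) : 0 <= al - 2 * x * B + x ^+ 2 * B * de.
  have := hq (- rc x * b^*).
  rewrite cabsM cabs_conj cabsN cabs_rc exprMn real_normK ?num_real //.
  by rewrite -[_ * _ * b]mulrA conj_mul -rcN -rcM /= -/B; lra.
have al0 : 0 <= al by have := hr 0; lra.
(* If [de < 0], take [t] and [-t] with [t ^ 2 = (al + 1) / - de]: the two inequalities add up to
   [0 <= -2]. *)
have de0 : 0 <= de.
  rewrite leNgt; apply/negP => de0.
  have := hq (rc (Num.sqrt ((al + 1) / - de))); have := hq (- rc (Num.sqrt ((al + 1) / - de))).
  rewrite !mulNr !cReN cabsN cabs_rc real_normK ?num_real // sqr_sqrtr.
    by rewrite invrN !mulrN mulNr mulfVK ?lt_eqF //; lra.
  by rewrite divr_ge0 ?oppr_ge0 ?(ltW de0) // addr_ge0.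
have [->|Bn0] := eqVneq B 0; first by rewrite mulr_ge0.
have Bp : 0 < B by rewrite lt_neqAle eq_sym Bn0.
have [d0|dp] := eqVneq de 0.
  have := hr ((al + 1) / B); rewrite d0 mulr0 addr0 -mulrA mulfVK //; lra.
(* The quadratic in [x] has its minimum at [1 / de]. *)
have := hr (de^-1).
have -> : de^-1 ^+ 2 * B * de = B / de by field.
rewrite -mulrA [_^-1 * B]mulrC -(@ler_pM2r _ de) ?lt_neqAle ?de0 1?eq_sym ?dp //.
have -> : (al - 2 * (B / de) + B / de) * de = al * de - B by field.
by rewrite mul0r subr_ge0.
Qed.

Lemma cvgC_ext (u v : nat -> C) (l : C) :
  u =1 v -> u @ \oo --> l -> v @ \oo --> l.
Proof. by move=> /funext ->. Qed.

Lemma cvgR_ext (u v : nat -> R) (l : R) :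
  u =1 v -> u @ \oo --> l -> v @ \oo --> l.
Proof. by move=> /funext ->. Qed.

End HermitianNumbers.

Section L2Space.
Variable R : realType.
Local Notation C := (Cplx R).
Implicit Types (x y w : nat -> C) (c : C).

(** Since [fine] sends [+oo] to [0], this is the squared norm only on [l2]; the hypotheses [l2]
    below guard against that default. *)
Definition nrm2 x : R := fine (l2sqnorm x).

Lemma l2_ext x y : x =1 y -> l2 x -> l2 y.
Proof. by move=> /funext ->. Qed.
Lemma inner_ext x x' y y' : x =1 x' -> y =1 y' -> inner x y = inner x' y'.
Proof. by move=> /funext -> /funext ->. Qed.
Lemma nrm2_ext x y : x =1 y -> nrm2 x = nrm2 y.
Proof. by move=> /funext ->. Qed.

Lemma nrm2_distC x y :
  nrm2 (fun n => x n - y n) = nrm2 (fun n => y n - x n).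
Proof.
congr fine; apply: eq_eseriesr => n _; congr (_ ^+ 2)%:E.
exact: cabs_distrC.
Qed.

Lemma l2P x : l2 x <->
  exists M : R, forall N, \sum_(0 <= n < N) cabs (x n) ^+ 2 <= M.
Proof. by apply: nneseries_ltyP => n; exact: sqr_ge0. Qed.

Lemma l2_nrm2 x : l2 x -> l2sqnorm x = (nrm2 x)%:E.
Proof.
move=> h; rewrite /nrm2 fineK // ge0_fin_numE //.
by apply: nneseries_ge0 => n _ _; rewrite lee_fin sqr_ge0.
Qed.

Lemma nrm2_ge_psum x N : l2 x -> \sum_(0 <= n < N) cabs (x n) ^+ 2 <= nrm2 x.
Proof.
move=> h; rewrite -lee_fin -l2_nrm2 //.
by apply: nneseries_ge_psum => n; exact: sqr_ge0.
Qed.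

Lemma nrm2_le x M : (forall N, \sum_(0 <= n < N) cabs (x n) ^+ 2 <= M) ->
  l2 x /\ nrm2 x <= M.
Proof.
move=> h; have lx : l2 x by apply/l2P; exists M.
split=> //; rewrite -lee_fin -l2_nrm2 //.
by apply: nneseries_le_bound => // n; exact: sqr_ge0.
Qed.

Lemma nrm2_ge0 x : 0 <= nrm2 x.
Proof.
by apply/fine_ge0/nneseries_ge0 => n _ _; rewrite lee_fin sqr_ge0.
Qed.

Lemma cabs_le_nrm2 x n : l2 x -> cabs (x n) ^+ 2 <= nrm2 x.
Proof.
move=> lx; apply: le_trans (nrm2_ge_psum n.+1 lx).
by rewrite big_nat_recr //= lerDr sumr_ge0 // => i _; exact: sqr_ge0.
Qed.

Lemma nrm2_eq0 x : l2 x -> nrm2 x = 0 -> forall n, x n = 0.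
Proof.
move=> lx x0 n; apply/eqP; rewrite -cabs_eq0 -sqrf_eq0 eq_le sqr_ge0 andbT.
by rewrite -x0 cabs_le_nrm2.
Qed.

Lemma nrm2_cvg x : l2 x ->
  (fun N => \sum_(0 <= n < N) cabs (x n) ^+ 2) @ \oo --> nrm2 x.
Proof.
move=> lx; have c : cvgn (series (fun n => cabs (x n) ^+ 2)).
  have [M hM] := (l2P x).1 lx.
  apply: (@cvgR_series_abs _ _ M) => N; apply: le_trans (hM N).
  by apply: ler_sum => i _; rewrite ger0_norm // sqr_ge0.
suff -> : nrm2 x = limn (series (fun n => cabs (x n) ^+ 2)) by exact: c.
apply/eqP; rewrite eq_le; apply/andP; split.
  have [] // := @nrm2_le x (limn (series (fun n => cabs (x n) ^+ 2))) _.
  move=> N; apply: (nondecreasing_cvgn_le _ c).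
  by apply/nondecreasing_series => n _ _; exact: sqr_ge0.
by apply: (cvgR_le (N := 0%N) c) => N _; exact: nrm2_ge_psum.
Qed.

Lemma l2_fin x N : (forall n, (N <= n)%N -> x n = 0) -> l2 x.
Proof.
move=> h; apply/l2P; exists (\sum_(0 <= n < N) cabs (x n) ^+ 2) => M.
have [MN|NM] := leqP M N.
  rewrite [X in _ <= X](big_cat_nat _ MN) //= lerDl.
  by rewrite sumr_ge0 // => i _; exact: sqr_ge0.
rewrite (big_cat_nat _ (ltnW NM)) //= gerDl big_nat big1 // => i /andP[Ni _].
by rewrite h // cabs0 expr0n.
Qed.

Lemma l2_0 : l2 (fun=> 0 : C).
Proof. exact: (@l2_fin _ 0%N). Qed.

Lemma nrm2_lin c x y : l2 x -> l2 y ->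
  l2 (fun n => c * x n + y n) /\
  nrm2 (fun n => c * x n + y n) <= 2 * cabs c ^+ 2 * nrm2 x + 2 * nrm2 y.
Proof.
move=> lx ly; apply: nrm2_le => N.
apply: (@le_trans _ _ (\sum_(0 <= n < N)
    (2 * cabs c ^+ 2 * cabs (x n) ^+ 2 + 2 * cabs (y n) ^+ 2))).
  apply: ler_sum => i _.
  have := cabsD (c * x i) (y i); rewrite cabsM.
  have := cabs_ge0 (c * x i + y i); have := cabs_ge0 (x i); have := cabs_ge0 (y i).
  have := cabs_ge0 c.
  move: (cabs c) (cabs (x i)) (cabs (y i)) (cabs (c * x i + y i)) => p q r s.
  move=> p0 r0 q0 s0 h.
  apply: (@le_trans _ _ ((p * q + r) ^+ 2)).
    by rewrite ler_sqr ?nnegrE ?addr_ge0 ?mulr_ge0.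
  by have := sqr_ge0 (p * q - r); nra.
rewrite big_split /= -!mulr_sumr lerD // ler_wpM2l ?nrm2_ge_psum //.
by rewrite mulr_ge0 // sqr_ge0.
Qed.

Lemma l2_lin c x y : l2 x -> l2 y -> l2 (fun n => c * x n + y n).
Proof. by move=> lx ly; have [] := nrm2_lin c lx ly. Qed.

Lemma l2_scale c x : l2 x -> l2 (fun n => c * x n).
Proof.
move=> lx; have := l2_lin c lx l2_0; congr l2.
by apply/funext => n; rewrite addr0.
Qed.

Lemma l2_sub x y : l2 x -> l2 y -> l2 (fun n => x n - y n).
Proof.
move=> lx ly; have := l2_lin (-1) ly lx; congr l2.
by apply/funext => n; rewrite mulN1r addrC.
Qed.

Lemma l2_add x y : l2 x -> l2 y -> l2 (fun n => x n + y n).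
Proof.
move=> lx ly; have := l2_lin 1 lx ly; congr l2.
by apply/funext => n; rewrite mul1r.
Qed.

Lemma l2_sum k (c : nat -> C) (v : nat -> nat -> C) :
  (forall i, (i < k)%N -> l2 (v i)) ->
  l2 (fun n => \sum_(0 <= i < k) c i * v i n).
Proof.
elim: k => [|k IH] h.
  by have := l2_0; congr l2; apply/funext => n; rewrite big_nil.
have := l2_lin (c k) (h k (ltnSn k)) (IH (fun i ik => h i (ltnW ik))).
by congr l2; apply/funext => n; rewrite big_nat_recr //= addrC.
Qed.

Lemma inner_cvg x y : l2 x -> l2 y ->
  series (fun n => (x n)^* * y n) @ \oo --> inner x y.
Proof.
move=> /l2P[M hM] /l2P[M' hM'].
apply: (@cvgC_series_abs _ _ (M + M')) => N.
apply: (@le_trans _ _ (\sum_(0 <= n < N) (cabs (x n) ^+ 2 + cabs (y n) ^+ 2))).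
  apply: ler_sum => i _; rewrite cabsM cabs_conj.
  have := sqr_ge0 (cabs (x i) - cabs (y i)).
  have := sqr_ge0 (cabs (x i)); have := sqr_ge0 (cabs (y i)); nra.
by rewrite big_split /= lerD.
Qed.

Lemma inner_linr c w x y : l2 w -> l2 x -> l2 y ->
  inner w (fun n => c * x n + y n) = c * inner w x + inner w y.
Proof.
move=> lw lx ly; apply: cvgC_unique (inner_cvg lw (l2_lin c lx ly)) _.
rewrite (_ : series _ = (fun N => c * series (fun n => (w n)^* * x n) N
    + series (fun n => (w n)^* * y n) N)); last first.
  apply/funext => N; rewrite /series /= mulr_sumr -big_split /=.
  by apply: eq_bigr => i _; rewrite mulrDr mulrCA.
by apply: cvgD (inner_cvg lw ly); apply: cvgMr; exact: inner_cvg.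
Qed.

Lemma inner_conj x y : l2 x -> l2 y -> inner y x = (inner x y)^*.
Proof.
move=> lx ly; apply: cvgC_unique (inner_cvg ly lx) _.
apply: cvgC_ext (cvg_conj (inner_cvg lx ly)) => N.
rewrite /series /= rmorph_sum /=.
by apply: eq_bigr => i _; rewrite rmorphM /= conjCK mulrC.
Qed.

Lemma inner_linl c w x y : l2 w -> l2 x -> l2 y ->
  inner (fun n => c * x n + y n) w = c^* * inner x w + inner y w.
Proof.
move=> lw lx ly; rewrite inner_conj ?inner_linr //; last exact: l2_lin.
by rewrite rmorphD rmorphM /= -!inner_conj.
Qed.

Lemma inner_self x : l2 x -> inner x x = rc (nrm2 x).
Proof.
move=> lx; apply: cvgC_unique (inner_cvg lx lx) _.
apply: cvgC_ext (cvgC_rc (nrm2_cvg lx)) => N.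
rewrite rc_sum; apply: eq_bigr => i _.
by rewrite conj_mul.
Qed.

Lemma sum_tail0 (F : nat -> C) N n : (N <= n)%N ->
  (forall i, (N <= i)%N -> F i = 0) ->
  \sum_(0 <= i < n) F i = \sum_(0 <= i < N) F i.
Proof.
move=> Nn h; rewrite (big_cat_nat _ Nn) //= [X in _ + X = _]big_nat [X in _ + X = _]big1 ?addr0 //.
by move=> i /andP[/h].
Qed.

Lemma inner_finr x y N : (forall n, (N <= n)%N -> y n = 0) ->
  inner x y = \sum_(0 <= n < N) (x n)^* * y n.
Proof.
move=> h; apply: cvgC_lim; apply/cvgC_dist => e e0; exists N => n Nn.
rewrite /series /= (sum_tail0 Nn) ?subrr ?cabs0 // => i Ni.
by rewrite h ?mulr0.
Qed.

Lemma inner_finl x y N : (forall n, (N <= n)%N -> x n = 0) ->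
  inner x y = \sum_(0 <= n < N) (x n)^* * y n.
Proof.
move=> h; apply: cvgC_lim; apply/cvgC_dist => e e0; exists N => n Nn.
rewrite /series /= (sum_tail0 Nn) ?subrr ?cabs0 // => i Ni.
by rewrite h ?conjC0 ?mul0r.
Qed.

Lemma inner0r x : inner x (fun=> 0) = 0.
Proof. by rewrite (@inner_finr _ _ 0%N) // big_nil. Qed.
Lemma inner0l x : inner (fun=> 0) x = 0.
Proof. by rewrite (@inner_finl _ _ 0%N) // big_nil. Qed.

Lemma inner_scaler c w x : l2 w -> l2 x ->
  inner w (fun n => c * x n) = c * inner w x.
Proof.
move=> lw lx; have := inner_linr c lw lx l2_0; rewrite inner0r addr0 => <-.
by apply: inner_ext => n //; rewrite addr0.
Qed.

Lemma inner_scalel c w x : l2 w -> l2 x ->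
  inner (fun n => c * x n) w = c^* * inner x w.
Proof.
move=> lw lx; have := inner_linl c lw lx l2_0; rewrite inner0l addr0 => <-.
by apply: inner_ext => n //; rewrite addr0.
Qed.

Lemma inner_subr w x y : l2 w -> l2 x -> l2 y ->
  inner w (fun n => x n - y n) = inner w x - inner w y.
Proof.
move=> lw lx ly; have := inner_linr (-1) lw ly lx; rewrite mulN1r addrC => <-.
by apply: inner_ext => n //; rewrite mulN1r addrC.
Qed.

Lemma inner_subl w x y : l2 w -> l2 x -> l2 y ->
  inner (fun n => x n - y n) w = inner x w - inner y w.
Proof.
move=> lw lx ly; rewrite inner_conj ?inner_subr //; last exact: l2_sub.
by rewrite rmorphB /= -!inner_conj.
Qed.

Lemma inner_sumr k (c : nat -> C) (v : nat -> nat -> C) w : l2 w ->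
  (forall i, (i < k)%N -> l2 (v i)) ->
  inner w (fun n => \sum_(0 <= i < k) c i * v i n)
    = \sum_(0 <= i < k) c i * inner w (v i).
Proof.
move=> lw; elim: k => [|k IH] h.
  rewrite [RHS]big_nil; transitivity (inner w (fun=> 0)); last exact: inner0r.
  by apply: inner_ext => n //; rewrite big_nil.
have hk i : (i < k)%N -> l2 (v i) by move=> ik; apply: h; exact: ltnW.
rewrite big_nat_recr //= -IH // addrC -inner_linr //; last 2 first.
- exact: h.
- exact: l2_sum.
by apply: inner_ext => n //; rewrite big_nat_recr //= addrC.
Qed.

Lemma inner_suml k (c : nat -> C) (v : nat -> nat -> C) w : l2 w ->
  (forall i, (i < k)%N -> l2 (v i)) ->
  inner (fun n => \sum_(0 <= i < k) c i * v i n) w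
    = \sum_(0 <= i < k) (c i)^* * inner (v i) w.
Proof.
move=> lw lv; rewrite inner_conj // ?inner_sumr //; last exact: l2_sum.
rewrite rmorph_sum /= [LHS]big_nat [RHS]big_nat; apply: eq_bigr => i /andP[_ ik].
by rewrite rmorphM /= -inner_conj //; exact: lv.
Qed.

(** Polarization applied to the squared norm of [x + t y]. *)
Lemma cauchy_schwarz x y : l2 x -> l2 y ->
  cabs (inner x y) ^+ 2 <= nrm2 x * nrm2 y.
Proof.
move=> lx ly.
have [] // := @nonneg_quadratic R (nrm2 x) (nrm2 y) (inner x y) (inner y x) _.
move=> t; suff -> : rc (nrm2 x) + t * inner x y + t^* * inner y x
    + rc (cabs t ^+ 2 * nrm2 y)
    = rc (nrm2 (fun n => t * y n + x n)) by rewrite -rc0 rc_le nrm2_ge0.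
have lt := l2_lin t ly lx.
rewrite -(inner_self lt) inner_linr // !inner_linl // !inner_self //.
rewrite rcM -conj_mul.
by move: (rc _) (rc _) (inner x y) (inner y x) (t^*) => p q r s t'; ring.
Qed.

Lemma l2_cvgP (u : nat -> nat -> C) x : (forall m, l2 (u m)) -> l2 x ->
  l2_cvg u x <-> (fun m => nrm2 (fun n => u m n - x n)) @ \oo --> (0 : R).
Proof.
move=> lu lx; rewrite /l2_cvg.
under eq_fun do rewrite (l2_nrm2 (l2_sub (lu _) lx)).
split=> [|h]; first by move/fine_cvgP => [].
by apply/fine_cvgP; split; [exact: nearW|exact: h].
Qed.

Lemma cvg_inner_l (u : nat -> nat -> C) x y : (forall m, l2 (u m)) ->
  l2 x -> l2 y -> l2_cvg u x -> (fun m => inner (u m) y) @ \oo --> inner x y.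
Proof.
move=> lu lx ly /(l2_cvgP lu lx)/cvgR_dist h; apply/cvgC_dist => e e0.
have y0 := nrm2_ge0 y.
have e1 : 0 < e ^+ 2 / (nrm2 y + 1) by rewrite divr_gt0 ?exprn_gt0 // ltr_wpDl.
have [N hN] := h _ e1; exists N => n /hN; rewrite subr0 ger0_norm ?nrm2_ge0 //.
rewrite ltr_pdivlMr ?ltr_wpDl // => hn.
rewrite -inner_subl // -(@ltr_pXn2r _ 2) ?nnegrE ?cabs_ge0 ?(ltW e0) //.
apply: le_lt_trans (cauchy_schwarz (l2_sub (lu n) lx) ly) _.
apply: le_lt_trans hn; rewrite ler_wpM2l ?nrm2_ge0 // lerDl //.
Qed.

Lemma cvg_inner_r (u : nat -> nat -> C) x y : (forall m, l2 (u m)) ->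
  l2 x -> l2 y -> l2_cvg u x -> (fun m => inner y (u m)) @ \oo --> inner y x.
Proof.
move=> lu lx ly h; rewrite (inner_conj lx ly).
apply: cvgC_ext (cvg_conj (cvg_inner_l lu lx ly h)) => m.
by rewrite -inner_conj.
Qed.

Lemma l2_cvg_cst x : l2_cvg (fun=> x) x.
Proof.
rewrite /l2_cvg; under eq_fun => m.
  rewrite /l2sqnorm; under eq_eseriesr => n _.
    rewrite subrr (_ : Normc.normc 0 ^+ 2 = 0); last first.
      by rewrite -/(cabs 0) cabs0 expr0n.
    over.
  rewrite eseries0 //; over.
exact: cvg_cst.
Qed.

Lemma l2_cvg_lin c (u v : nat -> nat -> C) x y :
  (forall m, l2 (u m)) -> (forall m, l2 (v m)) -> l2 x -> l2 y ->
  l2_cvg u x -> l2_cvg v y ->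
  l2_cvg (fun m n => c * u m n + v m n) (fun n => c * x n + y n).
Proof.
move=> lu lv lx ly /(l2_cvgP lu lx) hu /(l2_cvgP lv ly) hv.
apply/l2_cvgP; [by move=> m; exact: l2_lin|exact: l2_lin|].
have h : (fun m => 2 * cabs c ^+ 2 * nrm2 (fun n => u m n - x n)
    + 2 * nrm2 (fun n => v m n - y n)) @ \oo --> 2 * cabs c ^+ 2 * 0 + 2 * 0.
  by apply: cvgD; apply: cvgMr; [exact: hu|exact: hv].
rewrite !mulr0 addr0 in h.
apply: (squeeze_cvgr _ (cvg_cst 0) h); apply: nearW => m.
rewrite nrm2_ge0 /=.
have [_] := nrm2_lin c (l2_sub (lu m) lx) (l2_sub (lv m) ly); apply: le_trans.
rewrite le_eqVlt; apply/orP; left; apply/eqP; apply: nrm2_ext => n.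
by rewrite mulrBr opprD addrACA.
Qed.

Lemma cvg_inner (u v : nat -> nat -> C) x y :
  (forall m, l2 (u m)) -> (forall m, l2 (v m)) -> l2 x -> l2 y ->
  l2_cvg u x -> l2_cvg v y ->
  (fun m => inner (u m) (v m)) @ \oo --> inner x y.
Proof.
move=> lu lv lx ly cu cv.
(* Expanding around [x] and [y], the terms with a single error are one-sided limits; only the
   product of both errors is left for Cauchy-Schwarz. *)
suff h : (fun m => inner (fun n => u m n - x n) (fun n => v m n - y n)) @ \oo
    --> (0 : C).
  have h1 : (fun m => inner (fun n => u m n - x n) (fun n => v m n - y n)
      + inner (u m) y + inner x (v m) - inner x y) @ \oo
      --> 0 + inner x y + inner x y - inner x y.
    apply: cvgB (cvg_cst _); apply: cvgD (cvg_inner_r lv ly lx cv).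
    by apply: cvgD (cvg_inner_l lu lx ly cu); exact: h.
  rewrite add0r addrK in h1; apply: cvgC_ext h1 => m.
  rewrite inner_subl ?inner_subr //; last exact: l2_sub.
  by move: (inner _ _) (inner _ _) (inner _ _) (inner _ _) => p q r s; ring.
move/(l2_cvgP lu lx): cu => /cvgR_dist cu; move/(l2_cvgP lv ly): cv => /cvgR_dist cv.
apply/cvgC_dist => e e0.
have [N1 h1] := cu _ e0; have [N2 h2] := cv _ e0.
exists (maxn N1 N2) => m; rewrite geq_max subr0 => /andP[/h1 + /h2].
rewrite !subr0 !ger0_norm ?nrm2_ge0 // => k1 k2.
rewrite -(@ltr_pXn2r _ 2) ?nnegrE ?cabs_ge0 ?(ltW e0) //.
apply: le_lt_trans (cauchy_schwarz (l2_sub (lu m) lx) (l2_sub (lv m) ly)) _.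
by rewrite expr2; apply: ltr_pM; rewrite ?nrm2_ge0.
Qed.

End L2Space.


(** * Hilbert bases *)

Section HilbertBasis.
Variable R : realType.
Local Notation C := (Cplx R).
Implicit Types (x y : nat -> C) (c : nat -> C).

Lemma ortho_inner_sum (v : nat -> nat -> C) N c i :
  (forall i, (i < N)%N -> l2 (v i)) ->
  (forall i j, (i < N)%N -> (j < N)%N -> inner (v i) (v j) = (i == j)%:R) ->
  (i < N)%N -> inner (v i) (fun n => \sum_(0 <= j < N) c j * v j n) = c i.
Proof.
move=> lv ov iN; rewrite inner_sumr //; last exact: lv.
rewrite big_mkord (bigD1 (Ordinal iN)) //= ov // eqxx mulr1 big1 ?addr0 //.
by move=> j ji; rewrite ov // (negbTE (_ : i != j)) ?mulr0 // eq_sym.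
Qed.

Lemma ortho_nrm2_sum (v : nat -> nat -> C) N c :
  (forall i, (i < N)%N -> l2 (v i)) ->
  (forall i j, (i < N)%N -> (j < N)%N -> inner (v i) (v j) = (i == j)%:R) ->
  nrm2 (fun n => \sum_(0 <= j < N) c j * v j n)
    = \sum_(0 <= j < N) cabs (c j) ^+ 2.
Proof.
move=> lv ov; apply: rcI; rewrite -inner_self; last exact: l2_sum.
rewrite {1}inner_suml //; last exact: l2_sum.
rewrite rc_sum [LHS]big_nat [RHS]big_nat; apply: eq_bigr => j /andP[_ jN].
by rewrite ortho_inner_sum // conj_mul.
Qed.

Lemma bessel (v : nat -> nat -> C) N x :
  (forall i, (i < N)%N -> l2 (v i)) ->
  (forall i j, (i < N)%N -> (j < N)%N -> inner (v i) (v j) = (i == j)%:R) ->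
  l2 x -> \sum_(0 <= j < N) cabs (inner (v j) x) ^+ 2 <= nrm2 x.
Proof.
move=> lv ov lx; set c := fun j => inner (v j) x.
pose S n := \sum_(0 <= j < N) c j * v j n.
have lS : l2 S by exact: l2_sum.
have Sx : inner S x = rc (\sum_(0 <= j < N) cabs (c j) ^+ 2).
  rewrite inner_suml // rc_sum; apply: eq_bigr => j _.
  by rewrite conj_mul.
have SS : inner S S = rc (\sum_(0 <= j < N) cabs (c j) ^+ 2).
  by rewrite inner_self // ortho_nrm2_sum.
have xS : inner x S = rc (\sum_(0 <= j < N) cabs (c j) ^+ 2).
  by rewrite (inner_conj lS lx) Sx rc_conj.
have ld := l2_sub lx lS; have := nrm2_ge0 (fun n => x n - S n).
rewrite -rc_le -inner_self // inner_subl // !inner_subr // xS Sx SS.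
by rewrite inner_self // subrr subr0 -rcB rc_le subr_ge0.
Qed.

Definition unit_seq (n : nat) : nat -> C := fun m => (m == n)%:R.

Lemma l2_unit_seq n : l2 (unit_seq n).
Proof.
by apply: (@l2_fin _ _ n.+1) => m nm; rewrite /unit_seq gtn_eqF.
Qed.

Lemma inner_unit_seqr x n : inner x (unit_seq n) = (x n)^*.
Proof.
rewrite (@inner_finr _ _ _ n.+1); last by move=> m nm; rewrite /unit_seq gtn_eqF.
rewrite big_nat_recr //= big_nat big1 ?add0r /unit_seq ?eqxx ?mulr1 //.
by move=> i /andP[_ ni]; rewrite ltn_eqF // mulr0.
Qed.

Lemma cvgR_sum (u : nat -> nat -> R) (l : nat -> R) K :
  (forall n, u n @ \oo --> l n) ->
  (fun N => \sum_(0 <= n < K) u n N) @ \oo --> \sum_(0 <= n < K) l n.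
Proof.
move=> h; elim: K => [|K IH].
  by rewrite big_nil; apply: cvgR_ext (cvg_cst 0) => N; rewrite big_nil.
rewrite big_nat_recr //=; apply: cvgR_ext (cvgD IH (h K)) => N.
by rewrite big_nat_recr.
Qed.

Variable e : nat -> nat -> C.
Hypothesis eb : hilbert_basis e.

Let le i : l2 (e i). Proof. by case: eb. Qed.
Let oe i j : inner (e i) (e j) = (i == j)%:R. Proof. by case: eb. Qed.

Definition coef x : nat -> C := fun j => inner (e j) x.

Lemma coef_le x : l2 x -> l2 (coef x) /\ nrm2 (coef x) <= nrm2 x.
Proof. by move=> lx; apply: nrm2_le => N; exact: bessel. Qed.

(** The coefficients of [unit_seq n] are the conjugates of the entries [e j n]. *)
Lemma l2_column n : l2 (fun j => e j n).
Proof.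
have [+ _] := coef_le (l2_unit_seq n); move=> /l2P[M hM].
apply/l2P; exists M => N; apply: le_trans (hM N).
by apply: ler_sum => i _; rewrite /coef inner_unit_seqr cabs_conj.
Qed.

Definition psynth c N : nat -> C := fun n => \sum_(0 <= j < N) c j * e j n.
(* The [n]-th coordinate of the series [\sum_j c j * e j] is an inner product
   with a column of the basis, which is square summable by Bessel. *)
Definition synth c : nat -> C :=
  fun n => inner (fun j => (c j)^*) (fun j => e j n).

Lemma l2_conj c : l2 c -> l2 (fun j => (c j)^*).
Proof.
move=> /l2P[M hM]; apply/l2P; exists M => N; apply: le_trans (hM N).
by apply: ler_sum => i _; rewrite cabs_conj.
Qed.

Lemma l2_psynth c N : l2 (psynth c N). Proof. exact: l2_sum. Qed.

Lemma psynth_cvg c n : l2 c -> (fun N => psynth c N n) @ \oo --> synth c n.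
Proof.
move=> lc; apply: cvgC_ext (inner_cvg (l2_conj lc) (l2_column n)) => N.
by apply: eq_bigr => j _; rewrite conjCK.
Qed.

Lemma psynth_dist c M N : l2 c -> (M <= N)%N ->
  nrm2 (fun n => psynth c N n - psynth c M n)
    <= nrm2 c - \sum_(0 <= j < M) cabs (c j) ^+ 2.
Proof.
move=> lc MN.
pose d j := if (M <= j)%N then c j else 0.
rewrite (@nrm2_ext _ _ (psynth d N)); last first.
  move=> n; rewrite /psynth (big_cat_nat _ MN) //= addrAC subrr add0r.
  rewrite [RHS](big_cat_nat _ MN) //= [X in _ = X + _]big_nat [X in _ = X + _]big1 ?add0r.
    rewrite [LHS]big_nat [RHS]big_nat; apply: eq_bigr => j /andP[Mj _].
    by rewrite /d Mj.
  by move=> j /andP[_ jM]; rewrite /d leqNgt jM mul0r.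
rewrite ortho_nrm2_sum // lerBrDl; apply: le_trans (nrm2_ge_psum N lc).
rewrite [leRHS](big_cat_nat _ MN) //= lerD2l.
rewrite (big_cat_nat _ MN) //= [X in X + _]big_nat big1 ?add0r.
  rewrite big_nat [leRHS]big_nat; apply: ler_sum => j /andP[Mj _].
  by rewrite /d Mj.
by move=> j /andP[_ jM]; rewrite /d leqNgt jM cabs0 expr0n.
Qed.

(** A Fatou argument: [psynth_dist] bounds the first [K] coordinates uniformly in [N], the bound
    survives the coordinatewise limit in [N], and then [K] is arbitrary. *)
Lemma synth_dist c M : l2 c ->
  l2 (fun n => synth c n - psynth c M n) /\
  nrm2 (fun n => synth c n - psynth c M n)
    <= nrm2 c - \sum_(0 <= j < M) cabs (c j) ^+ 2.
Proof.
move=> lc; apply: nrm2_le => K.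
have h n : (fun N => cabs (psynth c N n - psynth c M n) ^+ 2) @ \oo
    --> cabs (synth c n - psynth c M n) ^+ 2.
  have ch : (fun N => cabs (psynth c N n - psynth c M n)) @ \oo
      --> cabs (synth c n - psynth c M n).
    by apply: cvg_cabs; apply: cvgB (cvg_cst _); exact: psynth_cvg.
  by rewrite expr2; apply: cvgR_ext (cvgM ch ch) => N; rewrite expr2.
apply: (cvgR_le (N := M) (cvgR_sum (K := K) h)) => N MN.
apply: le_trans (psynth_dist lc MN).
by apply: nrm2_ge_psum; apply: l2_sub; exact: l2_psynth.
Qed.

Lemma l2_synth c : l2 c -> l2 (synth c).
Proof.
move=> lc; have [h _] := synth_dist 0 lc.
by apply: l2_ext (l2_add h (l2_psynth c 0)) => n; rewrite subrK.
Qed.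

Lemma psynth_l2cvg c : l2 c -> l2_cvg (psynth c) (synth c).
Proof.
move=> lc; apply/l2_cvgP; [exact: l2_psynth|exact: l2_synth|].
apply/cvgR_dist => eps eps0.
have /cvgR_dist/(_ _ eps0)[N hN] := nrm2_cvg lc.
exists N => M /hN h; rewrite subr0 ger0_norm ?nrm2_ge0 //; move: h.
rewrite ler0_norm ?subr_le0 ?nrm2_ge_psum // opprB; apply: le_lt_trans.
by rewrite nrm2_distC; have [] := synth_dist M lc.
Qed.

Lemma coef_synth c : l2 c -> coef (synth c) =1 c.
Proof.
move=> lc i; have h := cvg_inner_r (l2_psynth c) (l2_synth lc) (le i) (psynth_l2cvg lc).
apply: cvgC_unique h _; apply/cvgC_dist => eps eps0; exists i.+1 => N iN.
by rewrite ortho_inner_sum // subrr cabs0.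
Qed.

Lemma coef_inj x y : l2 x -> l2 y -> coef x =1 coef y -> x =1 y.
Proof.
move=> lx ly h n; apply/eqP; rewrite -subr_eq0; apply/eqP.
have [_ _ /(_ (fun n => x n - y n) (l2_sub lx ly))] := eb; apply=> i.
by rewrite inner_subr //; apply/eqP; rewrite subr_eq0; apply/eqP/h.
Qed.

Lemma synth_coef x : l2 x -> synth (coef x) =1 x.
Proof.
move=> lx; have [lc _] := coef_le lx.
by apply: coef_inj => //; [exact: l2_synth|exact: coef_synth].
Qed.

(** The partial sums of the left side are the inner products of [psynth (coef x) N] with [y], and
    these partial expansions converge to [x]. *)
Lemma parseval x y : l2 x -> l2 y -> inner (coef x) (coef y) = inner x y.
Proof.
move=> lx ly; have [lcx _] := coef_le lx; have [lcy _] := coef_le ly.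
apply: cvgC_unique (inner_cvg lcx lcy) _.
have := cvg_inner_l (l2_psynth (coef x)) (l2_synth lcx) ly (psynth_l2cvg lcx).
rewrite (inner_ext (synth_coef lx) (frefl y)).
by apply: cvgC_ext => N; rewrite /psynth inner_suml.
Qed.

Lemma nrm2_coef x : l2 x -> nrm2 (coef x) = nrm2 x.
Proof.
move=> lx; apply: rcI; rewrite -!inner_self ?parseval //.
by have [] := coef_le lx.
Qed.

End HilbertBasis.


(** * The Jacobi operator, its form and its Friedrichs extension *)

Section JacobiForm.
Variables (R : realType) (a b : nat -> R).
Local Notation C := (Cplx R).
Local Notation jact := (jacobi_act a b).
Local Notation J := (jacobi_op a b).
Implicit Types (x y u v : nat -> C) (p q : (nat -> C) * (nat -> C)).

Definition fin_supp N x := forall n, (N <= n)%N -> x n = 0.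

Definition comb (c : C) p q : (nat -> C) * (nat -> C) :=
  (fun n => c * p.1 n + q.1 n, fun n => c * p.2 n + q.2 n).

Lemma jacobi_entry_sym i j : jacobi_entry a b i j = jacobi_entry a b j i.
Proof.
rewrite /jacobi_entry eq_sym; have [->//|ij] := eqVneq j i.
have [->|_] := eqVneq j i.+1; first by rewrite -[i == _]negbK neq_ltn ltnS leqnSn orTb.
by [].
Qed.

Lemma jacobi_entry_far i j : (i.+1 < j)%N -> jacobi_entry a b i j = 0.
Proof.
move=> h; rewrite /jacobi_entry !ifF //; apply/eqP => e; lia.
Qed.

(** The row-dependent range [n + 2] is traded for the length of the support, so that all rows are
    summed over a common range. *)
Lemma jacobi_actE N x n : fin_supp N x ->
  jact x n = \sum_(0 <= j < N) rc (jacobi_entry a b n j) * x j.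
Proof.
move=> h; rewrite /jacobi_act -(big_mkord xpredT (fun j => rc (jacobi_entry a b n j) * x j)).
have [le|lt] := leqP n.+2 N.
  rewrite [RHS](@sum_tail0 _ _ n.+2) // => i ni.
  by rewrite jacobi_entry_far // rc0 mul0r.
by rewrite (@sum_tail0 _ _ N) ?(ltnW lt) // => i Ni; rewrite h // mulr0.
Qed.

Lemma fin_supp_jact N x : fin_supp N x -> fin_supp N.+1 (jact x).
Proof.
move=> h n Nn; rewrite (jacobi_actE _ h) big_nat big1 // => j /andP[_ jN].
by rewrite jacobi_entry_sym jacobi_entry_far ?rc0 ?mul0r //; lia.
Qed.

Lemma jact_lin c x y :
  jact (fun n => c * x n + y n) = fun n => c * jact x n + jact y n.
Proof.
apply/funext => n; rewrite /jacobi_act mulr_sumr -big_split /=.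
by apply: eq_bigr => i _; rewrite mulrDr mulrCA.
Qed.

Lemma jact_unit_seq n m : jact (unit_seq R n) m = rc (jacobi_entry a b m n).
Proof.
have h : fin_supp n.+1 (unit_seq R n).
  by move=> i ni; rewrite /unit_seq gtn_eqF.
rewrite (jacobi_actE _ h) big_nat_recr //= big_nat big1 ?add0r /unit_seq ?eqxx ?mulr1 //.
by move=> i /andP[_ ni]; rewrite ltn_eqF // mulr0.
Qed.

Lemma jacobi_fin N x : fin_supp N x -> J (x, jact x).
Proof.
move=> h; split=> /=; [exact: l2_fin h|exact: l2_fin (fin_supp_jact h)|].
exists (fun=> (x, jact x)); split=> /=; [|exact: l2_cvg_cst|exact: l2_cvg_cst].
by move=> _; split=> //; exists N.
Qed.

Lemma jacobi_l2 p : J p -> l2 p.1 /\ l2 p.2.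
Proof. by case. Qed.

Lemma jacobi_comb c p q : J p -> J q -> J (comb c p q).
Proof.
move=> [lp1 lp2 [u [hu u1 u2]]] [lq1 lq2 [v [hv v1 v2]]].
have fl w : (forall m, [set p | (exists N, forall n, (N <= n)%N -> p.1 n = 0)
                      /\ p.2 = jact p.1] (w m)) ->
    (forall m, l2 (w m).1) /\ (forall m, l2 (w m).2).
  move=> hw; split=> m; have [[N hN] e] := hw m; first exact: l2_fin hN.
  by rewrite e; exact: l2_fin (fin_supp_jact hN).
have [lu1 lu2] := fl _ _ hu; have [lv1 lv2] := fl _ _ hv.
split=> /=; [exact: l2_lin|exact: l2_lin|].
exists (fun m => comb c (u m) (v m)); split=> /=.
- move=> m; have [[N hN] e] := hu m; have [[N' hN'] e'] := hv m.
  split=> /=; last by rewrite e e' jact_lin.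
  exists (maxn N N') => n; rewrite geq_max => /andP[n1 n2].
  by rewrite hN // hN' // mulr0 addr0.
- exact: l2_cvg_lin.
- exact: l2_cvg_lin.
Qed.

Hypothesis J_pos : positive_op J.

Definition qform p : R := complex.Re (inner p.1 p.2).

Lemma qformE p : J p -> inner p.1 p.2 = rc (qform p).
Proof. by move=> /J_pos /ge0C[]. Qed.
Lemma qform_ge0 p : J p -> 0 <= qform p.
Proof. by move=> /J_pos /ge0C[]. Qed.

(** Positivity of [J] at [p + t q] for all complex [t], then polarization; the Hermitian half is the
    symmetry of [J]. *)
Lemma form_schwarz p q : J p -> J q ->
  inner q.1 p.2 = (inner p.1 q.2)^* /\
  cabs (inner p.1 q.2) ^+ 2 <= qform p * qform q.
Proof.
move=> Jp Jq; have [p1 p2] := jacobi_l2 Jp; have [q1 q2] := jacobi_l2 Jq.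
apply: nonneg_quadratic => t.
have := J_pos (jacobi_comb t Jq Jp); rewrite /comb /=; congr (_ <= _).
have l1 := l2_lin t q1 p1; have l2 := l2_lin t q2 p2.
rewrite inner_linr // !inner_linl // !qformE // rcM -conj_mul.
by move: (rc _) (rc _) (inner _ _) (inner _ _) (t^*) => r s z w t'; ring.
Qed.

Lemma qform_sub p q : J p -> J q ->
  J (comb (-1) q p) /\
  qform (comb (-1) q p) = qform p - 2 * complex.Re (inner p.1 q.2) + qform q.
Proof.
move=> Jp Jq; have [p1 p2] := jacobi_l2 Jp; have [q1 q2] := jacobi_l2 Jq.
split; first exact: jacobi_comb.
have [h _] := form_schwarz Jp Jq.
rewrite /qform /comb /=.
have l1 := l2_lin (-1) q1 p1.
rewrite inner_linr // !inner_linl // h rmorphN /= conjC1 !mulN1r.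
by rewrite !(cReD, cReN, cRe_conj); lra.
Qed.

Lemma qform_le_sub p q : J p -> J q ->
  qform p <= 2 * qform (comb (-1) q p) + 2 * qform q.
Proof.
move=> Jp Jq; have [Jd ->] := qform_sub Jp Jq.
have [p1 p2] := jacobi_l2 Jp; have [q1 q2] := jacobi_l2 Jq.
(* The right side minus the left side is the form at [p - 2 q]. *)
have := qform_ge0 (jacobi_comb (-2) Jq Jp).
have [h _] := form_schwarz Jp Jq.
have l1 := l2_lin (-2) q1 p1.
rewrite /qform /comb /= inner_linr // !inner_linl // h -!rc_nat -rcN rc_conj.
rewrite !(cReD, cReM, cRe_conj, cIm_conj) /=; lra.
Qed.

(* The form extends continuously to the Friedrichs domain, where the
   operator still represents it. *)
Lemma friedrichs_form p : friedrichs J p ->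
  exists (q : nat -> (nat -> C) * (nat -> C)) (r : R),
    [/\ forall m, J (q m), l2_cvg (fun m => (q m).1) p.1,
        0 <= r, inner p.1 p.2 = rc r & (fun m => qform (q m)) @ \oo --> r].
Proof.
move=> [[lp1 [q [Jq q1 qC]]] [_ lp2 adj]].
have lq1 m : l2 (q m).1 by have [] := jacobi_l2 (Jq m).
have lq2 m : l2 (q m).2 by have [] := jacobi_l2 (Jq m).
have cauchy (eps : R) : 0 < eps -> exists N, forall m n, (N <= m)%N -> (N <= n)%N ->
    qform (comb (-1) (q n) (q m)) < eps.
  move=> e0; have [|N hN] := qC (rc eps); first by rewrite -[0]rc0 rc_lt.
  exists N => m n Nm Nn; have := hN m n Nm Nn; rewrite normE rc_lt.
  apply: le_lt_trans; have Jd := jacobi_comb (-1) (Jq n) (Jq m).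
  rewrite -[qform _]ger0_norm ?qform_ge0 // -cabs_rc -qformE //.
  rewrite le_eqVlt; apply/orP; left; apply/eqP; congr cabs.
  by apply: inner_ext => i /=; rewrite mulN1r addrC.
have [N0 hN0] := cauchy 1 ltr01.
(* From index [N0] on the forms are bounded: the form at [q m - q N0] is below [1], and
   [qform_le_sub] doubles both contributions. *)
pose B := 2 + 2 * qform (q N0).
have B0 : 0 < B by rewrite ltr_wpDr // mulr_ge0 // qform_ge0.
have bB m : (N0 <= m)%N -> qform (q m) <= B.
  move=> Nm; have := qform_le_sub (Jq m) (Jq N0); have := hN0 m N0 Nm (leqnn _).
  by rewrite /B; lra.
have lim1 m : inner p.2 (q m).1 = inner p.1 (q m).2 by rewrite adj.
(* For fixed [m] the difference is the limit over [n] of the form paired at [q n - q m] and [q m].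
   The Schwarz inequality bounds its square by a small form times [B]. *)
have key : (fun m => inner p.2 (q m).1 - rc (qform (q m))) @ \oo --> (0 : C).
  apply/cvgC_dist => e e0.
  have e1 : 0 < (e / 2) ^+ 2 / B by rewrite divr_gt0 // exprn_gt0 // divr_gt0.
  have [N hN] := cauchy _ e1.
  exists (maxn N N0) => m; rewrite geq_max subr0 => /andP[Nm N0m].
  suff : cabs (inner p.2 (q m).1 - rc (qform (q m))) <= e / 2.
    by move/le_lt_trans; apply; rewrite ltr_pdivrMr // ltr_pMr // ltr1n.
  have cv : (fun n => cabs (inner (q n).1 (q m).2 - rc (qform (q m)))) @ \oo
      --> cabs (inner p.2 (q m).1 - rc (qform (q m))).
    have cvi : (fun n => inner (q n).1 (q m).2) @ \oo --> inner p.1 (q m).2.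
      exact: (@cvg_inner_l _ (fun n => (q n).1)).
    by rewrite lim1; apply: cvg_cabs; exact: cvgB cvi (cvg_cst _).
  apply: (cvgR_le (N := N) cv) => n Nn.
  have Jd := jacobi_comb (-1) (Jq m) (Jq n).
  have [_] := form_schwarz Jd (Jq m).
  rewrite /comb /= inner_linl // rmorphN /= conjC1 mulN1r addrC qformE // => h.
  rewrite -(@ler_pXn2r _ 2) ?nnegrE ?cabs_ge0 ?divr_ge0 ?(ltW e0) //.
  apply: le_trans h _.
  apply: (@le_trans _ _ ((e / 2) ^+ 2 / B * B)); last by rewrite divfK // gt_eqF.
  apply: ler_pM; [exact: qform_ge0|exact: qform_ge0|exact/ltW/hN|exact: bB].
have lim2 : (fun m => inner p.2 (q m).1) @ \oo --> inner p.2 p.1.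
  by apply: (@cvg_inner_r _ (fun n => (q n).1)).
have lim3 : (fun m => rc (qform (q m))) @ \oo --> inner p.2 p.1.
  rewrite -[X in _ --> X]subr0; apply: cvgC_ext (cvgB lim2 key) => m.
  by rewrite !fctE subKr.
have hr : (fun m => qform (q m)) @ \oo --> complex.Re (inner p.2 p.1).
  exact: cvg_Re lim3.
have hi : complex.Im (inner p.2 p.1) = 0.
  by apply: cvgR_unique (cvg_Im lim3) _; exact: cvg_cst.
exists q, (complex.Re (inner p.2 p.1)); split=> //.
  by apply: (cvgR_ge (N := 0%N) hr) => n _; exact: qform_ge0.
rewrite (inner_conj lp2 lp1); apply: cplx_eq; rewrite ?cRe_conj //.
by rewrite cIm_conj hi oppr0.
Qed.

End JacobiForm.


(** * The inverse of the Friedrichs extension: [T (x, u)] reads [u = T x], that is [J_F u = x] *)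

Section InverseFriedrichs.
Variables (R : realType) (a b : nat -> R).
Local Notation C := (Cplx R).
Local Notation jact := (jacobi_act a b).
Local Notation J := (jacobi_op a b).
Local Notation T := (op_inv (friedrichs J)).
Implicit Types (x y u v : nat -> C) (p q : (nat -> C) * (nat -> C)).

Hypothesis J_pos : positive_op J.
Hypothesis T_bounded : bounded_op T.

Lemma T_l2 x u : T (x, u) -> l2 x /\ l2 u.
Proof. by case: T_bounded => h _ _ _ /h. Qed.

Lemma T_lin c x u y v : T (x, u) -> T (y, v) ->
  T (fun n => c * x n + y n, fun n => c * u n + v n).
Proof. by case: T_bounded => _ _ h _; exact: (h c (x, u) (y, v)). Qed.

Lemma T_ext x x' u u' : x =1 x' -> u =1 u' -> T (x, u) -> T (x', u').
Proof. by move=> /funext -> /funext ->. Qed.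

Lemma T_total x : l2 x -> exists u, T (x, u).
Proof. by case: T_bounded => _ h _ _ /h. Qed.

Lemma T_nonneg x u : T (x, u) -> exists2 r : R, 0 <= r & inner x u = rc r.
Proof.
move=> h; have [lx lu] := T_l2 h.
have [q [r [_ _ r0 e _]]] := friedrichs_form J_pos h.
by exists r => //; rewrite (inner_conj lu lx) e rc_conj.
Qed.

(** Polarization again, this time of the nonnegative form of [T] at [x + t y]. *)
Lemma T_sym x u y v : T (x, u) -> T (y, v) -> inner u y = inner x v.
Proof.
move=> hx hy; have [lx lu] := T_l2 hx; have [ly lv] := T_l2 hy.
have [r r0 er] := T_nonneg hx; have [s s0 es] := T_nonneg hy.
have [h _] : inner y u = (inner x v)^* /\ cabs (inner x v) ^+ 2 <= r * s.
  apply: nonneg_quadratic => t.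
  have [w w0] := T_nonneg (T_lin t hy hx).
  have l1 := l2_lin t ly lx; have l2 := l2_lin t lv lu.
  rewrite inner_linr // !inner_linl // er es => e.
  apply: (@le_trans _ _ (rc w)); first by rewrite -rc0 rc_le.
  rewrite -e rcM -conj_mul le_eqVlt; apply/orP; left; apply/eqP.
  by move: (rc _) (rc _) (inner _ _) (inner _ _) (t^*) => r' s' z z' t'; ring.
by rewrite (inner_conj ly lu) h conjCK.
Qed.

(** The Friedrichs extension restricts the adjoint, and finitely supported vectors lie in the domain
    of [J]. Through this identity the matrix entries act on [T x]. *)
Lemma T_adjoint x u N y : T (x, u) -> fin_supp N y ->
  inner u (jact y) = inner x y.
Proof.
by move=> [_ [_ _ h]] hy; exact: (h (y, jact y) (jacobi_fin a b hy)).
Qed.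

Lemma T_inj0 x : T (x, fun=> 0) -> forall n, x n = 0.
Proof.
move=> h n; have f : fin_supp n.+1 (unit_seq R n).
  by move=> i ni; rewrite /unit_seq gtn_eqF.
have := T_adjoint h f; rewrite inner0l inner_unit_seqr => /esym/eqP.
by rewrite conjC_eq0 => /eqP.
Qed.

(** The right side minus the left side is the closed form at [u - y]; its nonnegativity is inherited
    in the limit from the approximants [q m] of [u]. *)
Lemma T_form_ge x u N y : T (x, u) -> fin_supp N y ->
  2 * complex.Re (inner y x) - complex.Re (inner y (jact y))
    <= complex.Re (inner x u).
Proof.
move=> h hy; have [lx lu] := T_l2 h; have ly := l2_fin hy.
have [q [r [Jq cq r0 e hr]]] := friedrichs_form J_pos h.
have Jy := jacobi_fin a b hy.
have lq m : l2 (q m).1 by have [] := jacobi_l2 (Jq m).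
have ljy : l2 (jact y) by have [] := jacobi_l2 Jy.
rewrite (inner_conj lu lx) cRe_conj e /=.
have h1 : (fun m => qform (q m)
    - 2 * complex.Re (inner (q m).1 (jact y)) + qform (y, jact y)) @ \oo
    --> r - 2 * complex.Re (inner u (jact y)) + qform (y, jact y).
  apply: cvgD (cvg_cst _); apply: cvgB hr _; apply: cvgMr.
  by apply: cvg_Re; exact: (@cvg_inner_l _ (fun m => (q m).1)).
have : 0 <= r - 2 * complex.Re (inner u (jact y)) + qform (y, jact y).
  apply: (cvgR_ge (N := 0%N) h1) => m _.
  have [Jd] := qform_sub J_pos (Jq m) Jy; rewrite /= => <-.
  exact: (qform_ge0 J_pos Jd).
rewrite (T_adjoint h hy) (inner_conj ly lx) cRe_conj /qform /=; lra.
Qed.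

(** At [y = u] the right side would be [2 r - r = r], with [r] the form of [u]. So [y] approximates
    [u] in two stages, each costing [eps / 2]. *)
Lemma T_form_approx x u (eps : R) : T (x, u) -> 0 < eps ->
  exists N y, fin_supp N y /\
    complex.Re (inner x u) - eps
      <= 2 * complex.Re (inner y x) - complex.Re (inner y (jact y)).
Proof.
move=> h e0; have [lx lu] := T_l2 h.
have [q [r [Jq cq r0 e hr]]] := friedrichs_form J_pos h.
have lq m : l2 (q m).1 by have [] := jacobi_l2 (Jq m).
rewrite [inner x u](inner_conj lu lx) cRe_conj e /=.
have h1 : (fun m => 2 * complex.Re (inner (q m).1 x) - qform (q m)) @ \oo
    --> 2 * r - r.
  apply: cvgB hr; apply: cvgMr.
  have -> : r = complex.Re (inner u x) by move: e => /= ->.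
  by apply: cvg_Re; exact: (@cvg_inner_l _ (fun m => (q m).1)).
have e2 : 0 < eps / 2 by rewrite divr_gt0.
have /cvgR_dist/(_ _ e2)[m0 /(_ m0 (leqnn _)) hm] := h1.
(* Second stage: [q m0] lies only in the closure [J], so it is itself a graph limit of finitely
   supported vectors. *)
have [l1 l2 [w [Jw w1 w2]]] := Jq m0.
have lw m : Defs.l2 (w m).1 /\ Defs.l2 (w m).2.
  have [[N hN] ew] := Jw m; rewrite ew.
  by split; [exact: l2_fin hN|exact: l2_fin (fin_supp_jact a b hN)].
have lw1 m : Defs.l2 (w m).1 by have [] := lw m.
have lw2 m : Defs.l2 (w m).2 by have [] := lw m.
have h2 : (fun m => 2 * complex.Re (inner (w m).1 x)
    - complex.Re (inner (w m).1 (w m).2)) @ \oo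
    --> 2 * complex.Re (inner (q m0).1 x) - qform (q m0).
  apply: cvgB.
    by apply: cvgMr; apply: cvg_Re; exact: (@cvg_inner_l _ (fun m => (w m).1)).
  apply: cvg_Re.
  exact: (@cvg_inner _ (fun m => (w m).1) (fun m => (w m).2)).
have /cvgR_dist/(_ _ e2)[m1 /(_ m1 (leqnn _)) hm1] := h2.
have [[N hN] ew] := Jw m1.
exists N, (w m1).1; split=> //; rewrite -ew.
move: hm hm1; rewrite !ltr_norml => /andP[k1 _] /andP[k2 _].
have lin (A B : R) : - (eps / 2) < A - (2 * r - r) -> - (eps / 2) < B - A ->
    r - eps <= B by lra.
exact: lin k1 k2.
Qed.

Hypothesis a_gt0 : forall n, 0 < a n.

(* The rows of [J u = la u] determine [u] from [u 0]. *)
Lemma T_eigen_zero x (s : R) : s != 0 -> T (x, fun n => rc s * x n) ->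
  x 0%N = 0 -> forall n, x n = 0.
Proof.
move=> s0 h x0.
have [lx _] := T_l2 h.
have row n : rc s * inner x (jact (unit_seq R n)) = (x n)^*.
  have f : fin_supp n.+1 (unit_seq R n).
    by move=> i ni; rewrite /unit_seq gtn_eqF.
  have := T_adjoint h f; rewrite inner_unit_seqr => <-.
  have lj : l2 (jact (unit_seq R n)) := l2_fin (fin_supp_jact a b f).
  by rewrite inner_scalel // rc_conj.
move=> n; have [m] := ubnP n; elim: m n => // m IH [//|n]; rewrite ltnS => nm.
(* In row [n] the entries of [x] up to index [n] vanish by induction, which leaves [a n] times the
   conjugate of [x (n + 1)]. *)
have := row n; rewrite IH; last exact: leq_trans nm.
rewrite conjC0 => /eqP; rewrite mulf_eq0 rc_eq0 (negbTE s0) /=.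
rewrite (@inner_finr _ _ _ n.+2); last first.
  move=> i ni; rewrite jact_unit_seq jacobi_entry_sym jacobi_entry_far //.
rewrite big_nat_recr //= big_nat big1 ?add0r; last first.
  by move=> i /andP[_ ni]; rewrite IH ?conjC0 ?mul0r //; exact: leq_trans nm.
have -> : jact (unit_seq R n) n.+1 = rc (a n).
  rewrite jact_unit_seq; congr rc; rewrite /jacobi_entry.
  by rewrite gtn_eqF // [n == n.+2]ltn_eqF ?ltnS ?leqnSn // eqxx.
rewrite mulf_eq0 rc_eq0 [a n == 0]gt_eqF // orbF conjC_eq0 => /eqP //.
Qed.

Variables (s : nat -> R).
Hypothesis s_sing : singular_values T s.

(** Symmetry turns the hypothesis into [(T + s)(T - s) e = 0], and [T + s] is injective because
    [T >= 0] and [s > 0]. *)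
Lemma singular_eigen : exists2 e, hilbert_basis e &
  forall j, 0 < s j /\ T (e j, fun n => rc (s j) * e j n).
Proof.
have [s_ge0 [e eb he]] := s_sing; exists e => // j.
have [f Tf [lf lse adj]] := he j.
have [le _] := T_l2 Tf.
have [h Th] := T_total lf.
have [_ lh] := T_l2 Th.
(* The adjoint condition becomes [T (T e) = s ^ 2 e]: the difference [d] of the two sides is tested
   against itself, with [w = T d] and symmetry moving [T] across. *)
have hE : h =1 (fun n => rc (s j ^+ 2) * e j n).
  have ld := l2_sub lh lse.
  have [w Tw] := T_total ld; have [_ lw] := T_l2 Tw.
  suff : inner (fun n => h n - rc (s j ^+ 2) * e j n)
      (fun n => h n - rc (s j ^+ 2) * e j n) = 0.
    rewrite inner_self // -rc0 => /rcI /(nrm2_eq0 ld) hn n.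
    by apply/eqP; rewrite -subr_eq0 hn.
  rewrite inner_subl // (T_sym Th Tw).
  by have /= -> := adj _ Tw; rewrite subrr.
have e0 : ~ forall n, e j n = 0.
  move=> z; have [_ /(_ j j) + _] := eb.
  rewrite eqxx (inner_ext (y' := fun=> 0) (frefl _)) // inner0r => /esym/eqP.
  by rewrite oner_eq0.
have s0 : 0 < s j.
  rewrite lt_neqAle s_ge0 andbT eq_sym; apply/negP => /eqP sj0.
  apply: e0; apply: T_inj0; apply: T_ext Tf => // n; apply: T_inj0.
  by apply: T_ext Th => // i; rewrite hE sj0 expr0n rc0 mul0r.
split=> //; apply: (T_ext _ _ Tf) => // n.
(* For [y = T e - s e] one has [<y, T y> = - s <y, y>], so nonnegativity forces [y = 0]. *)
have Ty := T_lin (- rc (s j)) Tf Th.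
have ly : l2 (fun n => - rc (s j) * e j n + f n) by have [] := T_l2 Ty.
have [r r0] := T_nonneg Ty.
rewrite (inner_ext (x' := fun n => - rc (s j) * e j n + f n)
  (y' := fun n => - rc (s j) * (- rc (s j) * e j n + f n))) //; last first.
  by move=> i; rewrite hE rcX; ring.
rewrite inner_scaler // inner_self // mulNr -rcM => /(congr1 (@complex.Re R)).
rewrite cReN /= => hr.
have : nrm2 (fun n => - rc (s j) * e j n + f n) = 0.
  apply/eqP; rewrite eq_le nrm2_ge0 andbT -(@ler_pM2l _ (s j)) // mulr0.
  by move: r0; rewrite -hr oppr_ge0.
move=> /(nrm2_eq0 ly)/(_ n)/eqP; rewrite mulNr addrC subr_eq0 => /eqP //.
Qed.

(** Two eigenvectors for one eigenvalue have a nontrivial combination with vanishing coordinate [0];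
    the recurrence kills it, against orthonormality. *)
Lemma eigen_simple e : hilbert_basis e ->
  (forall j, 0 < s j /\ T (e j, fun n => rc (s j) * e j n)) -> injective s.
Proof.
move=> eb he i j sij; apply/eqP; apply: contraT => ij.
have [_ oe _] := eb.
have [si Ti] := he i; have [sj Tj] := he j; rewrite -sij in Tj.
have [li _] := T_l2 Ti; have [lj _] := T_l2 Tj.
have nz k : (forall n, e k n = 0) -> False.
  move=> z; have := oe k k.
  rewrite eqxx (inner_ext (y' := fun=> 0) (frefl _)) // inner0r => /esym/eqP.
  by rewrite oner_eq0.
have si0 : s i != 0 by rewrite gt_eqF.
have ei0 : e i 0%N != 0.
  by apply/eqP => z; apply: (nz i); exact: T_eigen_zero si0 Ti z.
pose c := - (e j 0%N / e i 0%N).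
have Tc := T_lin c Ti Tj.
have z : forall n, c * e i n + e j n = 0.
  apply: (T_eigen_zero si0 (x := fun n => c * e i n + e j n)).
    by apply: T_ext Tc => // n; ring.
  by rewrite /c mulNr divfK // addNr.
have := inner_linr c lj li lj.
rewrite (inner_ext (y' := fun=> 0) (frefl _)) // inner0r.
rewrite !oe eqxx [j == i]eq_sym (negbTE ij) mulr0 add0r => /esym/eqP.
by rewrite oner_eq0.
Qed.

End InverseFriedrichs.


(** * The spectrum of the Friedrichs extension *)

Section DecreasingRearrangement.
Variable R : realType.
Implicit Types s F : nat -> R.

Lemma sum_uniq_le F (l : seq nat) K : (forall i, 0 <= F i) -> uniq l ->
  (forall i, i \in l -> (i < K)%N) ->
  \sum_(i <- l) F i <= \sum_(0 <= i < K) F i.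
Proof.
move=> F0 ul lK.
have p : perm_eq (index_iota 0 K) (l ++ [seq i <- index_iota 0 K | i \notin l]).
  apply: uniq_perm; rewrite ?iota_uniq // ?cat_uniq ?ul ?filter_uniq ?iota_uniq ?andbT //=.
    by apply/hasPn => i; rewrite mem_filter => /andP[].
  move=> i; rewrite mem_cat mem_filter mem_index_iota /=.
  by case: (boolP (i \in l)) => //= /lK ->.
by rewrite (perm_big _ p) /= big_cat lerDl sumr_ge0.
Qed.

Lemma summable_to0 s k : (0 < k)%N -> (forall j, 0 < s j) ->
  (\sum_(0 <= j <oo) (s j ^+ k)%:E < +oo)%E ->
  forall eps, 0 < eps -> exists N, forall j, (N <= j)%N -> s j < eps.
Proof.
move=> k0 s0 /nneseries_ltyP[]; first by move=> n; rewrite exprn_ge0 // ltW.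
move=> M hM eps e0.
have c : cvgn (series (fun j => s j ^+ k)).
  apply: (@cvgR_series_abs _ _ M) => N; apply: le_trans (hM N).
  by apply: ler_sum => i _; rewrite ger0_norm // exprn_ge0 // ltW.
have /cvgR_dist := cvg_series_cvg_0 c.
move=> /(_ (eps ^+ k)) [|N hN]; first by rewrite exprn_gt0.
exists N => j /hN; rewrite subr0 ger0_norm ?exprn_ge0 ?(ltW (s0 j)) //.
by rewrite ltr_pXn2r // nnegrE ltW.
Qed.

Variable s : nat -> R.
Hypothesis s_gt0 : forall j, 0 < s j.
Hypothesis s_inj : injective s.
Hypothesis s_to0 : forall eps, 0 < eps -> exists N, forall j, (N <= j)%N -> s j < eps.

(** Only finitely many values reach [s j0], so the maximum is taken over a finite range of
    indices. *)
Lemma exists_argmax (P : nat -> Prop) j0 : P j0 ->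
  exists j, P j /\ forall i, P i -> s i <= s j.
Proof.
move=> P0; have [N hN] := s_to0 (s_gt0 j0).
have jN : (j0 < N)%N.
  by rewrite ltnNge; apply/negP => /hN; rewrite ltxx.
have Q0 : `[< P (Ordinal jN) >] by apply/asboolP.
have [j /asboolP Pj jmax] := 
  @arg_maxP _ _ 'I_N (Ordinal jN) (fun i => `[< P i >]) (fun i => s i) Q0.
exists j; split=> // i Pi; have [iN|Ni] := ltnP i N.
  by apply: (jmax (Ordinal iN)); apply/asboolP.
by apply: le_trans (ltW (hN _ Ni)) _; exact: (jmax (Ordinal jN)).
Qed.

Lemma exists_next n :
  exists j, s j < s n /\ forall i, s i < s n -> s i <= s j.
Proof.
have [N hN] := s_to0 (s_gt0 n); apply: (@exists_argmax (fun j => s j < s n) N).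
exact: hN.
Qed.

(** Greedy enumeration: [nxt] picks the largest value strictly below the current one. Injectivity of
    [s] is what makes an index determined by its value, hence reached. *)
Lemma decreasing_rearrangement : exists sg : nat -> nat,
  [/\ forall m n, (m < n)%N -> s (sg n) < s (sg m), injective sg &
      forall j, exists n, sg n = j].
Proof.
have [j0 [_ j0max]] := @exists_argmax (fun=> True) 0%N I.
pose nxt n := projT1 (cid (exists_next n)).
have nxtP n : s (nxt n) < s n /\ forall i, s i < s n -> s i <= s (nxt n).
  by rewrite /nxt; case: cid.
pose sg n := iter n nxt j0.
have dec m n : (m < n)%N -> s (sg n) < s (sg m).
  elim: n => // n IH; rewrite ltnS leq_eqVlt => /predU1P[->|/IH h].
    by have [] := nxtP (sg n).
  by apply: lt_trans h; have [] := nxtP (sg n).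
have inj : injective sg.
  move=> m n e; apply/eqP; apply: contraT; rewrite neq_ltn => /orP[] /dec.
    by rewrite e ltxx.
  by rewrite e ltxx.
exists sg; split=> // j; apply: contrapT => nj.
have neq n : s j != s (sg n).
  by apply/eqP => /s_inj e; apply: nj; exists n.
have lt n : s j < s (sg n).
  elim: n => [|n IH]; first by rewrite lt_neqAle neq j0max.
  by rewrite lt_neqAle neq /=; have [_] := nxtP (sg n); apply.
(* A missed index [j] would keep all the values [s (sg n)] above [s j], forcing infinitely many
   distinct indices [sg n] below a fixed [N]. *)
have [N hN] := s_to0 (s_gt0 j).
have bd n : (sg n < N)%N.
  by rewrite ltnNge; apply/negP => /hN; rewrite ltNge ltW.
have : (size (map sg (iota 0 N.+1)) <= size (iota 0 N))%N.
  apply: uniq_leq_size; first by rewrite (map_inj_uniq inj) iota_uniq.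
  by move=> _ /mapP[n _ ->]; rewrite mem_iota /= add0n bd.
by rewrite size_map !size_iota ltnn.
Qed.

End DecreasingRearrangement.

(** * Diagonalization in the eigenbasis and the spectrum of the Friedrichs extension *)

Section Spectrum.
Variables (R : realType) (a b : nat -> R).
Local Notation C := (Cplx R).
Local Notation J := (jacobi_op a b).
Local Notation JF := (friedrichs J).
Local Notation T := (op_inv JF).

Hypothesis J_pos : positive_op J.
Hypothesis T_bounded : bounded_op T.

Variables (e : nat -> nat -> C) (s : nat -> R).
Hypothesis eb : hilbert_basis e.
Hypothesis se : forall j, 0 < s j /\ T (e j, fun n => rc (s j) * e j n).
Hypothesis s_dec : forall m n, (m < n)%N -> s n < s m.
Hypothesis s_to0 : forall eps, 0 < eps -> exists N, forall j, (N <= j)%N -> s j < eps.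

Let s0 j : 0 < s j. Proof. by have [] := se j. Qed.
Let Te j : T (e j, fun n => rc (s j) * e j n). Proof. by have [] := se j. Qed.
Let le j : l2 (e j). Proof. by case: eb. Qed.
Let oe i j : inner (e i) (e j) = (i == j)%:R. Proof. by case: eb. Qed.

Lemma coef_T x u j : T (x, u) -> coef e u j = rc (s j) * coef e x j.
Proof.
move=> h; have [lx lu] := T_l2 T_bounded h.
by have := T_sym J_pos T_bounded (Te j) h; rewrite inner_scalel // rc_conj.
Qed.

Lemma T_scale c x u : T (x, u) -> T (fun n => c * x n, fun n => c * u n).
Proof.
move=> h; have h0 := T_lin T_bounded (-1) h h.
apply: (T_ext _ _ (T_lin T_bounded c h h0)) => n /=.
  by rewrite mulN1r addNr addr0.
by rewrite mulN1r addNr addr0.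
Qed.

Lemma eigen_scaled j : JF (e j, fun n => rc (s j)^-1 * e j n).
Proof.
apply: (T_ext _ _ (T_scale (rc (s j)^-1) (Te j))) => // n.
by rewrite mulrA -rcM mulVf ?gt_eqF // mul1r.
Qed.

(** Once [s j < 1 / (2 (|z| + 1))], the factor [1 - z s_j] has modulus at least [1 / 2]; the
    finitely many earlier factors are nonzero and contribute a minimum. *)
Lemma resolvent_gap z : (forall j, z != rc (s j)^-1) ->
  exists2 d : R, 0 < d & forall j, d <= cabs (1 - z * rc (s j)).
Proof.
move=> hz.
have nz j : 0 < cabs (1 - z * rc (s j)).
  rewrite lt_neqAle cabs_ge0 andbT eq_sym cabs_eq0 subr_eq0.
  apply: contra (hz j) => /eqP h.
  by rewrite rcV -[X in _ == X]mul1r h mulfK // rc_eq0 gt_eqF.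
have [|N hN] := s_to0 (eps := (2 * (cabs z + 1))^-1).
  by rewrite invr_gt0 mulr_gt0 // ltr_wpDl // cabs_ge0.
have [d d0 hd] : exists2 d : R, 0 < d &
    forall j, (j < N)%N -> d <= cabs (1 - z * rc (s j)).
  elim: N {hN} => [|N [d d0 hd]]; first by exists 1.
  exists (Num.min d (cabs (1 - z * rc (s N)))); first by rewrite lt_min d0 nz.
  move=> j; rewrite ltnS leq_eqVlt => /predU1P[->|/hd h].
    by rewrite ge_min lexx orbT.
  by rewrite ge_min h.
exists (Num.min d (1 / 2)); first by rewrite lt_min d0 divr_gt0.
move=> j; have [/hd h|/hN h] := ltnP j N; rewrite ge_min ?h //.
apply/orP; right.
have h1 : cabs (z * rc (s j)) <= 1 / 2.
  rewrite cabsM cabs_rc gtr0_norm //.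
  apply: (@le_trans _ _ ((cabs z + 1) * (2 * (cabs z + 1))^-1)).
    apply: ler_pM => //; rewrite ?cabs_ge0 ?(ltW (s0 j)) //; last exact: ltW.
    by rewrite lerDl.
  have z1 : cabs z + 1 != 0 by rewrite gt_eqF // ltr_wpDl // cabs_ge0.
  by rewrite invfM mulrCA mulfV // mulr1 mul1r.
have := cabsD (1 - z * rc (s j)) (z * rc (s j)); rewrite subrK cabs1; lra.
Qed.

(** With [f = J_F u], the equation [(J_F - z) u = g] reads [(1 - z s_j) f_j = g_j] in the basis [e].
    It is solved for [f], not for [u], so that [u = T f] lies in the domain automatically. At
    [z = 1 / s_j] the eigenvector [e j] violates the resolvent estimate. *)
Lemma spectrum_friedrichs :
  spectrum JF = [set (rc (s j)^-1 : C) | j in [set: nat]].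
Proof.
apply/seteqP; split=> [z zs|_ [j _ <-] [_ [M hM]]]; last first.
  have := hM _ (eigen_scaled j); rewrite /=.
  rewrite (l2_nrm2 (le j)) (_ : (fun n => _) = (fun=> 0)); last first.
    by apply/funext => n; rewrite subrr.
  rewrite (l2_nrm2 (l2_0 R)) -EFinM lee_fin.
  have -> : nrm2 (e j) = 1 by apply: rcI; rewrite -inner_self // oe eqxx.
  have -> : nrm2 (fun=> 0 : C) = 0.
    by apply: rcI; rewrite -inner_self ?inner0r //; exact: l2_0.
  by rewrite mulr0 ler10.
apply: contrapT => nz; apply: zs.
have [|d d0 hd] := @resolvent_gap z.
  by move=> j; apply/eqP => h; apply: nz; exists j.
have nz1 j : 1 - z * rc (s j) != 0.
  by rewrite -cabs_eq0 gt_eqF // (lt_le_trans d0).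
have shrink (c c' : nat -> C) : (forall j, c' j = c j / (1 - z * rc (s j))) ->
    l2 c -> l2 c' /\ nrm2 c' <= (d ^+ 2)^-1 * nrm2 c.
  move=> cc lc; apply: nrm2_le => N.
  apply: (@le_trans _ _ ((d ^+ 2)^-1 * \sum_(0 <= n < N) cabs (c n) ^+ 2)).
    rewrite mulr_sumr; apply: ler_sum => j _.
    rewrite cc cabsM cabsV exprMn mulrC ler_wpM2r ?sqr_ge0 // exprVn.
    by rewrite lef_pV2 ?posrE ?exprn_gt0 // ?(lt_le_trans d0) // ler_pXn2r ?nnegrE ?cabs_ge0 // ltW.
  by rewrite ler_wpM2l ?nrm2_ge_psum // invr_ge0 sqr_ge0.
have coefg u f : JF (u, f) ->
    forall j, coef e (fun n => f n - z * u n) j = (1 - z * rc (s j)) * coef e f j.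
  move=> h j; have [lf lu] := T_l2 T_bounded h.
  rewrite /coef inner_subr ?inner_scaler //; last exact: l2_scale.
  by have := coef_T j h; rewrite /coef => ->; ring.
split=> [g lg|].
  have [lcg _] := coef_le eb lg.
  pose c' j := coef e g j / (1 - z * rc (s j)).
  have [lc' _] := shrink _ c' (fun j => erefl) lcg.
  have lf := l2_synth eb lc'.
  have [u Tu] := T_total T_bounded lf; have [_ lu] := T_l2 T_bounded Tu.
  exists (u, synth e c') => //=; apply/funext; apply: (coef_inj eb) => //.
    by apply: l2_sub => //; exact: l2_scale.
  by move=> j; rewrite coefg // coef_synth // /c' mulrC divfK.
have [_ _ _ [M0 hM0]] := T_bounded.
(* [M0] bounds [T] and [d ^ -2] bounds the division by the gap; the absolute value is there because
   [M0] carries no sign information. *)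
exists (`|M0| * (d ^+ 2)^-1) => -[u f] h /=.
have [lf lu] := T_l2 T_bounded h.
have lg : l2 (fun n => f n - z * u n) by apply: l2_sub => //; exact: l2_scale.
have [lcg hcg] := coef_le eb lg; have [lcf _] := coef_le eb lf.
have cf j : coef e f j
    = coef e (fun n => f n - z * u n) j / (1 - z * rc (s j)).
  by rewrite (coefg _ _ h) mulrC mulKf.
have [_ hf] := shrink _ _ cf lcg.
have := hM0 (f, u) h; rewrite /= (l2_nrm2 lf) (l2_nrm2 lu) (l2_nrm2 lg).
rewrite -!EFinM !lee_fin => hu; apply: le_trans hu _.
apply: (@le_trans _ _ (`|M0| * nrm2 f)).
  by rewrite ler_wpM2r ?nrm2_ge0 // ler_norm.
rewrite -mulrA ler_wpM2l //.
rewrite -(nrm2_coef eb lf) -(nrm2_coef eb lg); exact: hf.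
Qed.

(** In coordinates the eigenvalue equation is [(1 - s_i / s_j) u_i = 0], and strict decrease
    isolates [i = j]. *)
Lemma eigenvalue_simple j : simple_eigenvalue JF (rc (s j)^-1).
Proof.
exists (e j); split; first exact: eigen_scaled.
  apply: contrapT => h; have := oe j j; rewrite eqxx.
  rewrite (inner_ext (y' := fun=> 0) (frefl _)) ?inner0r; last first.
    by move=> n; apply/eqP; apply: contraT => nz; case: h; exists n.
  by move=> /esym/eqP; rewrite oner_eq0.
move=> u hu; exists (coef e u j).
have [l1 lu] := T_l2 T_bounded hu.
apply/funext; apply: (coef_inj eb) => //; first exact: l2_scale.
move=> i; have := coef_T i hu; rewrite {2}/coef inner_scaler // -/(coef e u i).
rewrite /coef inner_scaler // oe -/(coef e u j) -/(coef e u i).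
have [->|ij] := eqVneq i j; first by rewrite mulr1.
rewrite mulr0 mulrA -rcM => /eqP; rewrite -subr_eq0 -{1}[coef e u i]mul1r -mulrBl.
rewrite mulf_eq0 -rc1 -rcB rc_eq0 subr_eq0 => /orP[|/eqP //].
move=> /eqP h1; have {h1} h : s i = s j.
  by rewrite -[s i](@divfK _ (s j)) ?gt_eqF // -h1 mul1r.
by move: ij; rewrite neq_ltn => /orP[] /s_dec; rewrite h ltxx.
Qed.

End Spectrum.


(** * Elementary factors *)

Section ComplexExp.
Variable R : realType.
Local Notation C := (Cplx R).
Implicit Types (w z : C) (x y : R).

Lemma abs_sin_le x : `|sin x| <= `|x|.
Proof.
wlog x0 : x / 0 <= x => [h|].
  have [/h//|/ltW x0] := leP 0 x.
  by rewrite -normrN -sinN -[`|x|]normrN h // oppr_ge0.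
have [|c _] := @MVT_segment R sin cos 0 x x0 (fun y _ => is_derive_sin y).
  by apply: continuous_subspaceT => y; exact: continuous_sin.
rewrite sin0 !subr0 => ->; rewrite normrM -[leRHS]mul1r.
by rewrite ler_wpM2r // cos_max.
Qed.

Lemma cos_ge_quad x : `|cos x - 1| <= x ^+ 2 / 2.
Proof.
have e : cos x - 1 = - (2 * sin (x / 2) ^+ 2).
  rewrite {1}(_ : x = (x / 2) *+ 2) ?cos_mulr2n ?cos2sin2; last by rewrite -mulr_natr divfK.
  by rewrite -mulr_natr; lra.
rewrite e normrN normrM ger0_norm // normrX.
have := abs_sin_le (x / 2); rewrite -(@ler_pXn2r _ 2) ?nnegrE //.
rewrite [X in _ <= X -> _]real_normK ?num_real // => h.
have -> : x ^+ 2 / 2 = 2 * (x / 2) ^+ 2 by field.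
by rewrite ler_wpM2l.
Qed.

Lemma sin_cubic x : `|sin x - x| <= `|x| * (x ^+ 2 / 2).
Proof.
wlog x0 : x / 0 <= x => [h|].
  have [/h//|/ltW x0] := leP 0 x.
  rewrite (_ : sin x - x = - (sin (- x) - - x)); last by rewrite sinN; ring.
  by rewrite normrN -[`|x|]normrN -sqrrN h // oppr_ge0.
have dB y : is_derive y 1 (fun y => sin y - y) (cos y - 1) by apply: is_deriveB.
have [|c cx] := @MVT_segment R (fun y => sin y - y) (fun y => cos y - 1) 0 x x0
    (fun y _ => dB y).
  apply: continuous_subspaceT => y; apply: cvgB; last exact: cvg_id.
  exact: continuous_sin.
rewrite sin0 !subr0 => ->; rewrite normrM mulrC ler_wpM2l //.
apply: le_trans (cos_ge_quad c) _; rewrite ler_wpM2r ?invr_ge0 //.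
move: cx; rewrite in_itv /= => /andP[c0 cx].
by rewrite ler_pXn2r // nnegrE.
Qed.

(** Both bounds come from [1 + y <= exp y]: at [y = x] directly, and at [y = - x] in the form
    [exp x * (1 - x) <= 1]. *)
Lemma expR_quad x : `|x| <= 1 / 2 -> `|expR x - 1 - x| <= 2 * x ^+ 2.
Proof.
rewrite ler_norml => /andP[h1 h2].
have l := expR_ge1Dx x; have u := expR_ge1Dx (- x).
have p := expR_gt0 x; have e := expRxMexpNx_1 x.
rewrite ger0_norm; last by lra.
have h : expR x * (1 - x) <= 1.
  by rewrite -[leRHS]e ler_wpM2l // ltW.
have := sqr_ge0 x; nra.
Qed.

Lemma cexpD w z : cexp (w + z) = cexp w * cexp z.
Proof.
rewrite /cexp cReD cImD expRD cosD sinD.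
by apply: cplx_eq; rewrite !(cReM, cImM) /=; ring.
Qed.

Lemma cexp0 : cexp (0 : C) = 1.
Proof. by apply: cplx_eq; rewrite /cexp !(cReM, cImM) /= expR0 cos0 sin0; ring. Qed.

Lemma cexpMn w n : cexp (w *+ n) = cexp w ^+ n.
Proof. by elim: n => [|n IH]; rewrite ?mulr0n ?cexp0 // mulrS cexpD IH exprS. Qed.

Lemma cabs_cis x : cabs (Complex (cos x) (sin x)) = 1.
Proof.
apply/eqP; rewrite -(@eqrXn2 _ 2) ?cabs_ge0 // cabs_sqr /= cos2Dsin2.
by rewrite expr1n.
Qed.

Lemma cabs_cexp w : cabs (cexp w) = expR (complex.Re w).
Proof.
rewrite /cexp -/(rc _) cabsM cabs_rc cabs_cis mulr1 ger0_norm //.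
Qed.

Lemma cabs_cexp_le w : cabs (cexp w) <= expR (cabs w).
Proof.
rewrite cabs_cexp ler_expR; apply: le_trans (Re_le_cabs w).
exact: ler_norm.
Qed.

(** The constant [9] is generous: the estimates of the two parts add up to
    [3 x ^ 2 + (13 / 4) y ^ 2]. *)
Lemma cexp_quad w : cabs w <= 1 / 2 ->
  cabs (cexp w - 1 - w) <= 9 * cabs w ^+ 2.
Proof.
move=> hw; apply: le_trans (cabs_le_ReIm _) _.
have := le_trans (Re_le_cabs w) hw; have := le_trans (Im_le_cabs w) hw.
rewrite cabs_sqr /cexp !(cReD, cReN, cImD, cImN) !(cReM, cImM) /=.
move: (complex.Re w) (complex.Im w) => x y hy hx.
have := expR_quad hx; have := cos_ge_quad y; have := sin_cubic y.
have E0 := expR_gt0 x.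
move: (expR x) (cos y) (sin y) E0 => E c s E0.
move=> hA hB hD.
have E3 : E <= 3.
  have := le_trans (ler_norm (E - 1 - x)) hD => h.
  move: hx; rewrite ler_norml => /andP[h1 h2].
  have : x ^+ 2 <= 1 / 2 by nra.
  by lra.
have h1 : `|E * c - 0 * s - 1 - x| <= 2 * x ^+ 2 + 3 * (y ^+ 2 / 2).
  rewrite (_ : _ - x = (E - 1 - x) + E * (c - 1)); last by ring.
  apply: le_trans (ler_normD _ _) _; apply: lerD => //.
  by rewrite normrM (gtr0_norm E0) ler_pM // ltW.
have E1 : `|E - 1| <= 2 * `|x|.
  rewrite (_ : E - 1 = (E - 1 - x) + x); last by ring.
  apply: le_trans (ler_normD _ _) _.
  have : x ^+ 2 <= `|x| / 2.
    rewrite -[x ^+ 2]real_normK ?num_real //.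
    by have := normr_ge0 x; nra.
  by lra.
have h2 : `|E * s + 0 * c - 0 - y| <= 3 * (y ^+ 2 / 4) + 2 * `|x| * `|y|.
  rewrite (_ : _ - y = E * (s - y) + (E - 1) * y); last by ring.
  apply: le_trans (ler_normD _ _) _; rewrite !normrM (gtr0_norm E0).
  apply: lerD; last by rewrite ler_wpM2r.
  apply: ler_pM => //; first exact: ltW.
  apply: le_trans hA _.
  apply: (@le_trans _ _ (1 / 2 * (y ^+ 2 / 2))); last by lra.
  by rewrite ler_wpM2r // divr_ge0 // sqr_ge0.
have xy : 2 * `|x| * `|y| <= x ^+ 2 + y ^+ 2.
  rewrite -[x ^+ 2]real_normK ?num_real // -[y ^+ 2]real_normK ?num_real //.
  by have := sqr_ge0 (`|x| - `|y|); nra.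
apply: le_trans (lerD h1 h2) _.
by have := sqr_ge0 x; have := sqr_ge0 y; lra.
Qed.

Lemma cabs_subX_le w z n (M : R) : cabs w <= M -> cabs z <= M ->
  cabs (w ^+ n - z ^+ n) <= cabs (w - z) * (n%:R * M ^+ n.-1).
Proof.
move=> hw hz; have M0 : 0 <= M := le_trans (cabs_ge0 w) hw.
rewrite subrXX cabsM ler_wpM2l ?cabs_ge0 //.
apply: le_trans (cabs_sum _ _ _) _.
apply: (@le_trans _ _ (\sum_(i < n) M ^+ n.-1)); last first.
  by rewrite sumr_const card_ord mulr_natl.
apply: ler_sum => i _; rewrite cabsM !cabsX.
rewrite [X in _ <= M ^+ X](_ : n.-1 = (n.-1 - i + i)%N); last first.
  by rewrite subnK //; case: n i => [[]|n i] //=; rewrite -ltnS.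
rewrite exprD.
by apply: ler_pM; rewrite ?exprn_ge0 ?cabs_ge0 // lerXn2r // nnegrE ?cabs_ge0.
Qed.

(** Both sides are [N + 1]-st powers, of [cexp h] and [1 + h] with [h = w / (N + 1)], and both bases
    are at most [exp (r / (N + 1))]. The condition on [N] puts [h] within reach of [cexp_quad]. The
    rate is explicit so that it is uniform on discs. *)
Lemma cexp_approx w N (r : R) : cabs w <= r -> 2 * r <= N.+1%:R ->
  cabs (cexp w - (1 + w / N.+1%:R) ^+ N.+1) <= 9 * r ^+ 2 * expR r / N.+1%:R.
Proof.
move=> wr rN; have r0 : 0 <= r := le_trans (cabs_ge0 w) wr.
have N0 : (0 : R) < N.+1%:R by rewrite ltr0n.
have NC : (N.+1%:R : C) != 0 by rewrite pnatr_eq0.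
have {1}-> : w = (w / N.+1%:R) *+ N.+1 by rewrite -mulr_natr divfK.
rewrite cexpMn; set h := w / N.+1%:R.
have hE : cabs h = cabs w / N.+1%:R by rewrite cabsM cabsV cabs_nat.
have hr : cabs h <= r / N.+1%:R by rewrite hE ler_wpM2r // invr_ge0 ltW.
have M1 : cabs (cexp h) <= expR (r / N.+1%:R).
  by apply: le_trans (cabs_cexp_le h) _; rewrite ler_expR.
have M2 : cabs (1 + h) <= expR (r / N.+1%:R).
  apply: le_trans (cabsD _ _) _; rewrite cabs1.
  by apply: le_trans (expR_ge1Dx _); rewrite lerD2l.
apply: le_trans (cabs_subX_le N.+1 M1 M2) _; rewrite /=.
have h1 : cabs (cexp h - (1 + h)) <= 9 * (r / N.+1%:R) ^+ 2.
  rewrite opprD addrA; apply: (@le_trans _ _ (9 * cabs h ^+ 2)).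
    by apply: cexp_quad; apply: le_trans hr _; rewrite ler_pdivrMr //; lra.
  by rewrite ler_wpM2l // ler_pXn2r // nnegrE ?cabs_ge0 // divr_ge0 // ltW.
have h2 : expR (r / N.+1%:R) ^+ N <= expR r.
  rewrite -expRM_natl ler_expR mulrA ler_pdivrMr // mulrC ler_wpM2l //.
  by rewrite ler_nat.
apply: (@le_trans _ _ (9 * (r / N.+1%:R) ^+ 2 * (N.+1%:R * expR r))).
  apply: ler_pM => //; rewrite ?cabs_ge0 ?mulr_ge0 ?exprn_ge0 ?expR_ge0 //.
  by rewrite ler_wpM2l // ltW.
rewrite le_eqVlt; apply/orP; left; apply/eqP.
by move: (N.+1%:R) N0 => n N0; field; rewrite gt_eqF.
Qed.

Lemma cvg_cexp w : (fun N => (1 + w / N.+1%:R) ^+ N.+1) @ \oo --> cexp w.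
Proof.
have h : (fun N => 9 * cabs w ^+ 2 * expR (cabs w) / N.+1%:R) @ \oo --> (0 : R).
  rewrite -[X in _ --> X](mulr0 (9 * cabs w ^+ 2 * expR (cabs w))).
  by apply: cvgMr; exact: cvg_harmonic.
apply/cvgC_dist => eps e0; have /cvgR_dist/(_ _ e0)[N1 h1] := h.
have [N2 h2] : exists N2 : nat, 2 * cabs w <= N2%:R.
  exists (Num.truncn (2 * cabs w)).+1; apply: ltW; exact: truncnS_gt.
exists (maxn N1 N2) => n; rewrite geq_max => /andP[/h1 + n2].
rewrite subr0 => h3; rewrite cabs_distrC; apply: le_lt_trans h3.
apply: le_trans (ler_norm _); apply: cexp_approx => //.
by apply: le_trans h2 _; rewrite ler_nat; exact: leqW.
Qed.

End ComplexExp.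

(** Discrete counterpart of [E_m' = - w ^ m exp q]: the hypothesis on [q] cancels everything of
    order one except ['X^m], and the term [q / (N + 1)] disappears as [N] grows. *)
Lemma deriv_mul_exp (F : numFieldType) (q : {poly F}) m N :
  (1 - 'X) * q^`() = 1 - 'X^m ->
  - ((1 - 'X) * (1 + (N.+1%:R)^-1 *: q) ^+ N.+1)^`()
    = (1 + (N.+1%:R)^-1 *: q) ^+ N * ('X^m + (N.+1%:R)^-1 *: q).
Proof.
move=> dq; rewrite derivM deriv_exp !poly.derivE /= !sub0r.
set A := 1 + _ *: q.
have -> : (1 - 'X) * ((0 + (N.+1%:R)^-1 *: q^`()) * A ^+ N *+ N.+1)
    = (1 - 'X^m) * A ^+ N.
  rewrite add0r -dq -scaler_nat -!scalerAl -!scalerAr scalerA.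
  by rewrite mulfV ?pnatr_eq0 // scale1r mulrA.
rewrite exprS /A; move: (_ *: q) => B; move: ((1 + B) ^+ N) ('X^m) => D E.
by ring.
Qed.

Section ElementaryFactor.
Variables (R : realType) (m : nat).
Local Notation C := (Cplx R).
Implicit Types (w z : C) (r : R).

Definition nneg_coef (p : {poly C}) := forall i, 0 <= p`_i.

Lemma nneg_coefM (p q : {poly C}) : nneg_coef p -> nneg_coef q -> nneg_coef (p * q).
Proof. by move=> hp hq i; rewrite coefM sumr_ge0 // => j _; rewrite mulr_ge0. Qed.

Lemma nneg_coefD (p q : {poly C}) : nneg_coef p -> nneg_coef q -> nneg_coef (p + q).
Proof. by move=> hp hq i; rewrite coefD addr_ge0. Qed.

Lemma nneg_coefX (p : {poly C}) n : nneg_coef p -> nneg_coef (p ^+ n).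
Proof.
move=> hp; elim: n => [|n IH]; last by rewrite exprS; exact: nneg_coefM.
by move=> i; rewrite expr0 coef1; exact: ler0n.
Qed.

(* If the derivative has coefficients of constant sign, its value at [r]
   majorises the coefficientwise mean value estimate on the disc of radius [r]. *)
Lemma horner_lipschitz (p : {poly C}) r w z : nneg_coef (- p^`()) ->
  cabs w <= r -> cabs z <= r ->
  cabs (p.[w] - p.[z]) <= cabs (w - z) * complex.Re (- p^`()).[rc r].
Proof.
move=> hp wr zr; set n := size p.
have sp : (size p <= n.+1)%N by [].
have sd : (size (- p^`()) <= n)%N.
  by rewrite size_polyN; apply: leq_trans (size_poly _ _) _; exact: leq_pred.
rewrite !(horner_coef_wide _ sp) (horner_coef_wide _ sd) -sumrB big_ord_recl /=.
rewrite !expr0 subrr add0r cRe_sum mulr_sumr; apply: le_trans (cabs_sum _ _ _) _.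
apply: ler_sum => i _; rewrite /bump /= add1n -mulrBr cabsM.
have -> : complex.Re ((- p^`())`_i * rc r ^+ i) = cabs p`_i.+1 * i.+1%:R * r ^+ i.
  rewrite -rcX cReM /= mulr0 subr0; congr (_ * _).
  rewrite -[RHS]ger0_norm ?mulr_ge0 ?cabs_ge0 // -(cabs_nat R) -cabsM.
  rewrite mulr_natr -coef_deriv -cabsN -coefN.
  have [-> h] := ge0C (hp i).
  by rewrite cabs_rc /= !ger0_norm.
rewrite mulrA [cabs (w - z) * _]mulrC -!mulrA ler_wpM2l ?cabs_ge0 //.
by rewrite mulrCA; exact: (@cabs_subX_le _ w z i.+1 r wr zr).
Qed.

Definition qpoly : {poly C} := \sum_(1 <= j < m.+1) (j%:R)^-1 *: 'X^j.
Definition qsum r : R := \sum_(1 <= j < m.+1) r ^+ j / j%:R.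
(* Replacing [exp q] by [(1 + q / N)^N] in [elem_factor m] gives polynomials
   whose derivative has coefficients of constant sign (see [deriv_fpoly]). *)
Definition fpoly N : {poly C} :=
  (1 - 'X) * (1 + (N.+1%:R)^-1 *: qpoly) ^+ N.+1.

Lemma horner_qpoly w : qpoly.[w] = \sum_(1 <= j < m.+1) w ^+ j / j%:R.
Proof.
by rewrite horner_sum; apply: eq_bigr => j _; rewrite hornerZ hornerXn mulrC.
Qed.

Lemma horner_qpoly_rc r : qpoly.[rc r] = rc (qsum r).
Proof.
rewrite horner_qpoly rc_sum; apply: eq_bigr => j _.
by rewrite rcM rcX rcV rc_nat.
Qed.

Lemma qsum_ge0 r : 0 <= r -> 0 <= qsum r.
Proof. by move=> r0; apply: sumr_ge0 => j _; rewrite divr_ge0 ?exprn_ge0. Qed.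

Lemma cabs_qpoly_le w r : cabs w <= r -> cabs qpoly.[w] <= qsum r.
Proof.
move=> wr; rewrite horner_qpoly; apply: le_trans (cabs_sum _ _ _) _.
apply: ler_sum => j _; rewrite cabsM cabsV cabsX cabs_nat.
rewrite ler_wpM2r ?invr_ge0 // lerXn2r // nnegrE ?cabs_ge0 //.
exact: le_trans (cabs_ge0 w) wr.
Qed.

Lemma nneg_coef_qpoly : nneg_coef qpoly.
Proof.
move=> i; rewrite coef_sum sumr_ge0 // => j _.
by rewrite coefZ coefXn mulr_ge0 // ?invr_ge0 ?ler0n.
Qed.

Lemma deriv_qpoly : (1 - 'X) * qpoly^`() = 1 - 'X^m.
Proof.
have -> : qpoly^`() = \sum_(i < m) 'X^i.
  rewrite /qpoly big_add1 big_mkord raddf_sum /=; apply: eq_bigr => j _.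
  by rewrite derivZ derivXn -[X in _ *: X]scaler_nat scalerA mulVf ?scale1r.
by rewrite -opprB mulNr -subrX1 opprB.
Qed.

Lemma deriv_fpoly N : - (fpoly N)^`() =
  (1 + (N.+1%:R)^-1 *: qpoly) ^+ N * ('X^m + (N.+1%:R)^-1 *: qpoly).
Proof.
exact: deriv_mul_exp deriv_qpoly.
Qed.

Lemma fpoly_lipschitz N r w z : cabs w <= r -> cabs z <= r ->
  cabs ((fpoly N).[w] - (fpoly N).[z])
    <= cabs (w - z) * (expR (qsum r) * (r ^+ m + qsum r / N.+1%:R)).
Proof.
move=> wr zr; have r0 : 0 <= r := le_trans (cabs_ge0 w) wr.
have N0 : 0 <= (N.+1%:R : C)^-1 by rewrite invr_ge0 ler0n.
have hB : nneg_coef ((N.+1%:R)^-1 *: qpoly).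
  by move=> i; rewrite coefZ mulr_ge0 ?nneg_coef_qpoly.
have h1 : nneg_coef (- (fpoly N)^`()).
  rewrite deriv_fpoly; apply: nneg_coefM.
    apply: nneg_coefX; apply: nneg_coefD => // i.
    by rewrite coef1; exact: ler0n.
  by apply: nneg_coefD => // i; rewrite coefXn; exact: ler0n.
apply: le_trans (horner_lipschitz h1 wr zr) _; rewrite ler_wpM2l ?cabs_ge0 //.
rewrite deriv_fpoly !hornerE ?hornerXn horner_qpoly_rc.
rewrite -rc_nat -rcV -rcM -rc1 -rcD -!rcX -rcD -rcM /=.
have q0 := qsum_ge0 r0; rewrite [_^-1 * _]mulrC.
rewrite ler_wpM2r ?addr_ge0 ?exprn_ge0 ?divr_ge0 //.
(* The exponent [N] is smaller than the denominator [N + 1], so the power stays below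
   [exp (qsum r)]. *)
apply: (@le_trans _ _ (expR (qsum r / N.+1%:R) ^+ N)).
  rewrite lerXn2r ?nnegrE ?expR_ge0 ?addr_ge0 ?divr_ge0 //.
  exact: expR_ge1Dx.
rewrite -expRM_natl ler_expR mulrCA ler_piMr //.
by rewrite ler_pdivrMr ?ltr0n // mul1r ler_nat.
Qed.

Lemma horner_fpoly N w : (fpoly N).[w]
  = (1 - w) * (1 + qpoly.[w] / N.+1%:R) ^+ N.+1.
Proof.
rewrite /fpoly hornerM hornerD hornerN hornerX hornerC horner_exp.
by rewrite hornerD hornerZ hornerC mulrC [_^-1 * _]mulrC mulrC.
Qed.

Lemma elem_factorE w : elem_factor m w = (1 - w) * cexp qpoly.[w].
Proof. by rewrite horner_qpoly. Qed.

Lemma cvg_fpoly w : (fun N => (fpoly N).[w]) @ \oo --> elem_factor m w.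
Proof.
rewrite elem_factorE.
under eq_fun do rewrite horner_fpoly.
by apply: cvgMr; exact: cvg_cexp.
Qed.

(** Limit of [fpoly_lipschitz], where the summand [qsum r / (N + 1)] drops out and the factor
    [r ^ m] remains. *)
Lemma elem_factor_lipschitz r w z : cabs w <= r -> cabs z <= r ->
  cabs (elem_factor m w - elem_factor m z)
    <= cabs (w - z) * (expR (qsum r) * r ^+ m).
Proof.
move=> wr zr.
have h1 : (fun N => cabs ((fpoly N).[w] - (fpoly N).[z])) @ \oo
    --> cabs (elem_factor m w - elem_factor m z).
  by apply: cvg_cabs; apply: cvgB; exact: cvg_fpoly.
have h2 : (fun N => cabs (w - z) * (expR (qsum r) * (r ^+ m + qsum r / N.+1%:R)))
    @ \oo --> cabs (w - z) * (expR (qsum r) * (r ^+ m + qsum r * 0)).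
  apply: cvgMr; apply: cvgMr; apply: cvgD (cvg_cst _) _.
  by apply: cvgMr; exact: cvg_harmonic.
rewrite mulr0 addr0 in h2.
rewrite -subr_ge0; apply: (cvgR_ge (N := 0%N) (cvgB h2 h1)) => N _.
by rewrite !fctE subr_ge0; exact: fpoly_lipschitz.
Qed.

Lemma elem_factor0 : elem_factor m (0 : C) = 1.
Proof.
rewrite elem_factorE subr0 mul1r horner_qpoly big_nat big1 ?cexp0 //.
by move=> j /andP[j0 _]; rewrite expr0n gtn_eqF // mul0r.
Qed.

Lemma qsum_le r r' : 0 <= r -> r <= r' -> qsum r <= qsum r'.
Proof.
move=> r0 rr'; apply: ler_sum => j _; rewrite ler_wpM2r ?invr_ge0 //.
by rewrite lerXn2r // nnegrE // (le_trans r0).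
Qed.

Lemma elem_factor_sub1 r w : cabs w <= r ->
  cabs (elem_factor m w - 1) <= expR (qsum r) * cabs w ^+ m.+1.
Proof.
move=> wr; rewrite -elem_factor0.
(* The radius is taken to be [cabs w] itself, so that [r ^ m] supplies the remaining powers of
   [cabs w]; only the exponential is enlarged to radius [r]. *)
apply: le_trans (elem_factor_lipschitz (lexx (cabs w)) _) _.
  by rewrite cabs0 cabs_ge0.
rewrite subr0 mulrCA exprS ler_wpM2r ?mulr_ge0 ?exprn_ge0 ?cabs_ge0 //.
by rewrite ler_expR qsum_le ?cabs_ge0.
Qed.

Lemma elem_factor_poly r eps : 0 < eps -> exists p : {poly C},
  forall w, cabs w <= r -> cabs (elem_factor m w - p.[w]) <= eps.
Proof.
move=> e0; have [rneg|r0] := ltP r 0.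
  exists 0 => w wr; have := le_lt_trans (le_trans (cabs_ge0 w) wr) rneg.
  by rewrite ltxx.
pose Q := qsum r; have Q0 : 0 <= Q := qsum_ge0 r0.
(* [1 + r] bounds [1 - w], and the rest is the rate of [cexp_approx] on the disc of radius [Q],
   which contains the values of [qpoly]. *)
pose K := (1 + r) * (9 * Q ^+ 2 * expR Q).
have K0 : 0 <= K by rewrite mulr_ge0 ?addr_ge0 // !mulr_ge0 ?exprn_ge0 ?expR_ge0.
pose N := maxn (Num.truncn (2 * Q)).+1 (Num.truncn (K / eps)).+1.
have hN1 : 2 * Q <= N.+1%:R.
  apply: le_trans (ltW (truncnS_gt _)) _.
  by rewrite ler_nat; apply: leqW; exact: leq_maxl.
have hN2 : K / N.+1%:R <= eps.
  rewrite ler_pdivrMr ?ltr0n // mulrC -ler_pdivrMr //.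
  apply: le_trans (ltW (truncnS_gt _)) _.
  by rewrite ler_nat; apply: leqW; exact: leq_maxr.
exists (fpoly N) => w wr; apply: le_trans hN2.
rewrite elem_factorE horner_fpoly -mulrBr cabsM /K -mulrA.
apply: ler_pM; rewrite ?cabs_ge0 //.
  by apply: le_trans (cabsB _ _) _; rewrite cabs1 lerD2l.
by apply: cexp_approx => //; exact: cabs_qpoly_le.
Qed.

End ElementaryFactor.


(** * Cauchy's formula and the functional calculus *)

Section CircleIntegral.
Variable R : realType.
Local Notation C := (Cplx R).
Implicit Types (h g : R -> C) (c d : C) (r t : R).

Definition cont (h : R -> C) := forall t, h @ t --> h t.

Lemma cont_Re h : cont h -> continuous (fun t => complex.Re (h t)).
Proof.
move=> ch t; apply/cvgrPdistC_lt => eps e0.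
have /cvgrPdistC_lt/(_ (rc eps)) := ch t.
rewrite -[X in X < _]rc0 rc_lt => /(_ e0); apply: filterS => s.
rewrite normE rc_lt; apply: le_lt_trans.
by rewrite -cReN -cReD Re_le_cabs.
Qed.

Lemma cont_Im h : cont h -> continuous (fun t => complex.Im (h t)).
Proof.
move=> ch t; apply/cvgrPdistC_lt => eps e0.
have /cvgrPdistC_lt/(_ (rc eps)) := ch t.
rewrite -[X in X < _]rc0 rc_lt => /(_ e0); apply: filterS => s.
rewrite normE rc_lt; apply: le_lt_trans.
by rewrite -cImN -cImD Im_le_cabs.
Qed.

Lemma cont_rc (f : R -> R) : continuous f -> cont (fun t => rc (f t)).
Proof.
move=> cf t; apply/cvgrPdistC_lt => eps e0.
have [e1 _] := ge0C (ltW e0).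
have r0 : 0 < complex.Re eps by rewrite -rc_lt -e1.
have /cvgrPdistC_lt/(_ _ r0) := cf t; apply: filterS => s.
by rewrite e1 -rcB normE rc_lt cabs_rc.
Qed.

Lemma cont_cst c : cont (fun=> c). Proof. by move=> t; exact: cvg_cst. Qed.
Lemma contD h g : cont h -> cont g -> cont (fun t => h t + g t).
Proof. by move=> ch cg t; apply: cvgD; [exact: ch|exact: cg]. Qed.
Lemma contB h g : cont h -> cont g -> cont (fun t => h t - g t).
Proof. by move=> ch cg t; apply: cvgB; [exact: ch|exact: cg]. Qed.
Lemma contM h g : cont h -> cont g -> cont (fun t => h t * g t).
Proof. by move=> ch cg t; apply: cvgM; [exact: ch|exact: cg]. Qed.
Lemma contV h : cont h -> (forall t, h t != 0) -> cont (fun t => (h t)^-1).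
Proof. by move=> ch h0 t; apply: cvgV; [exact: h0|exact: ch]. Qed.
Lemma contX h n : cont h -> cont (fun t => h t ^+ n).
Proof.
move=> ch; elim: n => [|n IH]; first exact: cont_cst.
rewrite (_ : (fun t => h t ^+ n.+1) = (fun t => h t * h t ^+ n)).
  exact: contM.
by apply/funext => t; rewrite exprS.
Qed.

Definition cis t : C := Complex (cos t) (sin t).

Lemma cisE t : cis t = rc (cos t) + Complex 0 1 * rc (sin t).
Proof. by apply: cplx_eq; rewrite !(cReD, cReM, cImD, cImM) /=; ring. Qed.

Lemma cont_cis : cont cis.
Proof.
rewrite (_ : cis = (fun t => rc (cos t) + Complex 0 1 * rc (sin t))); last first.
  by apply/funext => t; rewrite cisE.
apply: contD; first by apply: cont_rc; exact: continuous_cos.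
apply: contM; first exact: cont_cst.
by apply: cont_rc; exact: continuous_sin.
Qed.

Lemma cabs_cisE t : cabs (cis t) = 1. Proof. exact: cabs_cis. Qed.

Lemma cis_neq0 t : cis t != 0.
Proof. by rewrite -cabs_eq0 cabs_cisE oner_eq0. Qed.

Lemma cisX t n : cis t ^+ n = cis (n%:R * t).
Proof.
elim: n => [|n IH].
  by rewrite mul0r; apply: cplx_eq; rewrite /= ?cos0 ?sin0.
rewrite exprS IH -natr1 mulrDl mul1r addrC.
by apply: cplx_eq; rewrite !(cReM, cImM) /= ?cosD ?sinD; ring.
Qed.

Lemma cisV t : (cis t)^-1 = (cis t)^*.
Proof.
rewrite -[RHS](mulfK (cis_neq0 t)) conj_mul cabs_cisE expr1n rc1 mul1r //.
Qed.

Let D : set R := `[0, 2 * pi]%classic.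
Notation mu := (@lebesgue_measure R).

Lemma cont_integrable (f : R -> R) : continuous f -> mu.-integrable D (EFin \o f).
Proof.
move=> cf; apply: continuous_compact_integrable; first exact: segment_compact.
exact: continuous_subspaceT.
Qed.

Lemma measurable_D : measurable (D : set (measurableTypeR R)).
Proof. exact: measurable_itv. Qed.

Lemma mu_D : fine (mu D) = 2 * pi.
Proof.
rewrite /D lebesgue_measure_itv /= lte_fin.
by rewrite ifT ?subr0 ?mulr_gt0 ?pi_gt0 //= subr0.
Qed.

Lemma RintegralD_cont (f g : R -> R) : continuous f -> continuous g ->
  Rintegral mu D (fun t => f t + g t) = Rintegral mu D f + Rintegral mu D g.
Proof.
move=> cf cg; apply: RintegralD; [exact: measurable_D|exact: cont_integrable..].
Qed.

Lemma RintegralZ_cont x (f : R -> R) : continuous f ->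
  Rintegral mu D (fun t => x * f t) = x * Rintegral mu D f.
Proof.
move=> cf; apply: RintegralZl; [exact: measurable_D|exact: cont_integrable].
Qed.

Lemma Rintegral_abs_le (f : R -> R) (M : R) : continuous f ->
  (forall t, `|f t| <= M) -> `|Rintegral mu D f| <= 2 * pi * M.
Proof.
move=> cf fM.
have h := le_normr_Rintegral measurable_D (cont_integrable cf).
apply: (le_trans h).
rewrite -mu_D mulrC -(Rintegral_cst mu measurable_D M).
apply: le_Rintegral; [exact: measurable_D|..|by []].
  by apply: cont_integrable => t; apply: cvg_norm; exact: cf.
by apply: cont_integrable => t; exact: cvg_cst.
Qed.

Lemma integral_2pi_lin c h g : cont h -> cont g ->
  integral_2pi (fun t => c * h t + g t) = c * integral_2pi h + integral_2pi g.
Proof.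
move=> ch cg; have rh := cont_Re ch; have ih := cont_Im ch.
have rg := cont_Re cg; have ig := cont_Im cg.
have cZ x (f : R -> R) : continuous f -> continuous (fun t => x * f t).
  by move=> cf t; apply: cvgM (cvg_cst _) (cf t).
have cD (f f' : R -> R) : continuous f -> continuous f' -> continuous (fun t => f t + f' t).
  by move=> cf cf' t; apply: cvgD (cf t) (cf' t).
apply: cplx_eq; rewrite !(cReD, cImD, cReM, cImM) /= -/D.
  under [LHS]eq_Rintegral do rewrite cReD cReM -mulNr.
  rewrite !(RintegralD_cont, RintegralZ_cont) ?mulNr //; [exact: cZ..|by apply: cD; exact: cZ].
under [LHS]eq_Rintegral do rewrite cImD cImM.
rewrite !(RintegralD_cont, RintegralZ_cont) //; [exact: cZ..|by apply: cD; exact: cZ].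
Qed.

Lemma integral_2pi_cst c : integral_2pi (fun=> c) = c * rc (2 * pi).
Proof.
apply: cplx_eq; rewrite !(cReM, cImM) /= -/D Rintegral_cst ?mu_D ?mulr0 ?subr0 ?add0r //;
exact: measurable_D.
Qed.

(** The constant is [4 pi] because real and imaginary parts are bounded separately; only smallness
    of such integrals matters. *)
Lemma integral_2pi_le h M : cont h -> (forall t, cabs (h t) <= M) ->
  cabs (integral_2pi h) <= 4 * pi * M.
Proof.
move=> ch hM; apply: le_trans (cabs_le_ReIm _) _ => /=; rewrite -/D.
have h1 : `|Rintegral mu D (fun t => complex.Re (h t))| <= 2 * pi * M.
  apply: Rintegral_abs_le (cont_Re ch) _ => t.
  exact: le_trans (Re_le_cabs _) (hM t).
have h2 : `|Rintegral mu D (fun t => complex.Im (h t))| <= 2 * pi * M.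
  apply: Rintegral_abs_le (cont_Im ch) _ => t.
  exact: le_trans (Im_le_cabs _) (hM t).
by apply: le_trans (lerD h1 h2) _; lra.
Qed.

Lemma integral_2pi_ext h g : h =1 g -> integral_2pi h = integral_2pi g.
Proof. by move=> /funext ->. Qed.

Lemma integral_2piZ c h : cont h -> integral_2pi (fun t => c * h t) = c * integral_2pi h.
Proof.
move=> ch; have := integral_2pi_lin c ch (@cont_cst 0).
rewrite integral_2pi_cst mul0r addr0 => <-.
by apply: integral_2pi_ext => t; rewrite addr0.
Qed.

Lemma integral_2pi_conj h : cont h ->
  integral_2pi (fun t => (h t)^*) = (integral_2pi h)^*.
Proof.
move=> ch; apply: cplx_eq; rewrite ?cRe_conj ?cIm_conj /= -/D.
  by apply: eq_Rintegral => t _; rewrite cRe_conj.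
rewrite -mulN1r -RintegralZ_cont; last exact: cont_Im.
by apply: eq_Rintegral => t _; rewrite cIm_conj mulN1r.
Qed.

Lemma Rintegral_deriv (F f : R -> R) : (forall t, is_derive t 1 F (f t)) ->
  continuous f -> Rintegral mu D f = F (2 * pi) - F 0.
Proof.
move=> dF cf; rewrite /Rintegral (@continuous_FTC2 _ f F) ?mulr_gt0 ?pi_gt0 //.
- exact: continuous_subspaceT.
- have cF t : {for t, continuous F}.
    by apply: differentiable_continuous; apply/derivable1_diffP; have [] := dF t.
  split; first by move=> t _; have [] := dF t.
    by apply: cvg_at_right_filter; exact: cF.
  by apply: cvg_at_left_filter; exact: cF.
- by move=> t _; rewrite derive1E; exact: derive_val.
Qed.

Lemma is_derive_scalel (c : R) (f : R -> R) (df t : R) : is_derive t 1 f df ->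
  is_derive t 1 (fun t => c * f t) (c * df).
Proof. exact: @is_deriveZ R R R f c t 1 df. Qed.

Lemma is_derive_comp_scale (f : R -> R) (df x t : R) : is_derive (x * t) 1 f df ->
  is_derive t 1 (fun t => f (x * t)) (df * x).
Proof.
move=> hf; have h : is_derive t 1 (fun t => x * t) x.
  by have := is_derive_scalel x (is_derive_id t 1); rewrite mulr1.
exact: (is_derive1_comp hf h).
Qed.

Lemma integral_2pi_cisX n : (0 < n)%N -> integral_2pi (fun t => cis t ^+ n) = 0.
Proof.
move=> n0; have n1 : (n%:R : R) != 0 by rewrite pnatr_eq0 -lt0n.
have per : cis (n%:R * (2 * pi)) = 1.
  rewrite -cisX (_ : cis _ = 1) ?expr1n //.
  by apply: cplx_eq; rewrite /= mulr_natl ?cos2pi ?sin2pi.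
have pc : cos (n%:R * (2 * pi)) = 1 := congr1 (@complex.Re R) per.
have ps : sin (n%:R * (2 * pi)) = 0 := congr1 (@complex.Im R) per.
have cnt (f : R -> R) : continuous f -> continuous (fun t => f (n%:R * t)).
  move=> cf t; apply: (@continuous_comp _ _ _ (fun t => n%:R * t) f); last exact: cf.
  exact: cvgM (cvg_cst _) cvg_id.
under integral_2pi_ext do rewrite cisX.
apply: cplx_eq; rewrite /= -/D.
  have d t : is_derive t 1 (fun t => n%:R^-1 * sin (n%:R * t)) (cos (n%:R * t)).
    have -> : cos (n%:R * t) = n%:R^-1 * (cos (n%:R * t) * n%:R) by field.
    exact: is_derive_scalel (is_derive_comp_scale (is_derive_sin _)).
  rewrite (Rintegral_deriv d) ?ps ?mulr0 ?sin0 ?mulr0 ?subrr //.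
  by apply: cnt; exact: continuous_cos.
have d t : is_derive t 1 (fun t => - n%:R^-1 * cos (n%:R * t)) (sin (n%:R * t)).
  have -> : sin (n%:R * t) = - n%:R^-1 * (- sin (n%:R * t) * n%:R) by field.
  exact: is_derive_scalel (is_derive_comp_scale (is_derive_cos _)).
rewrite (Rintegral_deriv d) ?pc ?mulr0 ?cos0 ?subrr //.
by apply: cnt; exact: continuous_sin.
Qed.

Lemma integral_2pi_cisVX n : (0 < n)%N ->
  integral_2pi (fun t => (cis t)^-1 ^+ n) = 0.
Proof.
move=> n0; rewrite -(conjC0 (Cplx R)) -(integral_2pi_cisX n0) -integral_2pi_conj.
  by apply: integral_2pi_ext => t; rewrite cisV rmorphXn.
by apply: contX; exact: cont_cis.
Qed.

End CircleIntegral.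


Section Cauchy.
Variable R : realType.
Local Notation C := (Cplx R).
Implicit Types (c : C) (t : R).
(** On the circle [dw = i w dt], so [k t dt] is the Cauchy kernel [dw / (i (w - d))]. *)
Variables (r : R) (d : C) (w k : R -> C).
Hypothesis r_gt_d : cabs d < r.
Hypothesis wE : forall t, w t = rc r * cis t.
Hypothesis kE : forall t, k t = w t / (w t - d).

Let r0 : 0 < r. Proof. exact: le_lt_trans (cabs_ge0 d) r_gt_d. Qed.

Let w_abs t : cabs (w t) = r.
Proof. by rewrite wE cabsM cabs_cisE mulr1 cabs_rc gtr0_norm. Qed.
Let w0 t : w t != 0. Proof. by rewrite wE mulf_neq0 ?cis_neq0 // rc_eq0 gt_eqF. Qed.
Let wd t : w t - d != 0.
Proof.
apply/eqP => h; have := w_abs t; have -> : w t = d by apply/eqP; rewrite -subr_eq0 h.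
by move=> e; move: r_gt_d; rewrite e ltxx.
Qed.
Let cw : cont w.
Proof. by rewrite (funext wE); apply: contM; [exact: cont_cst|exact: cont_cis]. Qed.
Let ck : cont k.
Proof.
rewrite (funext kE); apply: contM; first exact: cw.
by apply: contV; [apply: contB; [exact: cw|exact: cont_cst]|exact: wd].
Qed.
Let K := r / (r - cabs d).
Let k_le t : cabs (k t) <= K.
Proof.
rewrite kE cabsM cabsV w_abs ler_wpM2l ?(ltW r0) // lef_pV2 ?posrE ?subr_gt0 //.
  by rewrite -(w_abs t) lerBlDr; have := cabsD (w t - d) d; rewrite subrK.
by rewrite lt_neqAle cabs_ge0 eq_sym cabs_eq0 wd.
Qed.

Let K0 : 0 <= K. Proof. by rewrite divr_ge0 ?subr_ge0 //; exact: ltW. Qed.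

Let cdw n : cont (fun t => (d / w t) ^+ n).
Proof.
apply: contX; apply: contM; first exact: cont_cst.
by apply: contV; [exact: cw|exact: w0].
Qed.

Let k_rec t : k t = 1 + d / w t * k t.
Proof. by rewrite !kE; field; rewrite w0 wd. Qed.

(** By [k_rec], raising the exponent changes the integral only by that of a negative power of [cis],
    which is zero. The integral is thus independent of the exponent, while its bound decays like
    [(|d| / r) ^ m]. *)
Let tail n : integral_2pi (fun t => (d / w t) ^+ n.+1 * k t) = 0.
Proof.
have rec m : integral_2pi (fun t => (d / w t) ^+ m.+1 * k t)
    = integral_2pi (fun t => (d / w t) ^+ m.+2 * k t).
  transitivity (integral_2pi (fun t => (d / rc r) ^+ m.+1 * ((cis t)^-1 ^+ m.+1)
      + (d / w t) ^+ m.+2 * k t)).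
    apply: integral_2pi_ext => t; rewrite {1}k_rec mulrDr mulr1 mulrA -exprSr.
    by congr (_ + _); rewrite -exprMn wE invfM mulrA.
  rewrite integral_2pi_lin; last 2 first.
  - by apply: contX; apply: contV; [exact: cont_cis|exact: cis_neq0].
  - by apply: contM; [exact: cdw|exact: ck].
  by rewrite (@integral_2pi_cisVX _ m.+1) // mulr0 add0r.
have Im m : integral_2pi (fun t => (d / w t) ^+ n.+1 * k t)
    = integral_2pi (fun t => (d / w t) ^+ (n + m).+1 * k t).
  elim: m => [|m IH]; first by rewrite addn0.
  rewrite addnS -rec; exact: IH.
move: (integral_2pi _) Im => I1 Im.
pose rho := cabs d / r.
have rho1 : rho < 1 by rewrite ltr_pdivrMr // mul1r.
have rho0 : 0 <= rho by rewrite divr_ge0 ?cabs_ge0 // ltW.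
have bd m : cabs I1 <= 4 * pi * (rho ^+ m * K).
  rewrite (Im m); apply: integral_2pi_le.
    by apply: contM; [exact: cdw|exact: ck].
  move=> t; rewrite cabsM cabsX cabsM cabsV w_abs; apply: ler_pM => //.
  - by rewrite exprn_ge0.
  - exact: cabs_ge0.
  - by rewrite ler_wiXn2l ?(ltW rho1) // -addSn leq_addl.
have lim : (fun m => 4 * pi * (rho ^+ m * K)) @ \oo --> 4 * pi * (0 * K).
  apply: cvgMr; apply: cvgMl; apply: cvg_expr.
  by rewrite ger0_norm.
rewrite mul0r mulr0 in lim.
apply/eqP; rewrite -cabs_eq0 eq_le cabs_ge0 andbT.
by apply: (cvgR_ge (N := 0%N) lim) => m _; exact: bd.
Qed.

Let kernel : integral_2pi k = rc (2 * pi).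
Proof.
transitivity (integral_2pi (fun t => 1 * ((d / w t) ^+ 1 * k t) + 1)).
  by apply: integral_2pi_ext => t; rewrite expr1 mul1r addrC -k_rec.
rewrite integral_2pi_lin; last 2 first.
- by apply: contM; [exact: cdw|exact: ck].
- exact: cont_cst.
by rewrite (tail 0) mulr0 add0r integral_2pi_cst mul1r.
Qed.

(** Induction through [w k = d k + w], since positive powers of [w] integrate to zero. *)
Let monomial n : integral_2pi (fun t => w t ^+ n * k t) = d ^+ n * rc (2 * pi).
Proof.
elim: n => [|n IH].
  by rewrite expr0 mul1r -kernel; apply: integral_2pi_ext => t; rewrite mul1r.
transitivity (integral_2pi (fun t => d * (w t ^+ n * k t)
    + rc r ^+ n.+1 * cis t ^+ n.+1)).
  apply: integral_2pi_ext => t; rewrite -exprMn -wE.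
  by rewrite !exprS !kE; field; rewrite wd.
have c1 : cont (fun t => cis t ^+ n.+1) by apply: contX; exact: cont_cis.
rewrite integral_2pi_lin; last 2 first.
- by apply: contM; [apply: contX; exact: cw|exact: ck].
- by apply: contM; [exact: cont_cst|exact: c1].
by rewrite IH integral_2piZ // integral_2pi_cisX // mulr0 addr0 exprS mulrA.
Qed.

Let cont_horner (p : {poly C}) : cont (fun t => p.[w t]).
Proof.
elim/poly_ind: p => [|p c IH].
  under [X in cont X]eq_fun do rewrite horner0; exact: cont_cst.
under [X in cont X]eq_fun do rewrite hornerD hornerMX hornerC.
by apply: contD; [apply: contM; [exact: IH|exact: cw]|exact: cont_cst].
Qed.

Let polynomial (p : {poly C}) :
  integral_2pi (fun t => p.[w t] * k t) = p.[d] * rc (2 * pi).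
Proof.
suff gen n (q : nat -> C) : integral_2pi (fun t => (\sum_(i < n) q i * w t ^+ i) * k t)
    = (\sum_(i < n) q i * d ^+ i) * rc (2 * pi).
  rewrite horner_coef -gen; apply: integral_2pi_ext => t.
  by rewrite horner_coef.
elim: n => [|n IH].
  rewrite big_ord0 mul0r -[RHS](mul0r (rc (2 * pi))) -integral_2pi_cst.
  by apply: integral_2pi_ext => t; rewrite big_ord0 mul0r.
transitivity (integral_2pi (fun t => q n * (w t ^+ n * k t)
    + (\sum_(i < n) q i * w t ^+ i) * k t)).
  apply: integral_2pi_ext => t; rewrite big_ord_recr /= mulrDl addrC.
  by rewrite mulrA.
rewrite integral_2pi_lin ?IH ?monomial.
- by rewrite big_ord_recr /= [RHS]mulrDl [LHS]addrC -[(_ * _) * rc _ in RHS]mulrA.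
- by apply: contM; [apply: contX; exact: cw|exact: ck].
apply: contM; last exact: ck.
have := @cont_horner (\poly_(i < n) q i); congr cont; apply/funext => t.
by rewrite horner_poly.
Qed.

(* Polynomial approximation replaces the power series of [f]. *)
Lemma cauchy_formula (f : C -> C) : cont (fun t => f (w t)) ->
  (forall eps : R, 0 < eps -> exists p : {poly C},
     forall z, cabs z <= r -> cabs (f z - p.[z]) <= eps) ->
  integral_2pi (fun t => f (w t) * k t) = f d * rc (2 * pi).
Proof.
move=> cf fp; apply/eqP; rewrite -subr_eq0 -cabs_eq0 eq_le cabs_ge0 andbT.
have p0 := pi_gt0 R.
(* [4 pi K] is the error made under the integral, [2 pi] the error in the value at [d], and [1]
   leaves room to spare. *)
have B0 : 0 < 4 * pi * K + 2 * pi + 1.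
  by have := mulr_ge0 (ltW p0) K0; lra.
apply/ler_addgt0Pr => e e0; rewrite add0r.
have [|p hp] := fp (e / (4 * pi * K + 2 * pi + 1)); first by rewrite divr_gt0.
set eps := e / _ in hp.
have eps0 : 0 < eps by rewrite divr_gt0.
have cfp : cont (fun t => (f (w t) - p.[w t]) * k t).
  apply: contM; last exact: ck.
  by apply: contB; [exact: cf|exact: cont_horner].
have -> : integral_2pi (fun t => f (w t) * k t) =
    integral_2pi (fun t => (f (w t) - p.[w t]) * k t) + p.[d] * rc (2 * pi).
  have cp : cont (fun t => p.[w t] * k t).
    by apply: contM; [exact: cont_horner|exact: ck].
  have := integral_2pi_lin 1 cfp cp; rewrite mul1r polynomial => <-.
  by apply: integral_2pi_ext => t; rewrite mul1r -mulrDl subrK.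
rewrite -addrA -mulrBl; apply: le_trans (cabsD _ _) _.
have h1 : cabs (integral_2pi (fun t => (f (w t) - p.[w t]) * k t)) <= 4 * pi * (eps * K).
  apply: integral_2pi_le => // t; rewrite cabsM; apply: ler_pM; rewrite ?cabs_ge0 //.
  by apply: hp; rewrite w_abs.
have h2 : cabs ((p.[d] - f d) * rc (2 * pi)) <= eps * (2 * pi).
  rewrite cabsM cabs_rc ger0_norm ?mulr_ge0 ?(ltW p0) //.
  rewrite ler_wpM2r ?mulr_ge0 ?(ltW p0) // cabs_distrC; apply: hp.
  exact: ltW.
apply: le_trans (lerD h1 h2) _.
have -> : e = eps * (4 * pi * K + 2 * pi + 1) by rewrite divfK // gt_eqF.
by nra.
Qed.

End Cauchy.


Section DiagonalConjugation.
Variable F : fieldType.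

Lemma invmx_conj_diag (n : nat) (P : 'M[F]_n) (d : 'rV[F]_n) : P \in unitmx ->
  (forall l, d 0 l != 0) ->
  invmx (invmx P *m diag_mx d *m P)
    = invmx P *m diag_mx (\row_l (d 0 l)^-1) *m P.
Proof.
move=> Pu d0; set M := _ *m _ *m P; set N := RHS.
suff MN : M *m N = 1%:M.
  by have [Mu _] := mulmx1_unit MN; rewrite -[RHS]mul1mx -(mulVmx Mu) -mulmxA MN mulmx1.
rewrite /M /N -!mulmxA (mulmxA P) mulmxV // mul1mx (mulmxA (diag_mx _) (diag_mx _)).
rewrite mulmx_diag (_ : diag_mx _ = 1%:M) ?mul1mx ?mulVmx //.
apply/matrixP => i j; rewrite !mxE; case: eqP => [->|_]; rewrite ?mulr0n // !mulr1n.
by rewrite mulfV.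
Qed.

Lemma invmx_diag (n : nat) (P : 'M[F]_n) (d : 'rV[F]_n) (w : F) :
  P \in unitmx -> (forall l, w != d 0 l) ->
  invmx (w%:M - invmx P *m diag_mx d *m P)
    = invmx P *m diag_mx (\row_l (w - d 0 l)^-1) *m P.
Proof.
move=> Pu wd.
have -> : w%:M - invmx P *m diag_mx d *m P
    = invmx P *m diag_mx (\row_l (w - d 0 l)) *m P.
  have -> : diag_mx (\row_l (w - d 0 l)) = w%:M - diag_mx d.
    apply/matrixP => i j; rewrite !mxE; case: eqP => _; rewrite ?mulr1n //.
    by rewrite !mulr0n subr0.
  by rewrite mulmxBr mulmxBl scalar_mxC -[w%:M *m _ *m _]mulmxA mulVmx // mulmx1.
rewrite (@invmx_conj_diag n P (\row_l (w - d 0 l)) Pu); last first.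
  by move=> l; rewrite mxE subr_eq0.
have -> : (\row_l ((\row_l (w - d 0 l)) 0 l)^-1) = \row_l (w - d 0 l)^-1.
  by apply/rowP => l; rewrite !mxE.
by [].
Qed.

Lemma mx_diag_entry (n : nat) (Q P : 'M[F]_n) (d : 'rV[F]_n) i j :
  (Q *m diag_mx d *m P) i j = \sum_l Q i l * P l j * d 0 l.
Proof.
rewrite mxE; apply: eq_bigr => l _; rewrite mul_mx_diag mxE.
by rewrite -mulrA [d 0 l * _]mulrC mulrA.
Qed.

Lemma det_conj_diag (n : nat) (P : 'M[F]_n) (d : 'rV[F]_n) : P \in unitmx ->
  \det (invmx P *m diag_mx d *m P) = \prod_l d 0 l.
Proof.
by move=> Pu; rewrite !det_mulmx det_inv det_diag mulrAC mulVr -?unitmxE // mul1r.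
Qed.

End DiagonalConjugation.

Section FunctionalCalculus.
Variable R : realType.
Local Notation C := (Cplx R).

Lemma cont_sum (I : Type) (s : seq I) (h : I -> R -> C) :
  (forall i, cont (h i)) -> cont (fun t => \sum_(i <- s) h i t).
Proof.
move=> ch; elim: s => [|i s IH].
  by under [X in cont X]eq_fun do rewrite big_nil; exact: cont_cst.
under [X in cont X]eq_fun do rewrite big_cons.
by apply: contD; [exact: ch|exact: IH].
Qed.

Lemma integral_2pi_sum (I : Type) (s : seq I) (c : I -> C) (h : I -> R -> C) :
  (forall i, cont (h i)) ->
  integral_2pi (fun t => \sum_(i <- s) c i * h i t)
    = \sum_(i <- s) c i * integral_2pi (h i).
Proof.
move=> ch; elim: s => [|i s IH].
  rewrite big_nil -[RHS](mul0r (rc (2 * pi))) -integral_2pi_cst.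
  by apply: integral_2pi_ext => t; rewrite big_nil.
rewrite big_cons -IH -integral_2pi_lin //.
  by apply: integral_2pi_ext => t; rewrite big_cons.
by apply: cont_sum => j; apply: contM; [exact: cont_cst|exact: ch].
Qed.

Definition hfc_radiusR (n : nat) (A : 'M[C]_n) : R :=
  1 + \sum_(i < n) \sum_(j < n) cabs (A i j).

Lemma hfc_radiusE (n : nat) (A : 'M[C]_n) : hfc_radius A = rc (hfc_radiusR A).
Proof.
rewrite /hfc_radius rcD rc1 rc_sum; congr (1 + _); apply: eq_bigr => i _.
by rewrite rc_sum; apply: eq_bigr => j _; rewrite normE.
Qed.

Lemma hfcE (f : C -> C) (n : nat) (A : 'M[C]_n) i j :
  hfc f A i j = (rc (2 * pi) * Complex 0 1)^-1 *
    integral_2pi (fun t => f (rc (hfc_radiusR A) * cis t) *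
      invmx ((rc (hfc_radiusR A) * cis t)%:M - A) i j *
      (Complex 0 1 * (rc (hfc_radiusR A) * cis t))).
Proof. by rewrite mxE hfc_radiusE. Qed.

(** Sums of absolute values are compared in [v A = d v]. Row eigenvectors are used because the rows
    of [P] are eigenvectors of [P^-1 D P]. *)
Lemma eigen_lt_radius (n : nat) (A : 'M[C]_n) (v : 'rV[C]_n) (d : C) :
  v != 0 -> v *m A = d *: v -> cabs d < hfc_radiusR A.
Proof.
move=> v0 vA; pose S := \sum_(j < n) cabs (v 0 j).
have S0 : 0 < S.
  rewrite lt_neqAle sumr_ge0 ?andbT; last by move=> j _; exact: cabs_ge0.
  apply: contra v0 => /eqP h; apply/eqP/rowP => j; rewrite mxE.
  apply/eqP; rewrite -cabs_eq0; apply/eqP.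
  by apply: (psumr_eq0P _ (esym h)) => // i _; exact: cabs_ge0.
pose M := \sum_(i < n) \sum_(j < n) cabs (A i j).
suff : cabs d * S <= S * M.
  rewrite mulrC ler_pM2l // => h; apply: le_lt_trans h _.
  by rewrite /hfc_radiusR ltrDr.
have -> : cabs d * S = \sum_(j < n) cabs (\sum_i v 0 i * A i j).
  rewrite mulr_sumr; apply: eq_bigr => j _; rewrite -cabsM; congr cabs.
  by have /rowP/(_ j) := vA; rewrite !mxE => <-.
apply: (@le_trans _ _ (\sum_(j < n) \sum_i cabs (v 0 i) * cabs (A i j))).
  apply: ler_sum => j _; apply: le_trans (cabs_sum _ _ _) _.
  by apply: ler_sum => i _; rewrite cabsM.
rewrite exchange_big /= mulr_suml; apply: ler_sum => i _.
rewrite -mulr_sumr ler_wpM2l ?cabs_ge0 // [leRHS](bigD1 i) //= lerDl.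
by apply: sumr_ge0 => k _; apply: sumr_ge0 => l _; exact: cabs_ge0.
Qed.

(** Each resolvent entry is a combination of the functions [1 / (w - d_l)], and the circle encloses
    every [d_l]; Cauchy's formula then applies termwise. *)
Lemma hfc_diag (f : C -> C) (n : nat) (P : 'M[C]_n) (d : 'rV[C]_n) :
  P \in unitmx ->
  (forall r, cont (fun t => f (rc r * cis t))) ->
  (forall r (eps : R), 0 < eps -> exists p : {poly C},
     forall z, cabs z <= r -> cabs (f z - p.[z]) <= eps) ->
  hfc f (invmx P *m diag_mx d *m P)
    = invmx P *m diag_mx (\row_l f (d 0 l)) *m P.
Proof.
move=> Pu cf fp; set A := invmx P *m _ *m P.
have dr l : cabs (d 0 l) < hfc_radiusR A.
  apply: (@eigen_lt_radius _ A (row l P)).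
    apply/eqP => h; have : row l P *m invmx P = 0 by rewrite h mul0mx.
    rewrite -row_mul mulmxV // => /rowP/(_ l); rewrite !mxE eqxx => /eqP.
    by rewrite oner_eq0.
  rewrite -row_mul /A !mulmxA mulmxV // mul1mx row_mul row_diag_mx.
  by rewrite -scalemxAl -rowE.
set rho := hfc_radiusR A in dr *.
pose w t := rc rho * cis t.
have wd t l : w t != d 0 l.
  apply/eqP => h; have := dr l; rewrite -h cabsM cabs_cisE mulr1 cabs_rc.
  by rewrite ltNge ler_norm.
apply/matrixP => i j; rewrite hfcE -/rho.
pose h l t := f (w t) * (w t / (w t - d 0 l)).
have ch l : cont (h l).
  have cw : cont w by apply: contM; [exact: cont_cst|exact: cont_cis].
  apply: contM; first exact: cf.
  apply: contM; first exact: cw.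
  apply: contV; first by apply: contB; [exact: cw|exact: cont_cst].
  by move=> t; rewrite subr_eq0.
rewrite (@integral_2pi_ext _ _
  (fun t => \sum_l Complex 0 1 * (invmx P i l * P l j) * h l t)); last first.
  move=> t; rewrite -/(w t) invmx_diag // mx_diag_entry mulr_sumr mulr_suml.
  apply: eq_bigr => l _; rewrite mxE /h.
  have e (F x y u p : C) : F * (p * y) * (u * x) = u * p * (F * (x * y)) by ring.
  exact: e.
rewrite integral_2pi_sum // mx_diag_entry mulr_sumr; apply: eq_bigr => l _.
rewrite mxE (@cauchy_formula R rho (d 0 l) w (fun t => w t / (w t - d 0 l))) //; last first.
- exact: fp.
- exact: cf.
have i0 : (Complex 0 1 : C) != 0 by apply/eqP => /(congr1 (@complex.Im R))/eqP; rewrite /= oner_eq0.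
have p0 : rc (2 * pi) != 0 :> C by rewrite rc_eq0 mulf_neq0 ?gt_eqF ?pi_gt0.
have e (x u F p q : C) : x != 0 -> u != 0 ->
    (x * u)^-1 * (u * (p * q) * (F * x)) = p * q * F.
  by move=> x0 u0; field; rewrite x0 u0.
exact: e.
Qed.

Lemma cont_elem_factor m r : cont (fun t => elem_factor m (rc r * cis t : C)).
Proof.
move=> t; have cw : cont (fun t => rc r * cis t : C).
  by apply: contM; [exact: cont_cst|exact: cont_cis].
pose L := expR (qsum m `|r|) * `|r| ^+ m + 1.
have L0 : 0 < L by rewrite ltr_wpDl // mulr_ge0 ?expR_ge0 ?exprn_ge0.
apply/cvgrPdistC_lt => eps e0; have [e1 _] := ge0C (ltW e0).
have r0 : 0 < complex.Re eps by rewrite -rc_lt -e1.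
have /cvgrPdistC_lt/(_ (rc (complex.Re eps / L))) := cw t.
rewrite -[X in X < _]rc0 rc_lt divr_gt0 // => /(_ isT); apply: filterS => s.
rewrite normE rc_lt ltr_pdivlMr // => hs.
rewrite e1 normE rc_lt; apply: le_lt_trans hs.
have bd u : cabs (rc r * cis u) <= `|r| by rewrite cabsM cabs_cisE mulr1 cabs_rc.
apply: le_trans (elem_factor_lipschitz m (bd s) (bd t)) _.
by rewrite ler_wpM2l ?cabs_ge0 // /L lerDl.
Qed.

Lemma det_hfc_elem_factor m (n : nat) (P : 'M[C]_n) (d : 'rV[C]_n) (z : C) :
  P \in unitmx -> (forall l, d 0 l != 0) ->
  \det (hfc (elem_factor m) (z *: invmx (invmx P *m diag_mx d *m P)))
    = \prod_l elem_factor m (z / d 0 l).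
Proof.
move=> Pu d0; rewrite invmx_conj_diag //.
have -> : z *: (invmx P *m diag_mx (\row_l (d 0 l)^-1) *m P)
    = invmx P *m diag_mx (\row_l (z / d 0 l)) *m P.
  rewrite scalemxAl scalemxAr; congr (_ *m _ *m _).
  by apply/matrixP => i j; rewrite !mxE mulrnAr.
rewrite hfc_diag //; last 2 first.
- exact: cont_elem_factor.
- by move=> r eps e0; exact: elem_factor_poly.
by rewrite det_conj_diag //; apply: eq_bigr => l _; rewrite !mxE.
Qed.

End FunctionalCalculus.


(** * Eigenvalues of the truncations *)

Section TruncationSpectrum.
Variables (R : realType) (a b : nat -> R).
Local Notation C := (Cplx R).
Local Notation jact := (jacobi_act a b).
Local Notation J := (jacobi_op a b).
Local Notation T := (op_inv (friedrichs J)).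

Lemma trunc_diagonalization n : exists (P : 'M[C]_n) (d : 'rV[C]_n),
  [/\ P \in unitmx, jacobi_trunc a b n = invmx P *m diag_mx d *m P,
      forall i j, \sum_m (P i m)^* * P j m = (i == j)%:R &
      forall m m', \sum_l (P l m)^* * P l m' = (m == m')%:R].
Proof.
set A := jacobi_trunc a b n.
have At : map_mx (@Num.conj C) A^T = A.
  by apply/matrixP => i j; rewrite !mxE jacobi_entry_sym; exact: rc_conj.
have An : A \is normalmx by apply/normalmxP; rewrite At.
have Pun := spectral_unitarymx A; have Pu := spectral_unit A.
have /unitarymxP PP := Pun.
exists (spectralmx A), (spectral_diag A); split=> //.
- exact/orthomx_spectralP.
- move=> i j; have /matrixP/(_ j i) := PP; rewrite !mxE eq_sym => <-.
  by apply: eq_bigr => m _; rewrite !mxE mulrC.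
- move=> m m'; have /matrixP/(_ m m') := mulmx1C PP; rewrite !mxE => <-.
  by apply: eq_bigr => l _; rewrite !mxE.
Qed.

(** Eigenvectors of the truncation extended by zero, with [mu l] the eigenvalues of its inverse. The
    eigenvalue equation is stated through pairings because [jact (v j)] may leave the first [N]
    coordinates: its entry at index [N] comes from [a (N - 1)]. *)
Definition spectral_data N (v : nat -> nat -> C) (mu : nat -> R) : Prop :=
  [/\ forall l, (l < N)%N -> fin_supp N (v l),
      forall i j, (i < N)%N -> (j < N)%N -> inner (v i) (v j) = (i == j)%:R,
      forall l, (l < N)%N -> 0 < mu l,
      forall i j, (i < N)%N -> (j < N)%N ->
        inner (v i) (jact (v j)) = (i == j)%:R * rc (mu j)^-1 &
      forall y, fin_supp N y ->
        y =1 (fun n => \sum_(0 <= l < N) inner (v l) y * v l n)].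

Definition trunc_det N (mu : nat -> R) : Prop := forall m (z : C),
  \det (hfc (elem_factor m) (z *: invmx (jacobi_trunc a b N)))
    = \prod_(0 <= l < N) elem_factor m (z * rc (mu l)).

Hypothesis J_pos : positive_op J.
Hypothesis T_bounded : bounded_op T.

Lemma exists_spectral_data N : exists v mu, [/\ spectral_data N v mu,
  forall i j, (i <= j)%N -> (j < N)%N -> mu j <= mu i & trunc_det N mu].
Proof.
(* The empty truncation is split off because [inord] needs a nonempty ordinal type. *)
case: N => [|N].
  exists (fun _ _ => 0), (fun=> 0); split=> //.
    by split=> // y fy n; rewrite big_nil fy.
  by move=> m z; rewrite det_mx00 big_nil.
have [P [d [Pu AE row_orth col_orth]]] := trunc_diagonalization N.+1.
pose v (l n : nat) : C := if (n < N.+1)%N then P (inord l) (inord n) else 0.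
have vfin l : fin_supp N.+1 (v l).
  by move=> n; rewrite leqNgt /v => /negbTE ->.
have vE l (n : 'I_N.+1) : v l n = P (inord l) n by rewrite /v ltn_ord inord_val.
have inE (i j : nat) : (i < N.+1)%N -> (j < N.+1)%N ->
    (inord i == inord j :> 'I_N.+1) = (i == j).
  by move=> iN jN; rewrite -val_eqE /= !inordK.
have vorth i j : (i < N.+1)%N -> (j < N.+1)%N -> inner (v i) (v j) = (i == j)%:R.
  move=> iN jN; rewrite (inner_finr _ (vfin j)) big_mkord -inE // -row_orth.
  by apply: eq_bigr => m _; rewrite !vE.
have vJ l n : (n < N.+1)%N -> jact (v l) n = d 0 (inord l) * v l n.
  move=> nN; rewrite (jacobi_actE _ _ _ (vfin l)) big_mkord.
  have := congr1 (fun M => (P *m M) (inord l) (inord n)) AE.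
  rewrite !mulmxA mulmxV // mul1mx mul_diag_mx !mxE /v nN => <-.
  apply: eq_bigr => m _; rewrite ltn_ord inord_val mxE mulrC inordK //.
  by congr (_ * _); rewrite jacobi_entry_sym.
have vJv i j : (i < N.+1)%N -> (j < N.+1)%N ->
    inner (v i) (jact (v j)) = (i == j)%:R * d 0 (inord j).
  move=> iN jN; rewrite (inner_finl _ (vfin i)) -vorth // (inner_finr _ (vfin j)).
  rewrite mulr_suml [LHS]big_nat [RHS]big_nat; apply: eq_bigr => n /andP[_ nN].
  by rewrite vJ // mulrCA mulrC.
have lv l : l2 (v l) := l2_fin (vfin l).
pose la l := complex.Re (d 0 (inord l : 'I_N.+1)).
have laE l : (l < N.+1)%N -> d 0 (inord l) = rc (la l) /\ 0 <= la l.
  move=> lN; have := J_pos (jacobi_fin a b (vfin l)).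
  by rewrite /= vJv // eqxx mul1r => /ge0C.
(* If the eigenvalue were zero, [T_form_ge] at [t v] would give [2 t <= <v, T v>] for every real
   [t]; [t = <v, T v> + 1] contradicts this. *)
have la0 l : (l < N.+1)%N -> 0 < la l.
  move=> lN; have [dl l0] := laE l lN; rewrite lt_neqAle l0 andbT eq_sym.
  apply/negP => /eqP z; have [u Tu] := T_total T_bounded (lv l).
  pose t := complex.Re (inner (v l) u) + 1.
  have ft : fin_supp N.+1 (fun n => rc t * v l n).
    by move=> n Nn; rewrite vfin // mulr0.
  have := T_form_ge J_pos T_bounded Tu ft.
  have -> : jact (fun n => rc t * v l n) = fun n => rc t * jact (v l) n.
    have := jact_lin a b (rc t) (v l) (fun=> 0).
    have j0 n : jact (fun=> 0) n = 0.
      by rewrite /jacobi_act big1 // => i _; rewrite mulr0.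
    rewrite (_ : (fun n => _ + 0) = (fun n => rc t * v l n)); last first.
      by apply/funext => n; rewrite addr0.
    by move=> ->; apply/funext => n; rewrite j0 addr0.
  have lj : l2 (jact (v l)) := l2_fin (fin_supp_jact a b (vfin l)).
  rewrite !inner_scalel //; last exact: l2_scale.
  rewrite inner_scaler // vJv // vorth // eqxx mul1r dl z mulr0 mulr0 mulr1 subr0.
  rewrite rc_conj /=.
  have [r r0 re] := T_nonneg J_pos T_bounded Tu.
  by rewrite /t re /=; lra.
have vcomp y : fin_supp N.+1 y ->
    y =1 (fun n => \sum_(0 <= l < N.+1) inner (v l) y * v l n).
  move=> fy n; have [nN|Nn] := ltnP n N.+1; last first.
    by rewrite fy // big1 // => l _; rewrite vfin ?mulr0.
  rewrite (eq_bigr (fun l => \sum_(0 <= m < N.+1) (v l m)^* * v l n * y m)); last first.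
    move=> l _; rewrite (inner_finl _ (vfin l)) mulr_suml.
    by apply: eq_bigr => m _; rewrite mulrAC.
  rewrite exchange_big /= big_mkord (bigD1 (Ordinal nN)) //=.
  rewrite [X in X + _](_ : _ = y n); last first.
    rewrite -mulr_suml big_mkord -[RHS]mul1r; congr (_ * _).
    transitivity ((Ordinal nN == Ordinal nN)%:R : C); last by rewrite eqxx.
    rewrite -col_orth.
    by apply: eq_bigr => l _; rewrite (vE l (Ordinal nN)) inord_val.
  rewrite big1 ?addr0 // => m mn; rewrite -mulr_suml big_mkord.
  rewrite (eq_bigr (fun l : 'I_N.+1 => (P l m)^* * P l (Ordinal nN))).
    by rewrite col_orth (negbTE mn) mul0r.
  by move=> l _; rewrite (vE l m) (vE l (Ordinal nN)) inord_val.
(* Increasing eigenvalues of the truncation are decreasing eigenvalues of its inverse. *)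
pose srt := sort (fun i j => la i <= la j) (iota 0 N.+1).
pose sg := nth 0%N srt.
have szs : size srt = N.+1 by rewrite size_sort size_iota.
have psrt : perm_eq (index_iota 0 N.+1) srt.
  by rewrite /index_iota subn0 perm_sym perm_sort.
have sgN l : (l < N.+1)%N -> (sg l < N.+1)%N.
  move=> lN; have : sg l \in srt by rewrite mem_nth // szs.
  by rewrite mem_sort mem_iota.
have sgE i j : (i < N.+1)%N -> (j < N.+1)%N -> (sg i == sg j) = (i == j).
  by move=> iN jN; rewrite /sg nth_uniq ?szs // sort_uniq iota_uniq.
have sgm i j : (i <= j)%N -> (j < N.+1)%N -> la (sg i) <= la (sg j).
  move=> ij jN.
  have tr : transitive (fun i j => la i <= la j) by move=> y x z; exact: le_trans.
  have st : sorted (fun i j => la i <= la j) srt.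
    by apply: sort_sorted => x y; exact: le_total.
  apply: (sorted_leq_nth tr _ 0%N st) => //; rewrite ?inE ?szs //.
  exact: leq_ltn_trans ij jN.
exists (fun l => v (sg l)), (fun l => (la (sg l))^-1); split.
- split.
  + by move=> l _; exact: vfin.
  + by move=> i j iN jN; rewrite vorth ?sgN // sgE.
  + by move=> l lN; rewrite invr_gt0 la0 // sgN.
  + move=> i j iN jN; rewrite vJv ?sgN // sgE //.
    by have [-> _] := laE _ (sgN _ jN); rewrite invrK.
  + move=> y fy n; rewrite {1}(vcomp y fy n) (perm_big _ psrt) /=.
    by rewrite (big_nth 0%N) szs.
- move=> i j ij jN; have iN := leq_ltn_trans ij jN.
  by rewrite lef_pV2 ?posrE ?la0 ?sgN // sgm.
- move=> m z.
  have d0 l : d 0 l != 0.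
    have [+ _] := laE l (ltn_ord l); rewrite inord_val => ->.
    by rewrite rc_eq0 gt_eqF // la0.
  rewrite {1}AE (det_hfc_elem_factor m z Pu d0).
  transitivity (\prod_(l <- srt) elem_factor m (z * rc (la l)^-1)).
    rewrite -(perm_big _ psrt) /= big_mkord; apply: eq_bigr => l _.
    by have [+ _] := laE l (ltn_ord l); rewrite inord_val => ->; rewrite rcV.
  by rewrite (big_nth 0%N) szs.
Qed.

Lemma jact_sum n (c : nat -> C) (v : nat -> nat -> C) :
  jact (fun i => \sum_(0 <= l < n) c l * v l i)
    = fun i => \sum_(0 <= l < n) c l * jact (v l) i.
Proof.
elim: n => [|n IH].
  apply/funext => i; rewrite big_nil /jacobi_act big1 // => j _.
  by rewrite big_nil mulr0.
rewrite (_ : (fun i => _) = (fun i => c n * v n i + \sum_(0 <= l < n) c l * v l i)).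
  rewrite jact_lin IH; apply/funext => i.
  by rewrite big_nat_recr //= addrC.
by apply/funext => i; rewrite big_nat_recr //= addrC.
Qed.

Variables (N : nat) (v : nat -> nat -> C) (mu : nat -> R).
Hypothesis vmu : spectral_data N v mu.

Lemma spectral_l2 l : (l < N)%N -> l2 (v l).
Proof. by move=> lN; case: vmu => h _ _ _ _; exact: l2_fin (h l lN). Qed.

Lemma spectral_form n (c : nat -> C) : (n <= N)%N ->
  let y := fun i => \sum_(0 <= l < n) c l * v l i in
  fin_supp N y /\
  inner y (jact y) = rc (\sum_(0 <= l < n) (mu l)^-1 * cabs (c l) ^+ 2).
Proof.
move=> nN y; have [vfin vorth mu0 vJ _] := vmu.
have lN l : (l < n)%N -> (l < N)%N by move/leq_trans; apply.
have fy : fin_supp N y.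
  move=> i Ni; rewrite /y big_nat big1 // => l /andP[_ ln].
  by rewrite vfin ?mulr0 // lN.
split=> //; rewrite inner_suml; last 2 first.
- exact: l2_fin (fin_supp_jact a b fy).
- by move=> l ln; exact: spectral_l2 (lN l ln).
rewrite rc_sum [LHS]big_nat [RHS]big_nat; apply: eq_bigr => l /andP[_ ln].
rewrite /y jact_sum inner_sumr; last 2 first.
- exact: spectral_l2 (lN l ln).
- by move=> l' ln'; exact: l2_fin (fin_supp_jact a b (vfin l' (lN l' ln'))).
rewrite big_mkord (bigD1 (Ordinal ln)) //= big1 ?addr0; last first.
  by move=> l' ll'; rewrite vJ ?lN // (negbTE (_ : l != l')) 1?eq_sym // mul0r mulr0.
have := vJ l l (lN l ln) (lN l ln); rewrite eqxx mul1r => e.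
by rewrite mulrA conj_mul [LHS]mulrC [RHS]rcM; congr (_ * _); exact: e.
Qed.

End TruncationSpectrum.


(** * Comparison of the eigenvalues of [J_n^-1] with those of [T] *)

Section EigenvalueComparison.
Variables (R : realType) (a b : nat -> R).
Local Notation C := (Cplx R).
Local Notation jact := (jacobi_act a b).
Local Notation J := (jacobi_op a b).
Local Notation T := (op_inv (friedrichs J)).

(** Supplies the dimension count of Courant-Fischer: [n] linear conditions on [n + 1]
    coefficients. *)
Lemma wide_kernel (n : nat) (F : nat -> nat -> C) :
  exists2 t : nat -> C, (exists2 l, (l < n.+1)%N & t l != 0) &
    forall j, (j < n)%N -> \sum_(0 <= l < n.+1) t l * F l j = 0.
Proof.
pose B : 'M[C]_(n.+1, n) := \matrix_(l, j) F l j.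
have kB : kermx B != 0.
  rewrite -mxrank_eq0 mxrank_ker subn_eq0 -ltnNge ltnS.
  exact: rank_leq_col.
pose t := nz_row (kermx B).
have tB : t *m B = 0 by apply/sub_kermxP; exact: nz_row_sub.
have t0 : t != 0 by rewrite nz_row_eq0.
exists (fun l => t 0 (inord l)).
  have /rV0Pn[l tl] := t0; exists l => //; by rewrite inord_val.
move=> j jn; have /rowP/(_ (Ordinal jn)) := tB; rewrite !mxE => h.
apply: etrans h; rewrite big_mkord; apply: eq_bigr => l _.
by rewrite mxE inord_val.
Qed.

(* Ky Fan: the weights are doubly substochastic. *)
Lemma weighted_sum_le N M (mu W : nat -> R) : (M < N)%N ->
  (forall i j, (i <= j)%N -> (j < N)%N -> mu j <= mu i) ->
  (forall l, (l < N)%N -> 0 <= mu l) ->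
  (forall l, (l < N)%N -> 0 <= W l <= 1) ->
  \sum_(0 <= l < N) W l <= M.+1%:R ->
  \sum_(0 <= l < N) mu l * W l <= \sum_(0 <= l < M.+1) mu l.
Proof.
move=> MN mono mu0 W01 sW; pose th := mu M.
have -> : \sum_(0 <= l < N) mu l * W l
    = \sum_(0 <= l < N) (mu l - th) * W l + th * \sum_(0 <= l < N) W l.
  by rewrite mulr_sumr -big_split; apply: eq_bigr => l _ /=; ring.
have -> : \sum_(0 <= l < M.+1) mu l
    = \sum_(0 <= l < M.+1) (mu l - th) + th * M.+1%:R.
  have -> : th * M.+1%:R = \sum_(0 <= l < M.+1) th.
    by rewrite sumr_const_nat subn0 mulr_natr.
  rewrite -big_split /=.
  by apply: eq_bigr => l _; rewrite subrK.
apply: lerD; last by rewrite ler_wpM2l // mu0.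
rewrite (@big_cat_nat _ _ _ M.+1) //= -[leRHS]addr0; apply: lerD.
  rewrite big_nat [leRHS]big_nat; apply: ler_sum => l /andP[_ lM].
  have lN : (l < N)%N by exact: leq_trans lM MN.
  have /andP[w0 w1] := W01 l lN.
  by rewrite ler_piMr // subr_ge0 mono.
rewrite big_nat; apply: sumr_le0 => l /andP[Ml lN].
have /andP[w0 w1] := W01 l lN.
by rewrite mulr_le0_ge0 // subr_le0 mono // ltnW.
Qed.

Hypothesis J_pos : positive_op J.
Hypothesis T_bounded : bounded_op T.

Variables (e : nat -> nat -> C) (s : nat -> R).
Hypothesis eb : hilbert_basis e.
Hypothesis se : forall j, 0 < s j /\ T (e j, fun n => rc (s j) * e j n).
Hypothesis s_dec : forall m n, (m < n)%N -> s n < s m.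

Let le j : l2 (e j). Proof. by case: eb. Qed.
Let oe i j : inner (e i) (e j) = (i == j)%:R. Proof. by case: eb. Qed.

Lemma T_form_le x u i : T (x, u) -> (forall j, (j < i)%N -> coef e x j = 0) ->
  complex.Re (inner x u) <= s i * nrm2 x.
Proof.
move=> h x0; have [lx lu] := T_l2 T_bounded h.
have [lcx _] := coef_le eb lx; have [lcu _] := coef_le eb lu.
rewrite -(parseval eb lx lu) -(nrm2_coef eb lx).
apply: (cvgR_le (N := 0%N) (cvg_Re (inner_cvg lcx lcu))) => N _.
apply: (@le_trans _ _ (s i * \sum_(0 <= j < N) cabs (coef e x j) ^+ 2)); last first.
  by rewrite ler_wpM2l ?nrm2_ge_psum // ltW //; have [] := se i.
rewrite /series /= cRe_sum mulr_sumr; apply: ler_sum => j _.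
rewrite (coef_T J_pos T_bounded eb se j h) mulrCA conj_mul -rcM /=.
have [ji|ij] := ltnP j i; first by rewrite x0 // cabs0 expr0n !mulr0.
rewrite ler_wpM2r ?sqr_ge0 //; move: ij; rewrite leq_eqVlt => /predU1P[->//|/s_dec].
exact: ltW.
Qed.

Section Fixed.
Variables (N : nat) (v : nat -> nat -> C) (mu : nat -> R).
Hypothesis vmu : spectral_data a b N v mu.
Hypothesis mono : forall i j, (i <= j)%N -> (j < N)%N -> mu j <= mu i.

Let lv l : (l < N)%N -> l2 (v l). Proof. by move=> lN; exact: (spectral_l2 vmu lN). Qed.

(* Courant-Fischer with the trial space spanned by [v 0, ..., v i]. *)
Lemma trunc_eigen_le i : (i < N)%N -> mu i <= s i.
Proof.
move=> iN; have [vfin vorth mu0 vJ _] := vmu.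
have lN l : (l < i.+1)%N -> (l < N)%N by move=> h; exact: leq_trans h iN.
have [t [l0 l0i tl0] tF] := wide_kernel i (fun l j => inner (e j) (v l)).
pose x n := \sum_(0 <= l < i.+1) t l * v l n.
pose S := \sum_(0 <= l < i.+1) cabs (t l) ^+ 2.
have nx : nrm2 x = S.
  by apply: ortho_nrm2_sum => [l li|l l' li li']; [exact: lv (lN l li)|rewrite vorth ?lN].
have lx : l2 x by apply: l2_sum => l li; exact: lv (lN l li).
have S0 : 0 < S.
  rewrite /S big_mkord (bigD1 (Ordinal l0i)) //= ltr_wpDr //.
    by apply: sumr_ge0 => l _; exact: sqr_ge0.
  by rewrite exprn_gt0 // lt_neqAle cabs_ge0 eq_sym cabs_eq0 tl0.
have cx j : (j < i)%N -> coef e x j = 0.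
  move=> ji; rewrite /coef /x inner_sumr ?tF // => l li; exact: lv (lN l li).
have [u Tu] := T_total T_bounded lx.
(* The trial vector is [y = J_n^-1 x], which is optimal: both [<y, x>] and [<y, J y>] equal
   [<x, J_n^-1 x>]. *)
have [fy yJy] := @spectral_form _ a b N v mu vmu i.+1 (fun l => t l * rc (mu l)) iN.
have := T_form_ge J_pos T_bounded Tu fy; rewrite yJy.
set y := fun n => \sum_(0 <= l < i.+1) t l * rc (mu l) * v l n.
have yx : inner y x = rc (\sum_(0 <= l < i.+1) mu l * cabs (t l) ^+ 2).
  rewrite inner_suml //; last by move=> l li; exact: lv (lN l li).
  rewrite rc_sum [LHS]big_nat [RHS]big_nat; apply: eq_bigr => l /andP[_ li].
  rewrite ortho_inner_sum //; last 2 first.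
  - by move=> l' li'; exact: lv (lN l' li').
  - by move=> l' l'' li' li''; rewrite vorth ?lN.
  by rewrite rmorphM /= rc_conj mulrAC conj_mul rcM mulrC.
rewrite yx /=.
have -> : \sum_(0 <= l < i.+1) (mu l)^-1 * cabs (t l * rc (mu l)) ^+ 2
    = \sum_(0 <= l < i.+1) mu l * cabs (t l) ^+ 2.
  rewrite [LHS]big_nat [RHS]big_nat; apply: eq_bigr => l /andP[_ li].
  have m0 := mu0 l (lN l li).
  by rewrite cabsM cabs_rc (gtr0_norm m0); field; rewrite gt_eqF.
set Q := \sum_(0 <= l < i.+1) mu l * _ => hQ.
have Qle := T_form_le Tu cx; rewrite nx in Qle.
have muQ : mu i * S <= Q.
  rewrite /Q /S mulr_sumr big_nat [leRHS]big_nat; apply: ler_sum => l /andP[_ li].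
  by rewrite ler_wpM2r ?sqr_ge0 // mono.
rewrite -(ler_pM2r S0); apply: le_trans muQ _; apply: le_trans Qle.
by apply: le_trans hQ; lra.
Qed.

(** The right side is [<x, J_n^-1 x>]. In the eigenbasis the inequality holds term by term, by
    completing the square. *)
Lemma trial_form_le x y : l2 x -> fin_supp N y ->
  2 * complex.Re (inner y x) - complex.Re (inner y (jact y))
    <= \sum_(0 <= l < N) mu l * cabs (inner (v l) x) ^+ 2.
Proof.
move=> lx fy; have [vfin vorth mu0 vJ comp] := vmu.
pose c l := inner (v l) y.
have [fz zJz] := @spectral_form _ a b N v mu vmu N c (leqnn N).
have yE : y = fun n => \sum_(0 <= l < N) c l * v l n by apply/funext; exact: comp.
have yx : inner y x = \sum_(0 <= l < N) (c l)^* * inner (v l) x.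
  by rewrite {1}yE (inner_suml c lx lv).
have yJy : inner y (jact y) = rc (\sum_(0 <= l < N) (mu l)^-1 * cabs (c l) ^+ 2).
  by rewrite -zJz -yE.
rewrite yJy yx cRe_sum /=.
rewrite mulr_sumr -sumrB [leLHS]big_nat [leRHS]big_nat.
apply: ler_sum => l /andP[_ lN].
have m0 := mu0 l lN.
have h : complex.Re ((c l)^* * inner (v l) x) <= cabs (c l) * cabs (inner (v l) x).
  by rewrite -(cabs_conj (c l)) -cabsM; apply: le_trans (ler_norm _) (Re_le_cabs _).
apply: (@le_trans _ _ (2 * (cabs (c l) * cabs (inner (v l) x)) - (mu l)^-1 * cabs (c l) ^+ 2)).
  by rewrite lerD2r ler_wpM2l.
move: (cabs (c l)) (cabs (inner (v l) x)) => p q.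
rewrite -subr_ge0.
have -> : mu l * q ^+ 2 - (2 * (p * q) - (mu l)^-1 * p ^+ 2)
    = (mu l)^-1 * (mu l * q - p) ^+ 2 by field; rewrite gt_eqF.
by rewrite mulr_ge0 ?sqr_ge0 // invr_ge0 ltW.
Qed.

Lemma eigen_gap_le M (eps : R) : (M < N)%N ->
  (forall j, (j < M.+1)%N -> exists2 y, fin_supp N y &
     s j - eps <= 2 * complex.Re (inner y (e j)) - complex.Re (inner y (jact y))) ->
  \sum_(0 <= l < M.+1) (s l - mu l) <= M.+1%:R * eps.
Proof.
move=> MN hy; have [vfin vorth mu0 vJ comp] := vmu.
(* Bessel for the family [e] gives [W l <= 1]; Bessel for the family [v] bounds the total weight by
   [M + 1]. *)
pose W l := \sum_(0 <= j < M.+1) cabs (inner (v l) (e j)) ^+ 2.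
have h1 : \sum_(0 <= j < M.+1) (s j - eps) <= \sum_(0 <= l < N) mu l * W l.
  apply: (@le_trans _ _ (\sum_(0 <= j < M.+1) \sum_(0 <= l < N)
      mu l * cabs (inner (v l) (e j)) ^+ 2)).
    rewrite big_nat [leRHS]big_nat; apply: ler_sum => j /andP[_ jM].
    have [y fy hyj] := hy j jM; apply: le_trans hyj _.
    exact: trial_form_le (le j) fy.
  by rewrite exchange_big /=; apply: ler_sum => l _; rewrite mulr_sumr.
have h2 : \sum_(0 <= l < N) mu l * W l <= \sum_(0 <= l < M.+1) mu l.
  apply: weighted_sum_le => //.
  - by move=> l lN; exact/ltW/mu0.
  - move=> l lN; rewrite sumr_ge0 /=; last by move=> j _; exact: sqr_ge0.
    have <- : nrm2 (v l) = 1 by apply: rcI; rewrite -inner_self ?vorth ?eqxx //; exact: lv.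
    have := @bessel _ e M.+1 _ (fun j _ => le j) (fun i j _ _ => oe i j) (lv lN).
    apply: le_trans; apply: ler_sum => j _.
    by rewrite (inner_conj (le j) (lv lN)) cabs_conj.
  - rewrite exchange_big /=.
    apply: (@le_trans _ _ (\sum_(0 <= j < M.+1) (1 : R))).
      apply: ler_sum => j _.
      have <- : nrm2 (e j) = 1 by apply: rcI; rewrite -inner_self // oe eqxx.
      exact: (bessel lv vorth (le j)).
    by rewrite sumr_const_nat subn0.
rewrite sumrB lerBlDr.
have -> : \sum_(0 <= l < M.+1) s l = \sum_(0 <= j < M.+1) (s j - eps) + M.+1%:R * eps.
  rewrite mulr_natl -[X in _ *+ X]subn0 -sumr_const_nat -big_split /=.
  by apply: eq_bigr => l _; rewrite subrK.
by rewrite addrC lerD2l; apply: le_trans h1 h2.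
Qed.

End Fixed.

(** Here [s j = <e j, T e j>], and finitely many trial vectors share a common support length. *)
Lemma trial_vectors M (eps : R) : 0 < eps -> exists N0, forall N, (N0 <= N)%N ->
  forall j, (j < M)%N -> exists2 y, fin_supp N y &
    s j - eps <= 2 * complex.Re (inner y (e j)) - complex.Re (inner y (jact y)).
Proof.
move=> e0; elim: M => [|M [N0 hN0]]; first by exists 0%N.
have [sM TM] := se M.
have [N1 [y [fy hy]]] := T_form_approx J_pos T_bounded TM e0.
exists (maxn N0 N1) => N; rewrite geq_max => /andP[N0N N1N] j.
rewrite ltnS leq_eqVlt => /predU1P[->|jM]; last exact: hN0.
exists y; first by move=> n Nn; apply: fy; exact: leq_trans Nn.
apply: le_trans hy; rewrite inner_scaler // oe eqxx mulr1 //.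
Qed.

End EigenvalueComparison.


(** * Convergence of the products *)

Section InfiniteProducts.
Variable R : realType.
Local Notation C := (Cplx R).
Implicit Types (u v : nat -> C) (B : nat -> R).

Lemma cabs_sub_near1 (x y : C) : cabs (x - y) <= cabs (x - 1) + cabs (y - 1).
Proof. by have := cabsB (x - 1) (y - 1); rewrite opprB addrA subrK. Qed.

Lemma prod1D_le_expR B n : (forall l, 0 <= B l) ->
  \prod_(0 <= l < n) (1 + B l) <= expR (\sum_(0 <= l < n) B l).
Proof.
move=> B0; rewrite expR_sum; apply: ler_prod => l _.
by rewrite addr_ge0 // expR_ge1Dx.
Qed.

Lemma cabs_prod_le u B n : (forall l, (l < n)%N -> cabs (u l) <= 1 + B l) ->
  cabs (\prod_(0 <= l < n) u l) <= \prod_(0 <= l < n) (1 + B l).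
Proof.
elim: n => [|n IH] h; first by rewrite !big_nil cabs1.
rewrite !big_nat_recr //= cabsM; apply: ler_pM; rewrite ?cabs_ge0 ?h //.
by apply: IH => l ln; apply: h; exact: ltnW.
Qed.

(** Factors are exchanged one at a time; the bound keeps the full product because each [1 + B l] is
    at least [1]. *)
Lemma prod_sub_le u v B n : (forall l, 0 <= B l) ->
  (forall l, (l < n)%N -> cabs (u l) <= 1 + B l) ->
  (forall l, (l < n)%N -> cabs (v l) <= 1 + B l) ->
  cabs (\prod_(0 <= l < n) u l - \prod_(0 <= l < n) v l)
    <= \prod_(0 <= l < n) (1 + B l) * \sum_(0 <= l < n) cabs (u l - v l).
Proof.
move=> B0; elim: n => [|n IH] hu hv.
  by rewrite !big_nil subrr cabs0 mul1r.
have hu' l : (l < n)%N -> cabs (u l) <= 1 + B l by move=> h; apply: hu; exact: ltnW.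
have hv' l : (l < n)%N -> cabs (v l) <= 1 + B l by move=> h; apply: hv; exact: ltnW.
have IHn := IH hu' hv'; have pv := cabs_prod_le hv'.
have un := hu n (ltnSn n).
rewrite !big_nat_recr //=.
set U := \prod_(0 <= l < n) u l in IHn *; set V := \prod_(0 <= l < n) v l in IHn pv *.
set P := \prod_(0 <= l < n) (1 + B l) in IHn pv *.
set S := \sum_(0 <= l < n) _ in IHn *.
have -> : U * u n - V * v n = (U - V) * u n + V * (u n - v n) by ring.
apply: le_trans (cabsD _ _) _; rewrite !cabsM.
have S0 : 0 <= S by apply: sumr_ge0 => l _; exact: cabs_ge0.
have P0 : 0 <= P by apply: prodr_ge0 => l _; rewrite addr_ge0.
have Bn := B0 n; have D0 := cabs_ge0 (u n - v n).
apply: (@le_trans _ _ (P * S * (1 + B n) + P * cabs (u n - v n))).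
  by apply: lerD; [apply: ler_pM; rewrite ?cabs_ge0|rewrite ler_wpM2r].
have -> : P * (1 + B n) * (S + cabs (u n - v n))
    = P * S * (1 + B n) + P * cabs (u n - v n) * (1 + B n) by ring.
by rewrite lerD2l ler_peMr ?mulr_ge0 // lerDl.
Qed.

Lemma uniform_cvg_dist (U : set C) (f : nat -> C -> C) (F : C -> C) :
  (forall eps : R, 0 < eps -> exists N, forall n, (N <= n)%N ->
     forall z, U z -> cabs (f n z - F z) < eps) ->
  {uniform U, f @ \oo --> F}.
Proof.
move=> h P /uniform_nbhs[E [entE EP]].
move: entE; rewrite -entourage_ballE => -[e /= e0 eE].
have [e1 _] := ge0C (ltW e0).
have r0 : 0 < complex.Re e by rewrite -rc_lt -e1.
have [N hN] := h _ r0; exists N => // n Nn.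
apply: EP => z Uz; apply: eE; rewrite /= -ball_normE /= e1 normE rc_lt.
by rewrite cabs_distrC; exact: hN.
Qed.

Lemma locally_uniform_cvg_ext (f f' : nat -> C -> C) (F F' : C -> C) :
  (forall n z, f n z = f' n z) -> F =1 F' ->
  locally_uniform_cvg f F -> locally_uniform_cvg f' F'.
Proof.
move=> ff' /funext <-; suff -> : f' = f by [].
by apply/funext => n; apply/funext => z; rewrite ff'.
Qed.

End InfiniteProducts.

Section Tannery.
Variables (R : realType) (m : nat) (s : nat -> R).
Local Notation C := (Cplx R).
Local Notation E := (elem_factor m).
Hypothesis s_gt0 : forall j, 0 < s j.
Hypothesis s_le0 : forall j, s j <= s 0%N.
Hypothesis s_sum : exists M, forall N, \sum_(0 <= j < N) s j ^+ m.+1 <= M.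

Variable mu : nat -> nat -> R.
Hypothesis mu_gt0 : forall N l, (l < N)%N -> 0 < mu N l.
Hypothesis mu_le : forall N l, (l < N)%N -> mu N l <= s l.
Hypothesis mu_cvg : forall M (eps : R), 0 < eps -> exists N0, forall N, (N0 <= N)%N ->
  \sum_(0 <= l < M.+1) (s l - mu N l) <= eps.

Let limit (z : C) : C := limn (fun N => \prod_(0 <= j < N) E (z * rc (s j))).

Section Disc.
Variable rho : R.
Hypothesis rho_ge0 : 0 <= rho.

(** All arguments [z s_l] and [z mu_l] with [|z| <= rho] lie in the disc of radius [r]. There [K] is
    the exponential constant and [B l] dominates [|E - 1|]. *)
Let r := rho * s 0%N.
Let K := expR (qsum m r).
Let B l := K * (rho ^+ m.+1 * s l ^+ m.+1).

Let B0 l : 0 <= B l.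
Proof. by rewrite !mulr_ge0 ?expR_ge0 ?exprn_ge0 // ltW. Qed.

Let B_sum : exists S, forall N, \sum_(0 <= l < N) B l <= S.
Proof.
have [M hM] := s_sum; exists (K * (rho ^+ m.+1 * M)) => N.
rewrite -mulr_sumr -mulr_sumr !ler_wpM2l ?expR_ge0 ?exprn_ge0 //.
Qed.

Let factor_near1 (z : C) (x : R) l : cabs z <= rho -> 0 < x -> x <= s l ->
  cabs (E (z * rc x) - 1) <= B l.
Proof.
move=> zr x0 xs.
have hw : cabs (z * rc x) <= rho * x by rewrite cabsM cabs_rc gtr0_norm // ler_wpM2r // ltW.
have hr : cabs (z * rc x) <= r.
  by apply: le_trans hw _; rewrite ler_wpM2l // (le_trans xs).
apply: le_trans (elem_factor_sub1 m hr) _.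
rewrite ler_wpM2l ?expR_ge0 // -exprMn lerXn2r ?nnegrE ?cabs_ge0 ?mulr_ge0 ?(ltW (s_gt0 l)) //.
by apply: le_trans hw _; rewrite ler_wpM2l.
Qed.

Let factor_le (z : C) (x : R) l : cabs z <= rho -> 0 < x -> x <= s l ->
  cabs (E (z * rc x)) <= 1 + B l.
Proof.
move=> zr x0 xs; have := factor_near1 zr x0 xs.
have := cabsD (E (z * rc x) - 1) 1; rewrite subrK cabs1; lra.
Qed.

Let factor_sub (z : C) (x : R) l : cabs z <= rho -> 0 < x -> x <= s l ->
  cabs (E (z * rc x) - E (z * rc (s l))) <= K * r ^+ m * rho * (s l - x).
Proof.
move=> zr x0 xs.
have hb y : 0 < y -> y <= s l -> cabs (z * rc y) <= r.
  move=> y0 yl; rewrite cabsM cabs_rc gtr0_norm //.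
  by apply: ler_pM; rewrite ?cabs_ge0 ?(ltW y0) // (le_trans yl).
apply: le_trans (elem_factor_lipschitz m (hb _ x0 xs) (hb _ (s_gt0 l) (lexx _))) _.
rewrite -mulrBr -rcB cabsM cabs_rc distrC ger0_norm ?subr_ge0 //.
rewrite -/K mulrC -mulrA ler_wpM2l ?mulr_ge0 ?expR_ge0 ?exprn_ge0 ?mulr_ge0 ?(ltW (s_gt0 0%N)) //.
by rewrite ler_wpM2r ?subr_ge0.
Qed.

Let sle l : s l <= s l. Proof. by []. Qed.

Let p (z : C) N := \prod_(0 <= j < N) E (z * rc (s j)).

Let p_step (z : C) S N : cabs z <= rho ->
  (forall N, \sum_(0 <= l < N) B l <= S) ->
  cabs (p z N.+1 - p z N) <= expR S * B N.
Proof.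
move=> zr hS; rewrite /p big_nat_recr //= -[X in _ - X]mulr1 -mulrBr cabsM.
apply: ler_pM; rewrite ?cabs_ge0 //; last exact: factor_near1.
apply: le_trans (cabs_prod_le (B := B) _) _.
  by move=> l _; exact: factor_le.
apply: le_trans (prod1D_le_expR _ B0) _; by rewrite ler_expR.
Qed.

(** The increments of the partial products are dominated by [expR S * B N], hence summable. *)
Let p_cvg (z : C) : cabs z <= rho -> p z @ \oo --> limit z.
Proof.
move=> zr; have [S hS] := B_sum.
have c : cvgn (series (fun N => p z N.+1 - p z N)).
  apply: (@cvgC_series_abs _ _ (expR S * S)) => N.
  apply: (@le_trans _ _ (expR S * \sum_(0 <= l < N) B l)).
    by rewrite mulr_sumr; apply: ler_sum => l _; exact: p_step.
  by rewrite ler_wpM2l ?expR_ge0.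
have pE N : p z N = series (fun N => p z N.+1 - p z N) N + 1.
  by rewrite /series /= telescope_sumr // /p [X in _ - X]big_nil subrK.
have c2 : p z @ \oo --> limn (series (fun N => p z N.+1 - p z N)) + 1.
  have c1 : (fun N => series (fun N => p z N.+1 - p z N) N + 1) @ \oo
      --> limn (series (fun N => p z N.+1 - p z N)) + 1.
    exact: cvgD c (cvg_cst _).
  by apply: cvgC_ext c1 => N; rewrite -pE.
by rewrite /limit -/(p z) (cvgC_lim c2).
Qed.

Let p_tail (z : C) S M N : cabs z <= rho ->
  (forall N, \sum_(0 <= l < N) B l <= S) -> (M <= N)%N ->
  cabs (p z N - p z M) <= expR S * \sum_(M <= l < N) B l.
Proof.
move=> zr hS; elim: N => [|N IH].
  by rewrite leqn0 => /eqP ->; rewrite subrr cabs0 big_geq // mulr0.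
rewrite leq_eqVlt => /predU1P[->|]; first by rewrite subrr cabs0 big_geq // mulr0.
rewrite ltnS => MN; rewrite big_nat_recr //= mulrDr.
have -> : p z N.+1 - p z M = (p z N - p z M) + (p z N.+1 - p z N) by ring.
by apply: le_trans (cabsD _ _) _; apply: lerD; [exact: IH|exact: p_step].
Qed.

Lemma tannery_disc (eps : R) : 0 < eps -> exists N0, forall N, (N0 <= N)%N ->
  forall z : C, cabs z <= rho ->
  cabs (\prod_(0 <= l < N) E (z * rc (mu N l)) - limit z) < eps.
Proof.
move=> eps0; have [S hS] := B_sum.
(* The budget is [3 eta] for exchanging the factors and [eta] for the infinite tail, so that
   [4 expR S eta = eps / 2]. *)
pose eta := eps / (8 * expR S).
have S0 := expR_gt0 S.
have eta0 : 0 < eta by rewrite divr_gt0 // mulr_gt0.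
have [M hM] : exists M, forall N, (M <= N)%N -> \sum_(M <= l < N) B l <= eta.
  have c : cvgn (series B).
    apply: (@cvgR_series_abs _ _ S) => N; apply: le_trans (hS N).
    by apply: ler_sum => l _; rewrite ger0_norm.
  have /cvgR_dist/(_ _ eta0)[M hM] := c.
  exists M => N MN; have := hM M (leqnn _); rewrite ltr_norml => /andP[h _].
  have : series B N <= limn (series B).
    apply: (nondecreasing_cvgn_le _ c).
    by apply/nondecreasing_series => n _ _; exact: B0.
  rewrite /series /= (big_cat_nat _ MN) //=; move: h; rewrite /series /=.
  set X := limn _; lra.
pose L := K * r ^+ m * rho.
have L0 : 0 <= L.
  by rewrite !mulr_ge0 ?expR_ge0 ?exprn_ge0 ?mulr_ge0 ?(ltW (s_gt0 0%N)).
have [|N1 hN1] := @mu_cvg M (eta / (L + 1)).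
  by rewrite divr_gt0 // ltr_wpDl.
exists (maxn N1 M.+1) => N; rewrite geq_max => /andP[N1N MN] z zr.
have h1 : cabs (\prod_(0 <= l < N) E (z * rc (mu N l)) - p z N) <= expR S * (3 * eta).
  apply: le_trans (prod_sub_le (B := B) B0 _ _) _.
  - by move=> l lN; apply: factor_le => //; [exact: mu_gt0|exact: mu_le].
  - by move=> l _; exact: factor_le.
  apply: ler_pM; first by apply: prodr_ge0 => l _; rewrite addr_ge0.
  - by apply: sumr_ge0 => l _; exact: cabs_ge0.
  - by apply: le_trans (prod1D_le_expR _ B0) _; rewrite ler_expR.
  rewrite (big_cat_nat _ MN) //=.
  (* The first [M + 1] factors are close because [mu] is close to [s]; beyond them both factors are
     within [B l] of [1], whence the coefficient [2]. *)
  have -> : 3 * eta = eta + 2 * eta by ring.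
  apply: lerD.
    apply: (@le_trans _ _ (L * \sum_(0 <= l < M.+1) (s l - mu N l))).
      rewrite mulr_sumr big_nat [leRHS]big_nat; apply: ler_sum => l /andP[_ lM].
      have lN : (l < N)%N by exact: leq_trans lM MN.
      by apply: factor_sub => //; [exact: mu_gt0|exact: mu_le].
    apply: (@le_trans _ _ (L * (eta / (L + 1)))); first by rewrite ler_wpM2l // hN1.
    by rewrite mulrCA ler_piMr ?(ltW eta0) // ler_pdivrMr ?ltr_wpDl // mul1r lerDl.
  apply: (@le_trans _ _ (2 * \sum_(M.+1 <= l < N) B l)).
    rewrite mulr_sumr big_nat [leRHS]big_nat; apply: ler_sum => l /andP[_ lN].
    have e1 := factor_near1 zr (mu_gt0 lN) (mu_le lN).
    have e2 := factor_near1 zr (s_gt0 l) (sle l).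
    apply: le_trans (cabs_sub_near1 _ _) _.
    by rewrite mulr2n mulrDl mul1r; exact: lerD.
  apply: ler_wpM2l; first exact: ler0n.
  apply: le_trans (hM N (ltnW MN)).
  by rewrite [leRHS]big_ltn // lerDr.
have h2 : cabs (p z N - limit z) <= expR S * eta.
  have cv : (fun L => cabs (p z L - p z N)) @ \oo --> cabs (limit z - p z N).
    by apply: cvg_cabs; apply: cvgB (cvg_cst _); exact: p_cvg.
  rewrite cabs_distrC; apply: (cvgR_le (N := N) cv) => L' NL.
  apply: le_trans (p_tail zr hS NL) _; rewrite ler_wpM2l ?expR_ge0 //.
  have ML : (M <= L')%N := leq_trans (ltnW MN) NL.
  apply: le_trans (hM L' ML); rewrite [leRHS](big_cat_nat (ltnW MN) NL) //= lerDr.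
  by apply: sumr_ge0 => l _; exact: B0.
have -> : \prod_(0 <= l < N) E (z * rc (mu N l)) - limit z =
    (\prod_(0 <= l < N) E (z * rc (mu N l)) - p z N) + (p z N - limit z) by ring.
apply: le_lt_trans (cabsD _ _) _; apply: le_lt_trans (lerD h1 h2) _.
have -> : expR S * (3 * eta) + expR S * eta = eps / 2.
  by rewrite /eta; field; rewrite gt_eqF.
by rewrite ltr_pdivrMr // ltr_pMr // ltr1n.
Qed.

End Disc.

Lemma tannery : locally_uniform_cvg
  (fun N (z : C) => \prod_(0 <= l < N) E (z * rc (mu N l)))
  (fun z => limn (fun N => \prod_(0 <= j < N) E (z * rc (s j)))).
Proof.
move=> z0; exists (ball z0 1); first exact: nbhsx_ballx.
apply: uniform_cvg_dist => eps e0.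
have r0 : 0 <= cabs z0 + 1 by rewrite addr_ge0 // cabs_ge0.
have [N0 hN0] := tannery_disc r0 e0; exists N0 => n Nn z.
rewrite -ball_normE /= normE -rc1 rc_lt => hz; apply: hN0 => //.
rewrite -[z](subrK z0) addrC; apply: le_trans (cabsD _ _) _.
by rewrite lerD2l cabs_distrC ltW.
Qed.

End Tannery.

(** * Assembly: the ordered eigenbasis of [T] and the limit of the determinants *)

Lemma spectrum_and_eigenvalues (R : realType) (a b : nat -> R) (k : nat) :
  (forall n, 0 < a n) -> (0 < k)%N -> positive_op (jacobi_op a b) ->
  schatten k (op_inv (friedrichs (jacobi_op a b))) ->
  exists (e : nat -> nat -> Cplx R) (s : nat -> R),
    [/\ hilbert_basis e,
       forall j, 0 < s j /\ op_inv (friedrichs (jacobi_op a b))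
         (e j, fun n => rc (s j) * e j n),
       forall m n, (m < n)%N -> s n < s m &
       exists M, forall N, \sum_(0 <= j < N) s j ^+ k <= M].
Proof.
move=> a0 k0 Jp [[Tb _] [s sing ssum]].
have [e eb se] := singular_eigen Jp Tb sing.
have s0 j : 0 < s j by have [] := se j.
have sinj := eigen_simple Tb a0 eb se.
have sto0 := summable_to0 k0 s0 ssum.
have [sg [sdec sginj sgsurj]] := decreasing_rearrangement s0 sinj sto0.
exists (fun j => e (sg j)), (fun j => s (sg j)); split=> //.
- have [le oe comp] := eb; split=> // [i j|u lu h]; first by rewrite oe (inj_eq sginj).
  by apply: comp => // i; have [j <-] := sgsurj i.
- have sk0 j : 0 <= s j ^+ k by rewrite exprn_ge0 // ltW.
  have [M hM] := (nneseries_ltyP sk0).1 ssum.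
  exists M => N; pose l := map sg (index_iota 0 N).
  (* The first [N] rearranged indices all lie below [K], so their terms are among the first [K]
     terms of the original series. *)
  pose K := (\max_(i <- l) i).+1.
  apply: le_trans (hM K).
  rewrite -(big_map sg xpredT (fun i => s i ^+ k)).
  apply: sum_uniq_le => //; first by rewrite (map_inj_uniq sginj) iota_uniq.
  by move=> i il; rewrite ltnS; exact: leq_bigmax_seq.
Qed.

Theorem theorem4p7 (R : realType) (a b : nat -> R) (k : nat)
    (a_gt0 : forall n, 0 < a n) (k_gt0 : (0 < k)%N)
    (J_pos : positive_op (jacobi_op a b))
    (J_schatten : schatten k (op_inv (friedrichs (jacobi_op a b)))) :
  exists zeta : nat -> R,
    spectral_sequence k (friedrichs (jacobi_op a b)) zeta /\
    locally_uniform_cvg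
      (fun (n : nat) (z : Cplx R) =>
         \det (hfc (elem_factor k.-1) (z *: invmx (jacobi_trunc a b n))))
      (reg_char_fun k zeta).
Proof.
have [e [s [eb se sdec ssum]]] := spectrum_and_eigenvalues a_gt0 k_gt0 J_pos J_schatten.
have [[Tb _] _] := J_schatten.
have s0 j : 0 < s j by have [] := se j.
have sk0 j : 0 <= s j ^+ k by rewrite exprn_ge0 // ltW.
have ssum_lty := (nneseries_ltyP sk0).2 ssum.
have sto0 := summable_to0 k_gt0 s0 ssum_lty.
exists (fun j => (s j)^-1); split.
  split.
  - by rewrite invr_gt0.
  - by move=> i j ij; rewrite ltf_pV2 ?posrE // sdec.
  - exact: etrans (spectrum_friedrichs J_pos Tb eb se sto0) _.
  - by move=> j; refine (eigenvalue_simple J_pos Tb eb se sdec j).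
  - by under eq_eseriesr do rewrite exprVn invrK.
have /choice[mu hmu] N : exists mu, exists v, [/\ spectral_data a b N v mu,
    forall i j, (i <= j)%N -> (j < N)%N -> mu j <= mu i & trunc_det a b N mu].
  by have [v [mu h]] := exists_spectral_data J_pos Tb N; exists mu, v.
have mu_gt0 N l : (l < N)%N -> 0 < mu N l.
  by have [v [[_ _ h _ _] _ _]] := hmu N; exact: h.
have mu_le N l : (l < N)%N -> mu N l <= s l.
  have [v [vmu mono _]] := hmu N => lN.
  exact: (trunc_eigen_le J_pos Tb eb se sdec vmu mono lN).
have mu_cvg M (eps : R) : 0 < eps -> exists N0, forall N, (N0 <= N)%N ->
    \sum_(0 <= l < M.+1) (s l - mu N l) <= eps.
  (* [eigen_gap_le] adds up [M + 1] errors. *)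
  move=> e0; have e1 : 0 < eps / M.+1%:R by rewrite divr_gt0 // ltr0n.
  have [N0 hN0] := trial_vectors J_pos Tb eb se M.+1 e1.
  exists (maxn N0 M.+1) => N; rewrite geq_max => /andP[N0N MN].
  have [v [vmu mono _]] := hmu N.
  have := eigen_gap_le eb vmu mono MN (hN0 N N0N).
  by rewrite mulrC divfK // pnatr_eq0.
have s_le0 j : s j <= s 0%N by case: j => // j; exact/ltW/sdec.
case: k k_gt0 ssum {J_schatten sk0 ssum_lty} => // m _ ssum /=.
have tan := @tannery R m s s0 s_le0 ssum mu mu_gt0 mu_le mu_cvg.
apply: (locally_uniform_cvg_ext _ _ tan) => [N z|z].
  by have [v [_ _ ->]] := hmu N.
rewrite /reg_char_fun; congr (limn _); apply/funext => N.
by apply: eq_bigr => j _; rewrite -/(rc _) rcV invrK.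
Qed.
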